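(* Let $\nu>-\frac12$ and denote the radius of starlikeness $r^\star(f_\nu)$ by $\gamma_{\nu,1}'$. Then $$r^\star(f_\nu)=\gamma_{\nu,1}'<\sqrt[4]{4(\nu+1)_3(2\nu+1)}.$$ Moreover, $$\sqrt[4]{\frac{16(2\nu+1)(\nu+1)_3}{2\nu+5}}<\gamma_{\nu,1}'<\sqrt[4]{\frac{16(2\nu+1)(2\nu+5)(\nu+1)_5}{20\nu^3+184\nu^2+529\nu+473}},$$ $$\sqrt[8]{\frac{2^8(2\nu+1)^2(\nu+1)_3(\nu+1)_5}{20\nu^3+184\nu^2+529\nu+473}}<\gamma_{\nu,1}'<\sqrt[4]{\frac{8(\nu+1)_3(\nu+6)(\nu+7)(2\nu+1)(20\nu^3+184\nu^2+529\nu+473)}{\nu_1}}$$ and $$\sqrt[12]{\frac{2^{11}(2\nu+1)^3((\nu+1)_3)^2(\nu+1)_7}{\nu_1}}<\gamma_{\nu,1}'<\sqrt[4]{\frac{32(\nu+1)_5(\nu+8)(\nu+9)(2\nu+1)\nu_1}{\nu_2}},$$ where $$\nu_1=168\nu^5+2876\nu^4+18590\nu^3+57349\nu^2+84874\nu+48267$$ and $$\nu_2=6864\nu^9+245792\nu^8+3802808\nu^7+33438984\nu^6+184372941\nu^5+661304856\nu^4+1542867228\nu^3+2256870262\nu^2+1877042671\nu+675828138.$$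
   Context: For $\nu>-1$, with $J_\nu,I_\nu$ the Bessel and modified Bessel functions of the first kind, $$\mathbf{\Phi}_\nu(z)=J_\nu(z)I_\nu'(z)-J_\nu'(z)I_\nu(z)=2\sum_{n\ge0}\frac{(-1)^n(z/2)^{2\nu+4n+1}}{n!\,\Gamma(\nu+n+1)\Gamma(\nu+2n+2)},$$ and for $\nu\ne-\frac12$, $f_\nu(z)=\left(2^{2\nu}\Gamma(\nu+1)\Gamma(\nu+2)\mathbf{\Phi}_\nu(z)\right)^{\frac{1}{2\nu+1}}$, with the branch chosen so that $f_\nu$ is analytic near $0$, $f_\nu(0)=0$, $f_\nu'(0)=1$; in particular $zf_\nu'(z)/f_\nu(z)=\frac{1}{2\nu+1}z\mathbf{\Phi}_\nu'(z)/\mathbf{\Phi}_\nu(z)$. The radius of starlikeness is $r^\star(f)=\sup\{r>0:\operatorname{Re}(zf'(z)/f(z))>0\text{ for all }|z|<r\}$. The number $\gamma_{\nu,1}'$ is also the first positive zero of $\mathbf{\Phi}_\nu'$. Pochhammer symbol: $(a)_n=a(a+1)\cdots(a+n-1)$. *)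

(* Defs.v *)
From HB Require Import structures.
From mathcomp Require Import all_boot all_order all_algebra.
From mathcomp Require Import complex.
From mathcomp Require Import all_classical all_reals all_analysis.

Set Implicit Arguments.
Unset Strict Implicit.
Unset Printing Implicit Defensive.

Import Order.TTheory GRing.Theory Num.Theory.
Import numFieldNormedType.Exports.

Local Open Scope classical_set_scope.
Local Open Scope ring_scope.
Local Open Scope complex_scope.

(* R[i] as a numFieldType: it carries the topology of its norm, so that
   [derivable f z 1] and [derive1 f] below are complex differentiability and the
   complex derivative. *)
Definition Cplx (R : realType) : numFieldType := R[i].

Section ComplexFunctions.
Context {R : realType}.
Implicit Types (x a : R) (z : Cplx R).

Definition toC x : Cplx R := x%:C.

Definition cexp z : Cplx R :=
  toC (expR (complex.Re z)) * (cos (complex.Im z) +i* sin (complex.Im z)).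

(* Principal argument, with values in ]-pi, pi] for z != 0. *)
Definition carg z : R :=
  let t := acos (complex.Re z / complex.Re `|z|) in
  if 0 <= complex.Im z then t else - t.

Definition clog z : Cplx R :=
  (ln (complex.Re `|z|) +i* carg z).

(* Principal power z^a; the value at z = 0 is irrelevant. *)
Definition cpow z a : Cplx R := cexp (toC a * clog z).

(* The plane cut along the closed negative half-axis. *)
Definition slit_plane : set (Cplx R) :=
  [set z | complex.Im z != 0 \/ 0 < complex.Re z].

Definition disc (r : R) : set (Cplx R) := [set z | `|z| < toC r].

Definition holomorphic_on (U : set (Cplx R)) (f : Cplx R -> Cplx R) : Prop :=
  forall z, U z -> derivable f z 1.

(* f is an analytic branch on U of the power h^a, i.e. f = exp (a L) for an
   analytic branch L of log h. *)
Definition power_branch (U : set (Cplx R)) (h : Cplx R -> Cplx R) a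
    (f : Cplx R -> Cplx R) : Prop :=
  exists L : Cplx R -> Cplx R,
    [/\ holomorphic_on U L,
        forall z, U z -> cexp (L z) = h z &
        forall z, U z -> f z = cexp (toC a * L z)].

(* sup {r > 0 : Re (z f'(z) / f(z)) > 0 for all |z| < r}, for f normalized by
   f(0) = 0 and f'(0) = 1: the quotient has the limit 1 at the origin, so only
   z != 0 is tested. *)
Definition radius_of_starlikeness (f : Cplx R -> Cplx R) : \bar R :=
  ereal_sup [set r%:E | r in [set r : R | 0 < r /\
    forall z, z != 0 -> disc r z -> 0 < complex.Re (z * derive1 f z / f z)]].

Definition first_positive_zero (F : Cplx R -> Cplx R) (x : R) : Prop :=
  [/\ 0 < x, F (toC x) = 0 & forall y : R, 0 < y < x -> F (toC y) != 0].

End ComplexFunctions.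

Section Bessel.
Context {R : realType}.
Implicit Types (x nu : R) (z : Cplx R).

(* Euler's integral; only used at x > 0. *)
Definition Gamma x : R :=
  Rintegral lebesgue_measure `]0, +oo[ (fun t : R => t `^ (x - 1) * expR (- t)).

Definition pochhammer x (n : nat) : R := \prod_(i < n) (x + i%:R).

Definition besselJ nu z : Cplx R := limn (series (fun n : nat =>
  toC ((-1) ^+ n / (n`!%:R * Gamma (nu + n%:R + 1)))
    * cpow (z / 2) (2 * n%:R + nu))).

Definition besselI nu z : Cplx R := limn (series (fun n : nat =>
  toC (1 / (n`!%:R * Gamma (nu + n%:R + 1)))
    * cpow (z / 2) (2 * n%:R + nu))).

(* Principal determination, holomorphic on the slit plane. *)
Definition Phi nu z : Cplx R :=
  besselJ nu z * derive1 (besselI nu) z - derive1 (besselJ nu) z * besselI nu z.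

(* The normalized branch of
     (2^(2 nu) Gamma(nu+1) Gamma(nu+2) Phi_nu)^(1/(2 nu+1)):
   it is holomorphic on every disc |z| < r in which Phi_nu has no zero other
   than the origin (zeros on the negative half-axis need no separate mention,
   Phi_nu(-z) being Phi_nu(z) up to a phase factor).  The multivalued identity
   is imposed off the cut of Phi_nu; together with f(0) = 0 and f'(0) = 1 it
   determines f on the union of these discs. *)
Definition is_fnu nu (f : Cplx R -> Cplx R) : Prop :=
  [/\ f 0 = 0, is_derive (0 : Cplx R) 1 f 1 &
      forall r : R, 0 < r ->
        (forall z, disc r z -> slit_plane z -> Phi nu z != 0) ->
        holomorphic_on (disc r) f /\
        power_branch (disc r `&` slit_plane)
          (fun z => toC (2 `^ (2 * nu) * Gamma (nu + 1) * Gamma (nu + 2))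
                      * Phi nu z)
          (1 / (2 * nu + 1)) f].

(* Outside the union of the discs of is_fnu the value of f_nu is arbitrary; the
   first positive zero of Phi_nu', where z f'/f vanishes, lies inside it, so the
   radius of starlikeness does not depend on this choice. *)
Definition fnu nu : Cplx R -> Cplx R :=
  match pselect (exists f, is_fnu nu f) with
  | left fP => projT1 (cid fP)
  | right _ => fun z => z
  end.

(* The integer with the given groups of three decimal digits, e.g.
   thousands [:: 1; 234; 5] is 1 234 005: the numerals of ring_scope are unary
   and cannot hold the coefficients below. *)
Definition thousands (s : seq nat) : R :=
  foldl (fun acc d => acc * 1000 + d%:R) 0 s.

Definition nu_1 nu : R :=
  168 * nu ^+ 5
  + thousands [:: 2; 876]%N * nu ^+ 4
  + thousands [:: 18; 590]%N * nu ^+ 3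
  + thousands [:: 57; 349]%N * nu ^+ 2
  + thousands [:: 84; 874]%N * nu
  + thousands [:: 48; 267]%N.

Definition nu_2 nu : R :=
  thousands [:: 6; 864]%N * nu ^+ 9
  + thousands [:: 245; 792]%N * nu ^+ 8
  + thousands [:: 3; 802; 808]%N * nu ^+ 7
  + thousands [:: 33; 438; 984]%N * nu ^+ 6
  + thousands [:: 184; 372; 941]%N * nu ^+ 5
  + thousands [:: 661; 304; 856]%N * nu ^+ 4
  + thousands [:: 1; 542; 867; 228]%N * nu ^+ 3
  + thousands [:: 2; 256; 870; 262]%N * nu ^+ 2
  + thousands [:: 1; 877; 42; 671]%N * nu
  + thousands [:: 675; 828; 138]%N.

End Bessel.

(* Main.v *)
Require Import Defs.
From HB Require Import structures.
From mathcomp Require Import all_boot all_order all_algebra.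
From mathcomp Require Import complex.
From mathcomp Require Import all_classical all_reals all_analysis.
From mathcomp Require Import measurable_realfun ring lra.

(** Let [w = z ^ 4] and [b = (2 nu + 1) / 4]. Multiplying out the two Bessel
    series gives
      [2 ^ (2 nu) Gamma(nu+1) Gamma(nu+2) Phi_nu(z) = z ^ (2 nu + 1) G(w)], where
      [G(w) = sum_n (-1)^n w^n / (16^n n! (nu+1)_n (nu+2)_(2n))],
    so that [z f' / f = H(w) / G(w)] with [H = G + w G' / b], and [Phi_nu'] is
    [H(w)] times a factor without zeros ([Phi_slit], [derive1_Phi]). Everything is
    thus about the first zeros of the two entire functions [G] and [H] of [w].

    Sums over the zeros, without a factorization theorem. Both functions are
    coefficientwise limits of polynomials whose roots are all positive: start from
    [(1 - w / N) ^ N] and apply operators [p + w p' / a] with [a > 0], which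
    multiply the coefficient of [w^n] by [1 + n / a] and, by Euler's product,
    create the Pochhammer symbols in the limit. Such an operator keeps the roots
    positive, since at a complex root the imaginary parts of the terms of [w p' / p]
    could not cancel ([pos_rooted_euler]). The power sums [s_n], of exponent
    [n + 1], of the inverse roots of these polynomials satisfy
    [s_(n+1)^2 <= s_n s_(n+2)] and [s_(m+n+1) <= s_m s_n]. Newton's identities
    compute them from the coefficients, so that both inequalities pass to the
    limit ([hyper_moment_like]).

    The first zero. Let [m] be the limit of the nondecreasing ratios
    [s_(n+1) / s_n]. Then [m^(n+1) <= s_n] and [s_(n+1) <= m s_n]
    ([moment_growth]). For [|w| < 1/m] the function is
    [exp (- sum_n s_n w^(n+1) / (n+1))], hence not zero ([cps_exp]); and it
    vanishes at [1/m], where its logarithmic derivative blows up although its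
    derivative is bounded ([cps_root]).

    Starlikeness. With the power sums [s_n > 0] of [G],
    [H / G = 1 - (w / b) sum_n s_n w^n]; on a circle its real part is smallest at
    the positive point. On the positive axis it is positive before the first zero
    of [H] and zero there, provided that this zero comes before the first zero of
    [G]; it does, because the sum is unbounded near the latter ([growth_lt]).

    The bounds. They are [m^(k+1) < s_k] and [s_(k+1) < m s_k] for the power sums
    [s_0, ..., s_3] of [H], which Newton's identities make explicit
    ([moment_values], [zero_bounds]). The inequalities are strict because one
    equality [s_(k+1) = m s_k] would force a recurrence with finitely many terms on
    the coefficients of [H], which decrease too fast to satisfy it
    ([growth_strict]).

    The function [f_nu]. It exists, being [z] times the exponential of
    [1 / (2 nu + 1)] times the logarithm of [G] ([is_fnu_froot]). Any other
    solution is a constant multiple of it, because two logarithms of the same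
    function differ by a constant on a slit disc ([fnu_unique]); so [z f' / f] is
    well defined. *)

Set Implicit Arguments.
Unset Strict Implicit.
Unset Printing Implicit Defensive.
Import Order.TTheory GRing.Theory Num.Theory.
Import numFieldNormedType.Exports.
Local Open Scope classical_set_scope.
Local Open Scope ring_scope.

(** * Modulus and derivatives on the complex plane *)

(** Without the division by [h], error terms can be added and composed as they
    stand. *)
Lemma is_derive_norm (K : numFieldType) (f : K -> K) (z l : K) :
  is_derive z 1 f l <->
  (forall e, 0 < e -> exists2 d, 0 < d &
    forall h, `|h| < d -> `|f (z + h) - f z - l * h| <= e * `|h|).
Proof.
have quot h : h != 0 ->
    `|h^-1 *: ((f \o shift z) (h *: 1) - f z) - l| =
    `|f (z + h) - f z - l * h| / `|h|.
  move=> h0; rewrite -normfV -normrM; congr `|_|.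
  by rewrite /= /GRing.scale/= mulr1 (addrC h) mulrBl mulfK// mulrC.
split=> [[fz fE] e e0|H].
  have /cvgrPdist_lt : h^-1 *: ((f \o shift z) (h *: 1) - f z) @[h --> 0^']
    --> l by rewrite -fE; exact: fz.
  move=> /(_ e e0); rewrite /dnbhs/within/= => /nbhs_ballP[d d0 dP].
  exists d => // h hd.
  have [->|h0] := eqVneq h 0; first by rewrite !addr0 mulr0 subrr subr0 normr0 mulr0.
  have := dP h; rewrite -ball_normE/= sub0r normrN => /(_ hd h0).
  by rewrite (distrC l) [X in X < _](quot h h0) ltr_pdivrMr ?normr_gt0// => /ltW.
have cvgf : h^-1 *: ((f \o shift z) (h *: 1) - f z) @[h --> 0^'] --> l.
  apply/cvgrPdist_lt => e e0.
  rewrite /dnbhs/within/=; apply/nbhs_ballP.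
  have e20 : 0 < e / 2 by rewrite divr_gt0.
  have [d d0 dP] := H _ e20; exists d => // h.
  rewrite -ball_normE/= sub0r normrN => hd h0.
  rewrite (distrC l) [X in X < _](quot h h0) ltr_pdivrMr ?normr_gt0//.
  apply: le_lt_trans (dP _ hd) _; rewrite ltr_pM2r ?normr_gt0//.
  by rewrite ltr_pdivrMr// ltr_pMr// ltr1n.
split; first by apply/cvg_ex; exists l.
by apply: cvg_lim => //; exact: norm_hausdorff.
Qed.

Lemma is_derive_comp (K : numFieldType) (f g : K -> K) (z df dg : K) :
  is_derive (g z) 1 f df -> is_derive z 1 g dg ->
  is_derive z 1 (fun w => f (g w)) (df * dg).
Proof.
move=> [/derivable1_diffP fd fE] [/derivable1_diffP gd gE].
have fgd : differentiable (f \o g) z by exact: differentiable_comp.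
split; first exact/derivable1_diffP.
have fE' : 'd f (g z) 1 = df by rewrite -(derive1E' fd) derive1E.
have gE' : 'd g z 1 = dg by rewrite -(derive1E' gd) derive1E.
rewrite -derive1E (derive1E' fgd).
rewrite (diff_comp gd fd) -fE' -gE' /= -[X in 'd f _ X = _]mulr1.
by rewrite [LHS]linearZ mulrC.
Qed.

Lemma is_derive_mul (K : numFieldType) (f g : K -> K) (z df dg : K) :
  is_derive z 1 f df -> is_derive z 1 g dg ->
  is_derive z 1 (fun w => f w * g w) (f z * dg + df * g z).
Proof. by move=> fz gz; apply: is_derive_eq; rewrite /GRing.scale/= (mulrC df). Qed.

Lemma is_derive_add (K : numFieldType) (f g : K -> K) (z df dg : K) :
  is_derive z 1 f df -> is_derive z 1 g dg ->
  is_derive z 1 (fun w => f w + g w) (df + dg).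
Proof. exact: is_deriveD. Qed.

Lemma is_derive_inv (K : numFieldType) (f : K -> K) (z df : K) : f z != 0 ->
  is_derive z 1 f df -> is_derive z 1 (fun w => (f w)^-1) (- (f z) ^- 2 * df).
Proof.
move=> f0 [fd <-]; split; first exact: derivableV.
by rewrite deriveV.
Qed.

Section ComplexBasics.
Context {R : realType}.
Local Notation C := (Cplx R).
Implicit Types (x y e r t : R) (z w h : C).

(* [toC] is a new constant, so the lemmas on ring morphisms do not see through it. *)
HB.instance Definition _ := GRing.RMorphism.copy (@toC R) (real_complex R).

(** The norm on the plane has values in the plane; estimates need a real number. *)
Definition cabs z : R := complex.Re `|z|.

Lemma cabsE z : `|z| = toC (cabs z).
Proof. by []. Qed.

Lemma toC_inj : injective (@toC R).
Proof. by move=> x y []. Qed.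

Lemma lt_toC x y : (toC x < toC y) = (x < y).
Proof. exact: ltcR. Qed.

Lemma le_toC x y : (toC x <= toC y) = (x <= y).
Proof. exact: lecR. Qed.

Lemma cabsM z w : cabs (z * w) = cabs z * cabs w.
Proof. by apply: toC_inj; rewrite rmorphM -!cabsE normrM. Qed.

Lemma cabsX z n : cabs (z ^+ n) = cabs z ^+ n.
Proof. by apply: toC_inj; rewrite rmorphXn -!cabsE normrX. Qed.

Lemma cabsV z : cabs z^-1 = (cabs z)^-1.
Proof. by apply: toC_inj; rewrite fmorphV -!cabsE normfV. Qed.

Lemma cabsN z : cabs (- z) = cabs z.
Proof. by apply: toC_inj; rewrite -!cabsE normrN. Qed.

Lemma cabs_ge0 z : 0 <= cabs z.
Proof. by rewrite -le_toC rmorph0 -cabsE. Qed.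

Lemma cabs0 : cabs 0 = 0.
Proof. by apply: toC_inj; rewrite -cabsE normr0. Qed.

Lemma cabs_eq0 z : (cabs z == 0) = (z == 0).
Proof. by rewrite -(inj_eq toC_inj) -cabsE rmorph0 normr_eq0. Qed.

Lemma cabs_gt0 z : (0 < cabs z) = (z != 0).
Proof. by rewrite lt0r cabs_ge0 andbT cabs_eq0. Qed.

Lemma ler_cabsD z w : cabs (z + w) <= cabs z + cabs w.
Proof. by rewrite -le_toC rmorphD -!cabsE ler_normD. Qed.

Lemma cabs_distC z w : cabs (z - w) = cabs (w - z).
Proof. by rewrite -cabsN opprB. Qed.

Lemma ler_cabs_sum I (s : seq I) (P : pred I) (F : I -> C) :
  cabs (\sum_(i <- s | P i) F i) <= \sum_(i <- s | P i) cabs (F i).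
Proof.
elim/big_rec2: _ => [|i y z _ yz]; first by rewrite cabs0.
by rewrite (le_trans (ler_cabsD _ _))// lerD2l.
Qed.

Lemma cabs_toC x : cabs (toC x) = `|x|.
Proof. by rewrite /cabs /toC normc_def/= expr0n addr0 sqrtr_sqr. Qed.

Lemma cabs_sqr z : cabs z ^+ 2 = complex.Re z ^+ 2 + complex.Im z ^+ 2.
Proof. by rewrite /cabs normc_def/= sqr_sqrtr// addr_ge0// sqr_ge0. Qed.

Lemma Re_le_cabs z : `|complex.Re z| <= cabs z.
Proof.
rewrite -(ler_pXn2r (_ : 0 < 2)%N) ?nnegrE ?normr_ge0 ?cabs_ge0//.
by rewrite cabs_sqr real_normK ?num_real// lerDl sqr_ge0.
Qed.

Lemma Im_le_cabs z : `|complex.Im z| <= cabs z.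
Proof.
rewrite -(ler_pXn2r (_ : 0 < 2)%N) ?nnegrE ?normr_ge0 ?cabs_ge0//.
by rewrite cabs_sqr real_normK ?num_real// lerDr sqr_ge0.
Qed.

Lemma ReD z w : complex.Re (z + w) = complex.Re z + complex.Re w.
Proof. by case: z w => a b [c d]. Qed.

Lemma ImD z w : complex.Im (z + w) = complex.Im z + complex.Im w.
Proof. by case: z w => a b [c d]. Qed.

Lemma ReN z : complex.Re (- z) = - complex.Re z.
Proof. by case: z. Qed.

Lemma ImN z : complex.Im (- z) = - complex.Im z.
Proof. by case: z. Qed.

Lemma Re_toCM x z : complex.Re (toC x * z) = x * complex.Re z.
Proof. by case: z => a b /=; rewrite mul0r subr0. Qed.

Lemma Im_toCM x z : complex.Im (toC x * z) = x * complex.Im z.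
Proof. by case: z => a b /=; rewrite mul0r addr0. Qed.

Lemma ReM z w : complex.Re (z * w) =
  complex.Re z * complex.Re w - complex.Im z * complex.Im w.
Proof. by case: z w => a b [c d]. Qed.

Lemma ImM z w : complex.Im (z * w) =
  complex.Re z * complex.Im w + complex.Im z * complex.Re w.
Proof. by case: z w => a b [c d]/=; rewrite addrC. Qed.

Lemma cplx_eq z w : complex.Re z = complex.Re w -> complex.Im z = complex.Im w ->
  z = w.
Proof. by case: z w => a b [c d] /= -> ->. Qed.

Lemma toC_Re z : complex.Im z = 0 -> z = toC (complex.Re z).
Proof. by move=> zi; apply: cplx_eq. Qed.

Lemma cabs_i : cabs ('i%C : C) = 1.
Proof.
apply/eqP; rewrite -(eqrXn2 (_ : 0 < 2)%N) ?cabs_ge0// cabs_sqr/=.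
by rewrite expr0n expr1n add0r.
Qed.

Lemma cabs_le_ReIm z : cabs z <= `|complex.Re z| + `|complex.Im z|.
Proof.
have {1}-> : z = toC (complex.Re z) + 'i%C * toC (complex.Im z).
  by apply: cplx_eq; rewrite ?(ReD, ImD, ReM, ImM)/=; ring.
apply: le_trans (ler_cabsD _ _) _.
by rewrite cabsM cabs_i mul1r !cabs_toC.
Qed.

(** A positive complex number is real. This is why tolerances and radii are taken
    real in the four statements that follow. *)
Lemma cplx_gt0 (e : C) : 0 < e -> exists2 x, 0 < x & e = toC x.
Proof.
case: e => a b; rewrite ltcE/= => /andP[/eqP -> a0].
by exists a.
Qed.

Lemma cvg_cabs (u : nat -> C) (l : C) : u @ \oo --> l <->
  (forall e, 0 < e -> \forall n \near \oo, cabs (u n - l) < e).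
Proof.
split=> [/cvgrPdist_lt ul e e0|ul].
  have := ul (toC e); rewrite -[0 : C](rmorph0 (@toC R)) lt_toC => /(_ e0).
  by apply: filterS => n; rewrite cabsE lt_toC cabs_distC.
apply/cvgrPdist_lt => _ /cplx_gt0[e e0 ->].
by have := ul _ e0; apply: filterS => n; rewrite cabsE lt_toC cabs_distC.
Qed.

Lemma nbhs_cabs z (P : C -> Prop) : (\forall w \near z, P w) <->
  exists2 d, 0 < d & forall w, cabs (w - z) < d -> P w.
Proof.
split.
  move=> /nbhs_ballP[_ /cplx_gt0[e e0 ->]] eP; exists e => // w wz.
  by apply: eP; rewrite -ball_normE/= cabsE lt_toC cabs_distC.
move=> [d d0 dP]; apply/nbhs_ballP; exists (toC d) => /=.
  by rewrite -[0 : C](rmorph0 (@toC R)) lt_toC.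
move=> w; rewrite -ball_normE/= cabsE lt_toC cabs_distC; exact: dP.
Qed.

Lemma continuous_cabs (f : C -> C) z : {for z, continuous f} <->
  (forall e, 0 < e -> exists2 d, 0 < d &
    forall w, cabs (w - z) < d -> cabs (f w - f z) < e).
Proof.
split=> [/cvgrPdist_lt fz e e0|fz].
  have := fz (toC e); rewrite -[0 : C](rmorph0 (@toC R)) lt_toC => /(_ e0).
  move=> /nbhs_cabs[d d0 dP]; exists d => // w /dP.
  by rewrite cabsE lt_toC cabs_distC.
apply/(@cvgrPdist_lt _ _ _ (nbhs z) (nbhs_filter z)) => _ /cplx_gt0[e e0 ->].
apply/nbhs_cabs; have [d d0 dP] := fz _ e0; exists d => // w /dP.
by rewrite cabsE lt_toC cabs_distC.
Qed.

Lemma is_derive_cabs (f : C -> C) z (l : C) : is_derive z 1 f l <->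
  (forall e, 0 < e -> exists2 d, 0 < d &
    forall h, cabs h < d -> cabs (f (z + h) - f z - l * h) <= e * cabs h).
Proof.
split=> [/is_derive_norm fz e e0|H].
  have [|_ /cplx_gt0[d d0 ->] dP] := fz (toC e).
    by rewrite -[0 : C](rmorph0 (@toC R)) lt_toC.
  exists d => // h hd; rewrite -le_toC rmorphM; apply: dP.
  by rewrite cabsE lt_toC.
apply/is_derive_norm => _ /cplx_gt0[e e0 ->].
have [d d0 dP] := H _ e0; exists (toC d).
  by rewrite -[0 : C](rmorph0 (@toC R)) lt_toC.
by move=> h; rewrite !cabsE lt_toC -rmorphM le_toC; exact: dP.
Qed.

Lemma derive1_val (f : C -> C) z (l : C) : is_derive z 1 f l -> derive1 f z = l.
Proof. by move=> fz; rewrite derive1E; apply: derive_val. Qed.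

Lemma is_derive_continuous (f : C -> C) z (l : C) :
  is_derive z 1 f l -> {for z, continuous f}.
Proof.
move=> [fz _].
by apply: differentiable_continuous; apply/derivable1_diffP.
Qed.

Lemma is_derive_Re_line (f : C -> C) z v t (l : C) :
  is_derive (z + toC t * v) 1 f l ->
  is_derive t 1 (fun s => complex.Re (f (z + toC s * v))) (complex.Re (l * v)).
Proof.
move=> /is_derive_cabs fz; apply/is_derive_norm => e e0.
have v1 : 0 < 1 + cabs v by rewrite ltr_pwDl// cabs_ge0.
have [d d0 dP] := fz (e / (1 + cabs v)) (divr_gt0 e0 v1).
exists (d / (1 + cabs v)) => [|h]; first exact: divr_gt0.
rewrite ltr_pdivlMr// => hd.
have hv : cabs (toC h * v) <= `|h| * (1 + cabs v).
  by rewrite cabsM cabs_toC ler_wpM2l// lerDr.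
have := dP _ (le_lt_trans hv hd).
have -> : z + toC t * v + toC h * v = z + toC (t + h) * v.
  by rewrite rmorphD mulrDl addrA.
move=> H; have := le_trans (Re_le_cabs _) H.
rewrite !ReD !ReN (mulrCA l) Re_toCM (mulrC h) => {}H; apply: le_trans H _.
rewrite -mulrA ler_wpM2l ?(ltW e0)// ler_pdivrMl// (mulrC (1 + _)).
exact: hv.
Qed.

(** The mean value theorem fails for complex values, so it is applied to the real
    part of [f] along the segment; the imaginary part is the real part of
    [- 'i * f]. *)
Lemma cst_on_segment (f : C -> C) z0 z1 :
  (forall t : R, 0 <= t <= 1 -> is_derive (z0 + toC t * (z1 - z0)) 1 f 0) ->
  f z1 = f z0.
Proof.
have Re_cst (g : C -> C) :
    (forall t : R, 0 <= t <= 1 -> is_derive (z0 + toC t * (z1 - z0)) 1 g 0) ->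
    complex.Re (g z1) = complex.Re (g z0).
  move=> g0; pose u t := complex.Re (g (z0 + toC t * (z1 - z0))).
  have du (t : R) : 0 <= t <= 1 -> is_derive t 1 u 0.
    by move=> /g0/is_derive_Re_line; rewrite mul0r.
  have [||c _] := @MVT_segment R u (fun=> 0) 0 1 ler01.
  - by move=> t; rewrite in_itv/= => /andP[? ?]; apply: du; rewrite !ltW.
  - apply: derivable_within_continuous => t; rewrite in_itv/= => /du[].
    by [].
  rewrite mul0r => /eqP; rewrite subr_eq0 => /eqP.
  by rewrite /u rmorph1 mul1r rmorph0 mul0r addr0 addrCA subrr addr0.
move=> f0; apply: cplx_eq; first exact: Re_cst.
have ReNi w : complex.Re (- 'i%C * w) = complex.Im w.
  by rewrite ReM/= oppr0 mul0r sub0r mulN1r opprK.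
rewrite -!ReNi; apply: (Re_cst (fun w => - 'i%C * f w)) => t /f0 ft.
have := @is_derive_mul _ (fun=> - 'i%C) f _ 0 0 (is_derive_cst _ _ _) ft.
by rewrite mulr0 mul0r addr0.
Qed.

End ComplexBasics.

(** * Absolutely convergent series and Cauchy products *)
Lemma lt_succ_ceil (R : realType) (x : R) : x < (`|Num.ceil x|%N).+1%:R.
Proof.
apply: le_lt_trans (ceil_ge _) _; rewrite -natr1.
by rewrite natr_absz ltr_pwDr// ler_int ler_norm.
Qed.

Section SequenceLimits.
Context {K : numFieldType}.
Implicit Types (u v : nat -> K) (l m : K).

Lemma lim_mul u v l m : u @ \oo --> l -> v @ \oo --> m ->
  (fun n => u n * v n) @ \oo --> l * m.
Proof. by move=> ul vm; apply: cvgM. Qed.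

Lemma lim_add u v l m : u @ \oo --> l -> v @ \oo --> m ->
  (fun n => u n + v n) @ \oo --> l + m.
Proof. by move=> ul vm; exact: (cvgD ul vm). Qed.

Lemma lim_sub u v l m : u @ \oo --> l -> v @ \oo --> m ->
  (fun n => u n - v n) @ \oo --> l - m.
Proof. by move=> ul vm; exact: (cvgB ul vm). Qed.

Lemma lim_cst l : (fun _ : nat => l) @ \oo --> l.
Proof. exact: cvg_cst. Qed.

Lemma lim_unique u l m : u @ \oo --> l -> u @ \oo --> m -> l = m.
Proof. exact: (cvg_unique (@norm_hausdorff K K)). Qed.

End SequenceLimits.

Section PowerSeries.
Context {R : realType}.
Local Notation C := (Cplx R).
Implicit Types (x y e r M t : R) (z w h : C) (a b : nat -> R) (u v : nat -> C).

Lemma bounded_series_cvg (f : nat -> R) M : (forall n, 0 <= f n) ->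
  (forall N, \sum_(n < N) f n <= M) -> cvgn (series f).
Proof.
move=> f0 fM; apply: nondecreasing_is_cvgn.
  by apply: nondecreasing_series => n _ _; exact: f0.
by exists M => _ [N _ <-]; rewrite /series/= big_mkord.
Qed.

Lemma abs_series_cvg u M : (forall N, \sum_(n < N) cabs (u n) <= M) ->
  cvgn (series u).
Proof.
move=> uM.
have comp (g : C -> R) : (forall z, `|g z| <= cabs z) ->
    cvgn (series (fun n => g (u n))).
  move=> gle; apply: normed_cvg; apply: (@bounded_series_cvg _ M) => N.
    exact: normr_ge0.
  by apply: le_trans _ (uM N); apply: ler_sum => i _; exact: gle.
have /cvg_ex[/= lr Hr] := comp (@complex.Re R) (@Re_le_cabs R).
have /cvg_ex[/= li Hi] := comp (@complex.Im R) (@Im_le_cabs R).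
have Re_sum N : complex.Re (series u N) = series (fun n => complex.Re (u n)) N.
  by rewrite /series/= (big_morph _ (@ReD R) (erefl _)).
have Im_sum N : complex.Im (series u N) = series (fun n => complex.Im (u n)) N.
  by rewrite /series/= (big_morph _ (@ImD R) (erefl _)).
suff : series u @ \oo --> (Complex lr li : C) by apply: cvgP.
apply/cvg_cabs => e e0.
have e20 : 0 < e / 2 by rewrite divr_gt0.
move/cvgrPdist_lt : Hr => /(_ _ e20) Hr; move/cvgrPdist_lt : Hi => /(_ _ e20) Hi.
near=> n; apply: le_lt_trans (cabs_le_ReIm _) _.
rewrite ReD ImD ReN ImN Re_sum Im_sum/= (splitr e) distrC [X in _ + X]distrC.
by apply: ltrD; near: n.
Unshelve. all: by end_near. Qed.

Lemma lim_cabs_le u (l : C) M : u @ \oo --> l ->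
  (\forall n \near \oo, cabs (u n) <= M) -> cabs l <= M.
Proof.
move=> /cvg_cabs ul uM; apply/ler_addgt0Pr => e e0.
have [N _ HN] := filterI (ul _ e0) uM.
have [uN uNM] := HN N (leqnn N).
have -> : l = u N - (u N - l) by rewrite opprB addrC subrK.
apply: le_trans (ler_cabsD _ _) _; rewrite cabsN.
by apply: lerD => //; apply: ltW.
Qed.

Lemma lim_Re u (l : C) : u @ \oo --> l ->
  (fun n => complex.Re (u n)) @ \oo --> complex.Re l.
Proof.
move=> /cvg_cabs ul; apply/cvgrPdist_lt => e e0; have := ul _ e0.
apply: filterS => n H; apply: le_lt_trans _ H; rewrite distrC.
by rewrite -ReN -ReD Re_le_cabs.
Qed.

Lemma lim_Im u (l : C) : u @ \oo --> l ->
  (fun n => complex.Im (u n)) @ \oo --> complex.Im l.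
Proof.
move=> /cvg_cabs ul; apply/cvgrPdist_lt => e e0; have := ul _ e0.
apply: filterS => n H; apply: le_lt_trans _ H; rewrite distrC.
by rewrite -ImN -ImD Im_le_cabs.
Qed.

Definition cauchy (K : pzRingType) (f g : nat -> K) n : K :=
  \sum_(i < n.+1) f i * g (n - i)%N.

Definition trunc (K : pzRingType) (f : nat -> K) N n := if (n < N)%N then f n else 0.

(** A product of partial sums is the value at 1 of a product of polynomials, whose
    coefficients are the Cauchy sums of the truncated sequences. *)
Lemma sum_mul_trunc (K : comNzRingType) (f g : nat -> K) N :
  (\sum_(i < N) f i) * (\sum_(i < N) g i) =
  \sum_(n < N + N) cauchy (trunc f N) (trunc g N) n.
Proof.
have hp (h : nat -> K) : \sum_(i < N) h i = (\poly_(i < N) h i).[1].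
  by rewrite horner_poly; apply: eq_bigr => i _; rewrite expr1n mulr1.
rewrite !hp -hornerM (@horner_coef_wide _ (N + N)); last first.
  apply: leq_trans (size_polyMleq _ _) _; apply: leq_trans (leq_pred _) _.
  by rewrite leq_add// size_poly.
apply: eq_bigr => n _; rewrite expr1n mulr1 coefM.
by apply: eq_bigr => i _; rewrite !coef_poly.
Qed.

Lemma cauchy_trunc (K : comNzRingType) (f g : nat -> K) N n : (n < N)%N ->
  cauchy (trunc f N) (trunc g N) n = cauchy f g n.
Proof.
move=> nN; apply: eq_bigr => i _; rewrite /trunc.
by rewrite (leq_ltn_trans _ nN) ?leq_ord// (leq_ltn_trans (leq_subr _ _) nN).
Qed.

Lemma cauchy_bounded (f g : nat -> R) M1 M2 N : (forall n, 0 <= f n) ->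
  (forall n, 0 <= g n) ->
  (forall N, \sum_(n < N) f n <= M1) -> (forall N, \sum_(n < N) g n <= M2) ->
  \sum_(n < N) cauchy f g n <= M1 * M2.
Proof.
move=> f0 g0 fM gM.
apply: (@le_trans _ _ ((\sum_(i < N) f i) * (\sum_(i < N) g i))); last first.
  by apply: ler_pM => //; apply: sumr_ge0.
rewrite sum_mul_trunc big_split_ord/=.
rewrite [X in _ <= X + _](eq_bigr (fun n : 'I_N => cauchy f g n)); last first.
  by move=> i _; rewrite cauchy_trunc.
rewrite lerDl; apply: sumr_ge0 => i _; apply: sumr_ge0 => j _.
by apply: mulr_ge0; rewrite /trunc; case: ifP.
Qed.

Lemma cabs_cauchy u v n :
  cabs (cauchy u v n) <= cauchy (fun n => cabs (u n)) (fun n => cabs (v n)) n.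
Proof.
apply: le_trans (ler_cabs_sum _ _ _) _.
by apply: ler_sum => i _; rewrite cabsM.
Qed.

Lemma cabs_cauchy_trunc u v N n :
  cabs (cauchy (trunc u N) (trunc v N) n) <=
  cauchy (fun n => cabs (u n)) (fun n => cabs (v n)) n.
Proof.
apply: le_trans (cabs_cauchy _ _ _) _.
have tr (s : nat -> C) k : cabs (trunc s N k) <= cabs (s k).
  by rewrite /trunc; case: ifP => // _; rewrite cabs0 cabs_ge0.
by apply: ler_sum => i _; apply: ler_pM; rewrite ?cabs_ge0.
Qed.

(** The product of two partial sums of length [N] and the partial sum of the
    Cauchy product differ in terms of index at least [N] only. These are dominated
    by a tail of the Cauchy product of the moduli, which converges. *)
Lemma cauchy_cvg u v M1 M2 :
  (forall N, \sum_(n < N) cabs (u n) <= M1) ->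
  (forall N, \sum_(n < N) cabs (v n) <= M2) ->
  series (cauchy u v) @ \oo --> limn (series u) * limn (series v).
Proof.
move=> uM vM.
have cu : series u @ \oo --> limn (series u) by exact: abs_series_cvg uM.
have cv : series v @ \oo --> limn (series v) by exact: abs_series_cvg vM.
set c := cauchy (fun n => cabs (u n)) (fun n => cabs (v n)).
have c0 n : 0 <= c n.
  by apply: sumr_ge0 => i _; rewrite mulr_ge0 ?cabs_ge0.
have cc : cvgn (series c).
  apply: (@bounded_series_cvg _ (M1 * M2)) => // N.
  by apply: cauchy_bounded => // n; rewrite cabs_ge0.
have := lim_mul cu cv => /cvg_cabs prodE; apply/cvg_cabs => e e0.
have e20 : 0 < e / 2 by rewrite divr_gt0.
have e40 : 0 < e / 2 / 2 by rewrite divr_gt0.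
have /cvgrPdist_lt/(_ _ e40)[N0 _ HN0] : series c @ \oo --> limn (series c) by [].
near=> N.
have N0N : (N0 <= N)%N by near: N; exact: nbhs_infty_ge.
have N0NN : (N0 <= N + N)%N by apply: leq_trans (leq_addr _ _).
rewrite -(subrKA (series u N * series v N)) (splitr e).
apply: le_lt_trans (ler_cabsD _ _) _; apply: ltrD; last by near: N; apply: prodE.
have tail : \sum_(N <= n < N + N) c n < e / 2.
  have -> : \sum_(N <= n < N + N) c n = series c (N + N)%N - series c N.
    by rewrite sub_series_geq ?leq_addr.
  have := HN0 _ N0N; have := HN0 _ N0NN; rewrite /= !ltr_distl.
  by move=> /andP[? ?] /andP[? ?]; lra.
apply: le_lt_trans _ tail; rewrite cabs_distC /series/= !big_mkord sum_mul_trunc.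
rewrite big_split_ord/= (eq_bigr (fun n : 'I_N => cauchy u v n)); last first.
  by move=> i _; rewrite cauchy_trunc.
rewrite addrAC subrr add0r.
apply: le_trans (ler_cabs_sum _ _ _) _.
have -> : \sum_(N <= n < N + N) c n = \sum_(i < N) c (i + N)%N.
  by rewrite -[X in \sum_(X <= _ < _) _]add0n big_addn addnK big_mkord.
by apply: ler_sum => i _; rewrite addnC; exact: cabs_cauchy_trunc.
Unshelve. all: by end_near. Qed.

End PowerSeries.

(** * Power series with real coefficients *)
Section RealPowerSeries.
Context {R : realType}.
Local Notation C := (Cplx R).
Implicit Types (x y e r M t : R) (z w h : C) (a b : nat -> R).

(** Absolute convergence at radius [r], as a bound on partial sums: such bounds go
    through products, derivatives and comparisons without naming a limit. *)
Definition asum a r := exists M, forall N, \sum_(n < N) `|a n| * r ^+ n <= M.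

Definition cps a z : C := limn (series (fun n => toC (a n) * z ^+ n)).

Lemma cabs_term a z n : cabs (toC (a n) * z ^+ n) = `|a n| * cabs z ^+ n.
Proof. by rewrite cabsM cabsX cabs_toC. Qed.

Lemma asum_le a r r' : 0 <= r <= r' -> asum a r' -> asum a r.
Proof.
move=> /andP[r0 rr'] [M aM]; exists M => N; apply: le_trans _ (aM N).
by apply: ler_sum => i _; rewrite ler_wpM2l// lerXn2r// nnegrE (le_trans r0).
Qed.

Lemma asum_norm_le a b r : 0 <= r -> (forall n, `|a n| <= `|b n|) ->
  asum b r -> asum a r.
Proof.
move=> r0 ab [M bM]; exists M => N; apply: le_trans _ (bM N).
by apply: ler_sum => i _; rewrite ler_wpM2r ?exprn_ge0.
Qed.

Lemma cps_cvg a z : asum a (cabs z) ->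
  series (fun n => toC (a n) * z ^+ n) @ \oo --> cps a z.
Proof.
move=> [M aM]; apply: (@abs_series_cvg _ _ M) => N.
by under eq_bigr do rewrite cabs_term.
Qed.

Lemma cps_eq a z (l : C) : series (fun n => toC (a n) * z ^+ n) @ \oo --> l ->
  cps a z = l.
Proof. by move=> al; apply: cvg_lim => //; exact: norm_hausdorff. Qed.

Lemma cps_le a z M : (forall N, \sum_(n < N) `|a n| * cabs z ^+ n <= M) ->
  cabs (cps a z) <= M.
Proof.
move=> aM; have /lim_cabs_le : series (fun n => toC (a n) * z ^+ n) @ \oo --> cps a z.
  by apply: cps_cvg; exists M.
apply; apply: nearW => N; rewrite /series/= big_mkord.
apply: le_trans (ler_cabs_sum _ _ _) _.
by under eq_bigr do rewrite cabs_term.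
Qed.

Lemma cps0 a : cps a 0 = toC (a 0%N).
Proof.
apply: cps_eq; apply/cvg_cabs => e e0.
apply: filterS (nbhs_infty_gt 0) => -[//|N _].
rewrite /series/= big_mkord big_ord_recl expr0 mulr1 big1 ?addr0 ?subrr ?cabs0//.
by move=> i _; rewrite expr0n/= mulr0.
Qed.

Lemma cps_lin a b x z : asum a (cabs z) -> asum b (cabs z) ->
  cps (fun n => a n + x * b n) z = cps a z + toC x * cps b z.
Proof.
move=> /cps_cvg az /cps_cvg bz; apply: cps_eq.
have -> : series (fun n => toC (a n + x * b n) * z ^+ n) =
    (fun N => series (fun n => toC (a n) * z ^+ n) N +
              toC x * series (fun n => toC (b n) * z ^+ n) N).
  apply/funext => N; rewrite /series/= mulr_sumr -big_split/=.
  by apply: eq_bigr => i _; rewrite rmorphD rmorphM mulrDl mulrA.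
exact: (lim_add az (lim_mul (@lim_cst _ (toC x)) bz)).
Qed.

Lemma cps_mull a x z : asum a (cabs z) -> cps (fun n => x * a n) z = toC x * cps a z.
Proof.
move=> /cps_cvg az; apply: cps_eq.
have -> : series (fun n => toC (x * a n) * z ^+ n) =
    (fun N => toC x * series (fun n => toC (a n) * z ^+ n) N).
  apply/funext => N; rewrite /series/= mulr_sumr.
  by apply: eq_bigr => n _; rewrite rmorphM mulrA.
exact: (lim_mul (@lim_cst _ (toC x)) az).
Qed.

Lemma cps_opp a z : asum a (cabs z) -> cps (fun n => - a n) z = - cps a z.
Proof.
move=> az; have -> : (fun n => - a n) = (fun n => (- 1) * a n).
  by apply/funext => n; rewrite mulN1r.
by rewrite cps_mull// rmorphN rmorph1 mulN1r.
Qed.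

Lemma cps_cauchy a b z : asum a (cabs z) -> asum b (cabs z) ->
  cps a z * cps b z = cps (cauchy a b) z.
Proof.
move=> [M1 aM] [M2 bM]; apply/esym/cps_eq.
have -> : (fun n => toC (cauchy a b n) * z ^+ n) =
    cauchy (fun n => toC (a n) * z ^+ n) (fun n => toC (b n) * z ^+ n).
  apply/funext => n; rewrite /cauchy rmorph_sum mulr_suml.
  apply: eq_bigr => i _; rewrite rmorphM mulrACA -exprD subnKC//.
  by rewrite -ltnS.
by apply: (@cauchy_cvg _ _ _ M1 M2) => N; under eq_bigr do rewrite cabs_term.
Qed.

Lemma asum_cauchy a b r : 0 <= r -> asum a r -> asum b r -> asum (cauchy a b) r.
Proof.
move=> r0 [M1 aM] [M2 bM]; exists (M1 * M2) => N.
apply: le_trans _ (@cauchy_bounded _ (fun n => `|a n| * r ^+ n)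
  (fun n => `|b n| * r ^+ n) M1 M2 N _ _ _ _) => //; last 2 first.
- by move=> n; rewrite mulr_ge0// exprn_ge0.
- by move=> n; rewrite mulr_ge0// exprn_ge0.
apply: ler_sum => n _; rewrite /cauchy.
rewrite [leRHS](eq_bigr (fun i : 'I_n.+1 => `|a i| * `|b (n - i)%N| * r ^+ n)).
  rewrite -mulr_suml ler_wpM2r ?exprn_ge0//.
  apply: le_trans (ler_norm_sum _ _ _) _.
  by under eq_bigr do rewrite normrM.
by move=> i _; rewrite mulrACA -exprD subnKC// -ltnS.
Qed.

Definition dcoef a n : R := n.+1%:R * a n.+1.

(** The geometric factorization of [r' ^+ n.+1 - r ^+ n.+1] has [n.+1] terms, each
    at least [r ^+ n]. This pays for the factor [n.+1] of a derivative with a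
    slightly larger radius. *)
Lemma pow_gap r r' n : 0 <= r -> r <= r' ->
  (r' - r) * (n.+1%:R * r ^+ n) <= r' ^+ n.+1.
Proof.
move=> r0 rr'; have r'0 := le_trans r0 rr'.
apply: (@le_trans _ _ (r' ^+ n.+1 - r ^+ n.+1)); last by rewrite gerBl exprn_ge0.
rewrite subrXX ler_wpM2l ?subr_ge0//.
rewrite -[X in X%:R](card_ord n.+1) -sum1_card natr_sum mulr_suml.
apply: ler_sum => i _; rewrite mul1r.
rewrite -[in leLHS](@subnK i n) ?exprD; last by rewrite -ltnS.
by rewrite ler_wpM2r ?exprn_ge0// lerXn2r// nnegrE.
Qed.

Lemma asum_dcoef a r r' : 0 <= r < r' -> asum a r' -> asum (dcoef a) r.
Proof.
move=> /andP[r0 rr'] [M aM]; exists (M / (r' - r)) => N.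
have d0 : 0 < r' - r by rewrite subr_gt0.
rewrite ler_pdivlMr// mulrC mulr_sumr.
apply: le_trans _ (aM N.+1); rewrite big_ord_recl/=.
rewrite -[leLHS]add0r lerD ?mulr_ge0 ?exprn_ge0//.
  exact: le_trans (ltW rr').
apply: ler_sum => i _; rewrite /dcoef normrM normr_nat.
have -> : (r' - r) * (i.+1%:R * `|a i.+1| * r ^+ i) =
  `|a i.+1| * ((r' - r) * (i.+1%:R * r ^+ i)) by ring.
by rewrite /bump/= add1n ler_wpM2l// pow_gap// ltW.
Qed.

Lemma dcoef_entire a r : (forall r, 0 <= r -> asum a r) -> 0 <= r -> asum (dcoef a) r.
Proof.
move=> a_ent r0; apply: (@asum_dcoef a _ (r + 1)); first by rewrite r0 ltrDl ltr01.
by apply: a_ent; rewrite addr_ge0.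
Qed.

Lemma exprDn_split2 (K : comNzRingType) (x y : K) n :
  (x + y) ^+ n.+2 = x ^+ n.+2 + x ^+ n.+1 * y *+ n.+2 +
    \sum_(i < n.+1) x ^+ (n - i) * y ^+ i.+2 *+ 'C(n.+2, i.+2).
Proof.
rewrite exprDn 2!big_ord_recl addrA; congr (_ + _ + _).
  by rewrite mulr1.
by rewrite subSS subn0 expr1 bin1.
Qed.

(** Beyond its first two terms, the binomial expansion has a common factor
    [(cabs h / d) ^+ 2], and what remains is dominated by the expansion of
    [(r + d) ^+ n]. The bound is summable against every series that converges
    absolutely at [r + d]. *)
Lemma pow_remainder z h r d n : cabs z <= r -> 0 < d -> cabs h <= d ->
  cabs ((z + h) ^+ n - z ^+ n - n%:R * z ^+ n.-1 * h) <=
  (cabs h / d) ^+ 2 * (r + d) ^+ n.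
Proof.
move=> zr d0 hd; have r0 := le_trans (cabs_ge0 z) zr.
have q0 : 0 <= (cabs h / d) ^+ 2 by rewrite exprn_ge0// divr_ge0 ?cabs_ge0// ltW.
case: n => [|[|n]].
- by rewrite !expr0 subrr mul0r mul0r subr0 cabs0 mulr1.
- have -> : (z + h) ^+ 1 - z ^+ 1 - 1%:R * z ^+ 0 * h = 0 by rewrite expr0 !expr1; ring.
  by rewrite cabs0 mulr_ge0// exprn_ge0// addr_ge0// ltW.
rewrite !exprDn_split2; set S := \sum_(i < n.+1) _.
set T := (X in cabs X).
have -> : T = S by rewrite /T -mulr_natr; ring.
rewrite mulrDr; apply: ler_wpDl.
  rewrite mulr_ge0// addr_ge0 ?exprn_ge0// mulrn_wge0// mulr_ge0 ?exprn_ge0//.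
  exact: ltW.
apply: le_trans (ler_cabs_sum _ _ _) _.
rewrite mulr_sumr; apply: ler_sum => i _.
rewrite -[in leLHS]mulr_natr -[in leRHS]mulr_natr cabsM [leRHS]mulrA.
rewrite -(rmorph_nat (@toC R)) cabs_toC normr_nat; apply: ler_wpM2r => //.
rewrite cabsM (cabsX z) (cabsX h) [leRHS]mulrCA.
apply: ler_pM; rewrite ?exprn_ge0 ?cabs_ge0//.
  by rewrite lerXn2r// nnegrE ?cabs_ge0.
rewrite -[i.+2]addn2 !exprD.
have -> : (cabs h / d) ^+ 2 * (d ^+ i * d ^+ 2) = d ^+ i * cabs h ^+ 2.
  by field; rewrite gt_eqF.
apply: ler_wpM2r; rewrite ?exprn_ge0 ?cabs_ge0//.
by rewrite lerXn2r// nnegrE ?cabs_ge0// ltW.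
Qed.

(** Summing [pow_remainder], with [d] half of the distance to the circle of radius
    [r], bounds the error of the termwise derivative by [K * cabs h ^+ 2]. *)
Lemma cps_is_derive a z r : cabs z < r -> asum a r ->
  is_derive z 1 (cps a) (cps (dcoef a) z).
Proof.
move=> zr ar; have z0 := cabs_ge0 z.
pose d := (r - cabs z) / 2.
have d0 : 0 < d by rewrite divr_gt0// subr_gt0.
have zdr : cabs z + d = (cabs z + r) / 2 by rewrite /d; lra.
have r2 : (cabs z + r) / 2 <= r by rewrite ler_pdivrMr//; lra.
have [M aM] : asum a (cabs z + d).
  by apply: asum_le ar; rewrite zdr r2 andbT divr_ge0// addr_ge0// ltW// (le_lt_trans z0).
have M0 : 0 <= M by have := aM 0%N; rewrite big_ord0.
have az : asum a (cabs z) by apply: asum_le ar; rewrite z0 ltW.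
have daz : asum (dcoef a) (cabs z) by apply: asum_dcoef ar; rewrite z0.
apply/is_derive_cabs => e e0.
pose K := M / d ^+ 2.
have K0 : 0 <= K by rewrite divr_ge0// exprn_ge0// ltW.
exists (Num.min d (e / (K + 1))).
  by rewrite lt_min d0 divr_gt0// ltr_wpDl.
move=> h; rewrite lt_min => /andP[hd he].
have azh : asum a (cabs (z + h)).
  apply: asum_le ar; rewrite cabs_ge0/=.
  apply: le_trans (ler_cabsD _ _) _; apply: le_trans _ r2.
  by rewrite -zdr lerD2l ltW.
have bound : cabs (cps a (z + h) - cps a z - cps (dcoef a) z * h) <= K * cabs h ^+ 2.
  (* The derived series is shifted by one, so that the partial sums of the three
     series stop at the same coefficient of [a]. *)
  have sc : series (fun n => toC (dcoef a n) * z ^+ n) \o predn @ \oo --> cps (dcoef a) z.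
    apply: cvg_comp (cps_cvg daz).
    by apply/cvgnyPge => A; exists A.+1 => //= -[].
  pose u N := series (fun n => toC (a n) * (z + h) ^+ n) N
     - series (fun n => toC (a n) * z ^+ n) N
     - (series (fun n => toC (dcoef a n) * z ^+ n) \o predn) N * h.
  have /lim_cabs_le : u @ \oo --> cps a (z + h) - cps a z - cps (dcoef a) z * h.
    exact: (lim_sub (lim_sub (cps_cvg azh) (cps_cvg az)) (lim_mul sc (@lim_cst _ h))).
  apply; apply: filterS (nbhs_infty_gt 0) => -[//|N _]; rewrite /u /= /series/= !big_mkord.
  have -> : (\sum_(i < N) toC (dcoef a i) * z ^+ i) * h =
      \sum_(i < N.+1) toC (a i) * (i%:R * z ^+ i.-1 * h).
    rewrite big_ord_recl/= !mul0r mulr0 add0r mulr_suml.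
    apply: eq_bigr => i _; rewrite /dcoef rmorphM rmorph_nat.
    by rewrite /bump/= add1n; ring.
  rewrite -!sumrB; apply: le_trans (ler_cabs_sum _ _ _) _.
  apply: (@le_trans _ _ (\sum_(i < N.+1) (cabs h / d) ^+ 2 * (`|a i| * (cabs z + d) ^+ i))).
    apply: ler_sum => i _; rewrite -!mulrBr cabsM cabs_toC mulrCA ler_wpM2l//.
    by apply: pow_remainder => //; exact: ltW.
  rewrite -mulr_sumr.
  have -> : K * cabs h ^+ 2 = (cabs h / d) ^+ 2 * M.
    by rewrite /K; field; rewrite gt_eqF.
  by apply: ler_wpM2l => //; rewrite exprn_ge0// divr_ge0 ?cabs_ge0// ltW.
apply: le_trans bound _; rewrite expr2 mulrA ler_wpM2r ?cabs_ge0//.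
move: he; rewrite ltr_pdivlMr ?ltr_wpDl// mulrDr mulr1 => he.
by rewrite mulrC; apply: le_trans (ltW he); rewrite lerDl cabs_ge0.
Qed.

Lemma is_derive_entire a z : (forall r, 0 <= r -> asum a r) ->
  is_derive z 1 (cps a) (cps (dcoef a) z).
Proof.
move=> a_ent; apply: (@cps_is_derive a z (cabs z + 1)); first by rewrite ltrDl.
by apply: a_ent; rewrite addr_ge0// cabs_ge0.
Qed.

End RealPowerSeries.

(** * Exponential, principal logarithm and powers *)
Section ExpLog.
Context {R : realType}.
Local Notation C := (Cplx R).
Implicit Types (x y e r M t : R) (z w h : C).

Lemma cexpD z w : cexp (z + w) = cexp z * cexp w.
Proof.
case: z w => a b [c d]; apply: cplx_eq; rewrite /cexp ?ReM ?ImM/= ?ReM ?ImM/=.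
  by rewrite expRD cosD; ring.
by rewrite expRD sinD; ring.
Qed.

Lemma cexp_toC x : cexp (toC x) = toC (expR x).
Proof. by apply: cplx_eq; rewrite /cexp ?ReM ?ImM/= cos0 sin0; ring. Qed.

Lemma cexp0 : cexp (0 : C) = 1.
Proof. by rewrite -[0 : C](rmorph0 (@toC R)) cexp_toC expR0 rmorph1. Qed.

Lemma cexp_neq0 z : cexp z != 0.
Proof.
apply/eqP => z0; have := cexpD z (- z); rewrite subrr cexp0 z0 mul0r.
by move/eqP; rewrite oner_eq0.
Qed.

Lemma cexpN z : cexp (- z) = (cexp z)^-1.
Proof.
by apply: (mulfI (cexp_neq0 z)); rewrite -cexpD subrr cexp0 divff// cexp_neq0.
Qed.

Lemma cexpMn z n : cexp (n%:R * z) = cexp z ^+ n.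
Proof.
elim: n => [|n ih]; first by rewrite mul0r cexp0.
by rewrite -natr1 mulrDl mul1r cexpD ih exprSr.
Qed.

Lemma real_derive_eps (f : R -> R) (l : R) e : is_derive (0 : R) 1 f l -> 0 < e ->
  exists2 d, 0 < d & forall x, `|x| < d -> `|f x - f 0 - l * x| <= e * `|x|.
Proof.
move=> /is_derive_norm H e0; have [d d0 dP] := H _ e0.
by exists d => // x /dP; rewrite add0r.
Qed.

(** The error [cexp h - 1 - h] at [h = x + i y] consists of the errors of the real
    exponential, of the cosine and of the sine, and of the term [x * y]; each is
    small compared with [cabs h]. *)
Lemma is_derive_cexp0 : is_derive (0 : C) 1 cexp 1.
Proof.
apply/is_derive_cabs => e e0.
have e40 : 0 < e / 4 by rewrite divr_gt0.
have e80 : 0 < e / 8 by rewrite divr_gt0.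
have [d1 d10 H1] := real_derive_eps (is_derive_expR 0) e80.
have [d2 d20 H2] := real_derive_eps (is_derive_cos 0) e80.
have [d3 d30 H3] := real_derive_eps (is_derive_sin 0) e80.
exists (Num.min 1 (Num.min (e / 4) (Num.min d1 (Num.min d2 d3)))).
  by rewrite !lt_min ltr01 e40 d10 d20 d30.
move=> [x y]; set h := Complex x y; rewrite !lt_min => /and5P[h1 he hd1 hd2 hd3].
have xh : `|x| <= cabs h := Re_le_cabs h.
have yh : `|y| <= cabs h := Im_le_cabs h.
rewrite add0r mul1r cexp0.
have E1 := H1 x (le_lt_trans xh hd1).
have E2 := H2 y (le_lt_trans yh hd2).
have E3 := H3 y (le_lt_trans yh hd3).
rewrite expR0 mul1r in E1; rewrite cos0 sin0 oppr0 mul0r subr0 in E2.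
rewrite sin0 cos0 subr0 mul1r in E3.
have eh0 : 0 <= e * cabs h by rewrite mulr_ge0 ?cabs_ge0// ltW.
have -> : cexp h - 1 - h = toC (expR x - 1 - x) * Complex (cos y) (sin y)
   + toC (1 + x) * Complex (cos y - 1) (sin y - y) + toC (x * y) * Complex 0 1.
  by apply: cplx_eq; rewrite /cexp ?(ReD, ImD, ReN, ImN, ReM, ImM)/=; ring.
have cs : cabs (Complex (cos y) (sin y) : C) = 1.
  by apply/eqP; rewrite -(eqrXn2 (_ : 0 < 2)%N) ?cabs_ge0// cabs_sqr/= cos2Dsin2 expr1n.
have ci : cabs (Complex 0 1 : C) = 1 by exact: cabs_i.
apply: le_trans (ler_cabsD _ _) _; rewrite cabsM ci mulr1 cabs_toC normrM.
apply: (@le_trans _ _ (e / 8 * cabs h + 2 * (e / 8 * cabs h + e / 8 * cabs h)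
   + e / 4 * cabs h)); last by lra.
apply: lerD.
  apply: le_trans (ler_cabsD _ _) _; rewrite !cabsM cs mulr1 !cabs_toC.
  apply: lerD; first by apply: le_trans E1 _; rewrite ler_wpM2l// ltW.
  apply: ler_pM => //; first exact: cabs_ge0.
    apply: le_trans (ler_normD _ _) _; rewrite normr1.
    have := le_trans xh (ltW h1); lra.
  apply: le_trans (cabs_le_ReIm _) _ => /=; apply: lerD.
    by apply: le_trans E2 _; rewrite ler_wpM2l// ltW.
  by apply: le_trans E3 _; rewrite ler_wpM2l// ltW.
apply: ler_pM => //.
exact: (le_trans xh (ltW he)).
Qed.

Lemma is_derive_cexp z : is_derive z 1 cexp (cexp z).
Proof.
have /is_derive_cabs H := is_derive_cexp0; apply/is_derive_cabs => e e0.
have z0 : 0 < cabs (cexp z) by rewrite cabs_gt0 cexp_neq0.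
have [d d0 dP] := H _ (divr_gt0 e0 z0); exists d => // h /dP.
rewrite add0r cexp0 mul1r cexpD => Hh.
have -> : cexp z * cexp h - cexp z - cexp z * h = cexp z * (cexp h - 1 - h) by ring.
rewrite cabsM mulrC -ler_pdivlMr//.
by rewrite mulrAC.
Qed.

Lemma Re_div_cabs z : z != 0 -> -1 <= complex.Re z / cabs z <= 1.
Proof.
rewrite -cabs_gt0 => z0; rewrite -ler_norml normrM normfV (ger0_norm (cabs_ge0 _)).
by rewrite ler_pdivrMr// mul1r Re_le_cabs.
Qed.

Lemma ImE_cabs z : z != 0 ->
  Num.sqrt (1 - (complex.Re z / cabs z) ^+ 2) = `|complex.Im z| / cabs z.
Proof.
rewrite -cabs_gt0 => z0.
have -> : 1 - (complex.Re z / cabs z) ^+ 2 = (`|complex.Im z| / cabs z) ^+ 2.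
  rewrite !expr_div_n real_normK ?num_real//.
  have c2 : cabs z ^+ 2 != 0 by rewrite expf_neq0// gt_eqF.
  rewrite -{1}(divff c2) -mulrBl; congr (_ / _).
  by rewrite cabs_sqr addrAC subrr add0r.
by rewrite sqrtr_sqr ger0_norm// divr_ge0// ltW.
Qed.

Lemma cos_carg z : z != 0 -> cos (carg z) = complex.Re z / cabs z.
Proof.
move=> z0; rewrite /carg; case: ifP => _; rewrite ?cosN acosK//;
  by rewrite in_itv/= Re_div_cabs.
Qed.

Lemma sin_carg z : z != 0 -> sin (carg z) = complex.Im z / cabs z.
Proof.
move=> z0; rewrite /carg; case: ifP => z1; rewrite ?sinN sin_acos ?Re_div_cabs//
  ImE_cabs//; first by rewrite ger0_norm.
by rewrite ltr0_norm ?mulNr ?opprK// ltNge z1.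
Qed.

Lemma clogK z : z != 0 -> cexp (clog z) = z.
Proof.
move=> z0; have c0 : cabs z != 0 by rewrite cabs_eq0.
rewrite /cexp /clog/= lnK ?posrE ?cabs_gt0// cos_carg// sin_carg//.
by apply: cplx_eq; rewrite ?ReM ?ImM/= ?mul0r ?subr0 ?addr0 mulrCA divff// mulr1.
Qed.

Lemma slit_neq0 z : slit_plane z -> z != 0.
Proof.
move=> sz; apply/eqP => z0; move: sz; rewrite z0 => -[/=|/=].
  by rewrite eqxx.
by rewrite ltxx.
Qed.

Lemma slit_Re_gt z : slit_plane z -> 0 < cabs z + complex.Re z.
Proof.
move=> sz; have z0 := slit_neq0 sz; rewrite -cabs_gt0 in z0.
case: sz => [zi|zr]; last by rewrite addr_gt0.
suff : - complex.Re z < cabs z by move=> ?; lra.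
apply: (@le_lt_trans _ _ `|complex.Re z|); first by rewrite -normrN ler_norm.
rewrite -(ltr_pXn2r (_ : 0 < 2)%N) ?nnegrE ?normr_ge0 ?cabs_ge0//.
by rewrite cabs_sqr real_normK ?num_real// ltrDl exprn_even_gt0.
Qed.

(** The half-angle formula: a single expression on the slit plane, whose continuity
    is visible, in place of a definition by cases on the sign of [Im z]. *)
Lemma carg_atan z : slit_plane z ->
  carg z = 2 * atan (complex.Im z / (cabs z + complex.Re z)).
Proof.
move=> sz; have z0 := slit_neq0 sz; have zr := slit_Re_gt sz.
have c0 : 0 < cabs z by rewrite cabs_gt0.
have gtN1 : -1 < complex.Re z / cabs z by rewrite ltr_pdivlMr// mulN1r; lra.
have /andP[_ le1] := Re_div_cabs z0.
have : `|carg z| < pi.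
  have lt : acos (complex.Re z / cabs z) < pi by rewrite acos_ltpi// gtN1 le1.
  have ge : 0 <= acos (complex.Re z / cabs z) by rewrite acos_ge0// ltW.
  by rewrite /carg; case: ifP => _; rewrite ?normrN ger0_norm.
rewrite ltr_norml => /andP[t1 t2].
set t := carg z in t1 t2 *.
have t12 : - (pi / 2) < t / 2 < pi / 2 by apply/andP; split; lra.
have ct : 0 < cos (t / 2) by apply: cos_gt0_pihalf.
have tt : t = t / 2 + t / 2 by lra.
have -> : complex.Im z / (cabs z + complex.Re z) = tan (t / 2).
  transitivity (sin t / (1 + cos t)).
    rewrite /t cos_carg// sin_carg//; field.
    by rewrite !gt_eqF.
  rewrite [in sin t]tt [in cos t]tt sinD cosD /tan.
  have := cos2Dsin2 (t / 2) => cs.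
  have -> : 1 + (cos (t / 2) * cos (t / 2) - sin (t / 2) * sin (t / 2)) =
    2 * cos (t / 2) ^+ 2 by rewrite -{1}cs; ring.
  by field; rewrite gt_eqF.
rewrite tanK; first by lra.
by rewrite in_itv.
Qed.

Lemma continuous_Re z : (complex.Re w @[w --> z]) --> complex.Re z.
Proof.
apply/(@cvgrPdist_lt _ _ _ (nbhs z) (nbhs_filter z)) => e e0.
apply/nbhs_cabs; exists e => // w; rewrite -ReN -ReD cabs_distC.
by apply: le_lt_trans; apply: Re_le_cabs.
Qed.

Lemma continuous_Im z : (complex.Im w @[w --> z]) --> complex.Im z.
Proof.
apply/(@cvgrPdist_lt _ _ _ (nbhs z) (nbhs_filter z)) => e e0.
apply/nbhs_cabs; exists e => // w; rewrite -ImN -ImD cabs_distC.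
by apply: le_lt_trans; apply: Im_le_cabs.
Qed.

Lemma continuous_cabsr z : (cabs w @[w --> z]) --> cabs z.
Proof.
apply/(@cvgrPdist_lt _ _ _ (nbhs z) (nbhs_filter z)) => e e0.
apply/nbhs_cabs; exists e => // w; apply: le_lt_trans.
have H1 := ler_cabsD (w - z) z; rewrite subrK in H1.
have H2 := ler_cabsD (z - w) w; rewrite subrK (cabs_distC z w) in H2.
have H : cabs w - cabs (w - z) <= cabs z <= cabs w + cabs (w - z).
  by apply/andP; split; lra.
by rewrite ler_distl.
Qed.

Lemma slit_open z : slit_plane z -> \forall w \near z, slit_plane w.
Proof.
case=> zP.
  have z0 : 0 < `|complex.Im z| by rewrite normr_gt0.
  have /(@cvgrPdist_lt _ _ _ (nbhs z) (nbhs_filter z))/(_ _ z0) := continuous_Im (z := z).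
  by apply: filterS => w H; left; apply/eqP => w0; move: H; rewrite w0 subr0 ltxx.
have /(@cvgrPdist_lt _ _ _ (nbhs z) (nbhs_filter z))/(_ _ zP) := continuous_Re (z := z).
apply: filterS => w H; right.
by have := le_lt_trans (ler_norm _) H; rewrite ltrBlDr ltrDl.
Qed.

Lemma clog_continuous z : slit_plane z -> {for z, continuous clog}.
Proof.
move=> sz; apply/continuous_cabs => e e0.
have e20 : 0 < e / 2 by rewrite divr_gt0.
have c0 : 0 < cabs z by rewrite cabs_gt0 slit_neq0.
have zr := slit_Re_gt sz.
have H1 : (ln (cabs w) @[w --> z]) --> ln (cabs z).
  by apply: (cvg_comp _ _ (@continuous_cabsr z)); exact: continuous_ln.
have H2 : (2 * atan (complex.Im w / (cabs w + complex.Re w)) @[w --> z]) -->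
    2 * atan (complex.Im z / (cabs z + complex.Re z)).
  have Q : (complex.Im w / (cabs w + complex.Re w) @[w --> z]) -->
      complex.Im z / (cabs z + complex.Re z).
    have S : ((cabs w + complex.Re w) @[w --> z]) --> cabs z + complex.Re z.
      exact: (cvgD (@continuous_cabsr z) (@continuous_Re z)).
    exact: (cvgM (@continuous_Im z) (cvgV (lt0r_neq0 zr) S)).
  have A : (atan (complex.Im w / (cabs w + complex.Re w)) @[w --> z]) -->
      atan (complex.Im z / (cabs z + complex.Re z)).
    by apply: (cvg_comp _ _ Q); exact: continuous_atan.
  exact: (@cvgMl_tmp R _ _ _ _ 2 _ A).
have /(@cvgrPdist_lt _ _ _ (nbhs z) (nbhs_filter z))/(_ _ e20) K1 := H1.
have /(@cvgrPdist_lt _ _ _ (nbhs z) (nbhs_filter z))/(_ _ e20) K2 := H2.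
have /nbhs_cabs[d d0 dP] : \forall w \near z, slit_plane w /\
    (`|ln (cabs z) - ln (cabs w)| < e / 2 /\
     `|2 * atan (complex.Im z / (cabs z + complex.Re z)) -
       2 * atan (complex.Im w / (cabs w + complex.Re w))| < e / 2).
  exact: filterI (slit_open sz) (filterI K1 K2).
exists d => // w /dP[sw [w1 w2]].
apply: le_lt_trans (cabs_le_ReIm _) _; rewrite ReD ImD ReN ImN /clog/=.
rewrite !carg_atan// (splitr e); apply: ltrD.
  by rewrite distrC.
by rewrite distrC.
Qed.

(** The derivative of an inverse function. The increment [k] of the logarithm is
    comparable with [h], since [cexp] has the derivative [z != 0] at [clog z]. *)
Lemma is_derive_clog z : slit_plane z -> is_derive z 1 clog z^-1.
Proof.
move=> sz; have z0 := slit_neq0 sz; have c0 : 0 < cabs z by rewrite cabs_gt0.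
apply/is_derive_cabs => e e0.
(* The first bound yields [cabs z * cabs k <= 2 * cabs h], the second one the
   tolerance [e]. *)
pose e1 := Num.min (cabs z / 2) (e * cabs z ^+ 2 / 2).
have e10 : 0 < e1 by rewrite lt_min divr_gt0//= divr_gt0// mulr_gt0// exprn_gt0.
have /is_derive_cabs/(_ _ e10)[d d0 dP] := is_derive_cexp (clog z).
have /continuous_cabs/(_ _ d0)[d' d'0 d'P] := clog_continuous sz.
exists (Num.min d' (cabs z)); first by rewrite lt_min d'0.
move=> h; rewrite lt_min => /andP[hd' hz].
have zh0 : z + h != 0.
  by apply: contraTneq hz => /eqP; rewrite addrC addr_eq0 => /eqP ->; rewrite cabsN ltxx.
have := d'P (z + h); rewrite [z + h - z]addrC addKr => /(_ hd').
set k := clog (z + h) - clog z => kd.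
have := dP k kd; rewrite /k addrCA subrr addr0 !clogK// -/k.
rewrite [z + h - z]addrC addKr => hk.
have hk1 : cabs (h - z * k) <= cabs z / 2 * cabs k.
  by apply: le_trans hk _; rewrite ler_wpM2r ?cabs_ge0// ge_min lexx.
have hk2 : cabs (h - z * k) <= e * cabs z ^+ 2 / 2 * cabs k.
  by apply: le_trans hk _; rewrite ler_wpM2r ?cabs_ge0// ge_min lexx orbT.
have k1 : cabs z * cabs k <= 2 * cabs h.
  have := ler_cabsD (z * k - h) h; rewrite subrK cabsM (cabs_distC _ h).
  move=> H; have := le_trans H (lerD hk1 (lexx _)); lra.
have -> : k - z^-1 * h = - (z^-1 * (h - z * k)).
  by rewrite mulrBr mulKf// opprB.
rewrite cabsN cabsM cabsV ler_pdivrMl//; apply: le_trans hk2 _.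
have -> : e * cabs z ^+ 2 / 2 * cabs k = e / 2 * cabs z * (cabs z * cabs k) by ring.
apply: (@le_trans _ _ (e / 2 * cabs z * (2 * cabs h))).
  by rewrite ler_wpM2l// mulr_ge0// ltW// divr_gt0.
by rewrite le_eqVlt; apply/orP; left; apply/eqP; field.
Qed.

Lemma is_derive_cpow z a : slit_plane z ->
  is_derive z 1 (cpow^~ a) (toC a * (cpow z a / z)).
Proof.
move=> sz; have := @is_derive_comp _ cexp (fun w => toC a * clog w) z.
move=> /(_ _ _ (is_derive_cexp _)).
have dl := @is_derive_mul _ (fun=> toC a) clog z _ _ (is_derive_cst _ _ _) (is_derive_clog sz).
move=> /(_ _ dl); rewrite mul0r addr0 => H; apply: is_derive_eq H _.
by rewrite /cpow mulrCA mulrA.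
Qed.

End ExpLog.

(** * The functional equation of Euler's integral *)
Section GammaFunction.
Context {R : realType}.
Implicit Types (x y t a b : R) (f F : R -> R).
Notation mu := (@lebesgue_measure R).

Lemma continuous_pos_within f a b : 0 < a ->
  (forall t, 0 < t -> {for t, continuous f}) -> {within `[a, b], continuous f}.
Proof.
move=> a0 fc; apply: continuous_in_subspaceT => t; rewrite inE/= in_itv/= => /andP[at_ _].
by apply: fc; exact: lt_le_trans at_.
Qed.

Lemma integrable_pos f a b : 0 < a ->
  (forall t, 0 < t -> {for t, continuous f}) -> mu.-integrable `[a, b] (EFin \o f).
Proof.
move=> a0 fc; apply: continuous_compact_integrable; first exact: segment_compact.
exact: continuous_pos_within.
Qed.

Lemma Rintegral_derive f F a b : 0 < a -> a < b ->
  (forall t, 0 < t -> is_derive t 1 F (f t)) ->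
  (forall t, 0 < t -> {for t, continuous f}) ->
  (\int[mu]_(t in `[a, b]) f t)%R = F b - F a.
Proof.
move=> a0 ab dF fc; rewrite /Rintegral (@continuous_FTC2 _ f F)//.
- exact: continuous_pos_within.
- have Fc t : 0 < t -> {for t, continuous F}.
    move=> t0; apply: differentiable_continuous; apply/derivable1_diffP.
    by have [] := dF _ t0.
  split.
  + by move=> t; rewrite in_itv/= => /andP[at_ _]; have [] := dF _ (lt_trans a0 at_).
  + by apply: cvg_at_right_filter; apply: Fc.
  + by apply: cvg_at_left_filter; apply: Fc; exact: lt_trans ab.
- move=> t; rewrite in_itv/= => /andP[at_ _].
  by rewrite derive1E; have [] := dF _ (lt_trans a0 at_).
Qed.

Definition gammaf x t : R := t `^ (x - 1) * expR (- t).

Lemma continuous_powR_pos x t : 0 < t -> {for t, continuous (@powR R ^~ x)}.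
Proof.
move=> t0; apply: differentiable_continuous; apply/derivable1_diffP.
by have [] := is_derive1_powR x t0.
Qed.

Lemma continuous_gammaf x t : 0 < t -> {for t, continuous (gammaf x)}.
Proof.
move=> t0; apply: (@continuousM R R); first exact: continuous_powR_pos.
by apply: continuous_comp; [exact: opp_continuous|exact: continuous_expR].
Qed.

Lemma gammaf_ge0 x t : 0 <= gammaf x t.
Proof. by rewrite mulr_ge0 ?powR_ge0 ?expR_ge0. Qed.

Lemma powR_le_expR x : 0 < x -> exists2 K, 0 < K &
  forall t, 0 < t -> t `^ x <= K * expR t.
Proof.
move=> x0; pose n := `|Num.ceil x|%N; exists n.+1`!%:R; first by rewrite ltr0n fact_gt0.
have f1 : 1 <= n.+1`!%:R :> R by rewrite ler1n fact_gt0.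
move=> t t0; have [t1|t1] := leP t 1.
  apply: (@le_trans _ _ 1).
    by rewrite -[leRHS](powRr0 t) ger_powR// ?t0// ltW.
  by rewrite -[leLHS]mulr1 ler_pM// -expR0 ler_expR ltW.
apply: (@le_trans _ _ (t ^+ n.+1)).
  rewrite -(powR_mulrn _ (ltW t0)) (ler_powR (ltW t1))//.
  by rewrite ltW// lt_succ_ceil.
rewrite mulrC -ler_pdivrMr ?ltr0n ?fact_gt0//.
by apply: le_trans _ (expR_ge1Dxn n (ltW t0)); rewrite lerDr.
Qed.

(* The half-line is exhausted by the segments from [lo n] to [hi n], on which the
   integrand is continuous. *)
Let lo n : R := n.+2%:R^-1.
Let hi n : R := n.+2%:R.

Let lo_gt0 n : 0 < lo n. Proof. by rewrite invr_gt0 ltr0n. Qed.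
Let lo_lt_hi n : lo n < hi n.
Proof. by apply: (@lt_trans _ _ 1); rewrite ?invf_lt1 ?ltr1n ?ltr0n. Qed.

Let J x n : R := (\int[mu]_(t in `[lo n, hi n]) gammaf x t)%R.

(** Integration by parts: [x * gammaf x t - gammaf (x + 1) t] is the derivative of
    [t `^ x * expR (- t)]. *)
Lemma gamma_boundary x n : 0 < x ->
  x * J x n - J (x + 1) n =
  hi n `^ x * expR (- hi n) - lo n `^ x * expR (- lo n).
Proof.
move=> x0; rewrite /J -RintegralZl//; last first.
  by apply: integrable_pos => // t; exact: continuous_gammaf.
have xc t : 0 < t -> {for t, continuous (fun t => x * gammaf x t)}.
  move=> t0; apply: (@continuousM R R); first exact: cst_continuous.
  exact: continuous_gammaf.
rewrite -RintegralB//; last 2 first.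
- exact: integrable_pos.
- by apply: integrable_pos => // t; exact: continuous_gammaf.
apply: (@Rintegral_derive _ (fun t => t `^ x * expR (- t))) => //.
  move=> t t0; have dp := is_derive1_powR x t0.
  have de : is_derive t 1 (fun t => expR (- t)) (- expR (- t)).
    have := @is_derive1_comp R expR -%R t (expR (- t)) (-1).
    by rewrite mulrN1; apply; apply: is_deriveNid.
  apply: (is_derive_eq (is_derive_mul dp de)).
  by rewrite /gammaf addrK; ring.
move=> t t0; apply: (@continuousB R R); first exact: xc.
exact: continuous_gammaf.
Qed.

(** The derivative [psi] of the bounded function [- C / (1 + t `^ x)] dominates the
    integrand both near 0 and near infinity. *)
Lemma gamma_partial_le x : 0 < x -> exists C, forall n, J x n <= C.
Proof.
move=> x0; have [K K0 HK] := powR_le_expR (mulr_gt0 x0 (ltr0Sn R 1)).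
(* The domination amounts to [(1 + t `^ x) ^+ 2 <= C * x * expR t], and
   [(1 + y) ^+ 2 <= 2 + 2 * y ^+ 2]. *)
pose C := (2 + 2 * K) / x.
have C0 : 0 < C by rewrite divr_gt0// addr_gt0// mulr_gt0.
pose psi t := C * (x * t `^ (x - 1)) / (1 + t `^ x) ^+ 2.
have p1 t : 0 < 1 + t `^ x by rewrite ltr_pwDl ?powR_ge0.
have psic t : 0 < t -> {for t, continuous psi}.
  move=> t0; have px := @continuous_powR_pos x _ t0.
  have px1 := @continuous_powR_pos (x - 1) _ t0.
  rewrite /psi /continuous_at; apply: cvgM.
    apply: cvgM; first exact: cvg_cst.
    by apply: cvgM; [exact: cvg_cst|exact: px1].
  apply: cvgV; first by rewrite gt_eqF// exprn_gt0.
  by apply: cvgM; apply: cvgD; [exact: cvg_cst|exact: px|exact: cvg_cst|exact: px].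
have dPsi t : 0 < t -> is_derive t 1 (fun t => - C * (1 + t `^ x)^-1) (psi t).
  move=> t0; have dp := is_derive1_powR x t0.
  have d1 : is_derive t 1 (fun t => 1 + t `^ x) (x * t `^ (x - 1)).
    by have := is_derive_add (is_derive_cst (1 : R) t 1) dp; rewrite add0r.
  have d2 := is_derive_inv (f := fun t => 1 + t `^ x) (lt0r_neq0 (p1 t)) d1.
  apply: (is_derive_eq (is_derive_mul (is_derive_cst (- C) t 1) d2)).
  rewrite /psi /=; field.
  by rewrite gt_eqF.
exists C => n; apply: (@le_trans _ _ (\int[mu]_(t in `[lo n, hi n]) psi t)%R).
  apply: le_Rintegral => //.
  - by apply: integrable_pos => // t; exact: continuous_gammaf.
  - exact: integrable_pos.
  move=> t /=; rewrite in_itv/= => /andP[t0 _].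
  have {}t0 : 0 < t by exact: lt_le_trans t0.
  have -> : psi t = t `^ (x - 1) * (C * x / (1 + t `^ x) ^+ 2) by rewrite /psi; ring.
  rewrite ler_wpM2l ?powR_ge0// ler_pdivlMr ?exprn_gt0// expRN ler_pdivrMl ?expR_gt0//.
  have -> : C * x = 2 + 2 * K by rewrite /C divfK// gt_eqF.
  have := HK _ t0; rewrite powRrM powR_mulrn ?powR_ge0// => H.
  have e1 : 1 <= expR t by rewrite -expR0 ler_expR ltW.
  have := sqr_ge0 (1 - t `^ x); nra.
rewrite (@Rintegral_derive psi (fun t => - C * (1 + t `^ x)^-1))//.
rewrite !mulNr opprK addrC lerBlDr ler_wpDr//.
  by rewrite mulr_ge0 ?ltW// invr_gt0.
by rewrite ler_piMr ?(ltW C0)// invf_le1// lerDl powR_ge0.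
Qed.

Lemma bigcup_exhaust : \bigcup_n `[lo n, hi n]%classic = `]0, +oo[%classic.
Proof.
apply/seteqP; split=> [t [n _]/=|t /=]; rewrite !in_itv/= andbT.
  by move=> /andP[+ _]; exact: lt_le_trans.
move=> t0; have [n] := (ltr_add_invr t0); rewrite add0r => nt.
pose m := maxn n `|Num.ceil t|%N; exists m => //=; rewrite in_itv/=; apply/andP; split.
  apply: le_trans (ltW nt); rewrite lef_pV2 ?posrE ?ltr0n//.
  by rewrite ler_nat ltnS (leq_trans (leq_maxl n `|Num.ceil t|%N)).
apply: le_trans (ltW (lt_succ_ceil t)) _.
by rewrite ler_nat ltnS (leq_trans (leq_maxr n _)).
Qed.

Lemma exhaust_le : nondecreasing_seq (fun n => `[lo n, hi n]%classic : set R).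
Proof.
move=> m n mn; apply/subsetPset => t /=; rewrite !in_itv/= => /andP[t1 t2].
apply/andP; split.
  by apply: le_trans t1; rewrite lef_pV2 ?posrE ?ltr0n// ler_nat !ltnS.
by apply: le_trans t2 _; rewrite ler_nat !ltnS.
Qed.

Lemma gamma_cvg x : 0 < x -> J x @ \oo --> Gamma x /\ forall n, J x n <= Gamma x.
Proof.
move=> x0; have [C JC] := gamma_partial_le x0.
have JE n : (J x n)%:E = (\int[mu]_(t in `[lo n, hi n]) (gammaf x t)%:E)%E.
  rewrite /J /Rintegral fineK//; apply: integrable_fin_num => //.
  by apply: integrable_pos => // t; exact: continuous_gammaf.
have mg (D : set R) : measurable_fun D (gammaf x).
  apply: measurable_funTS; apply: measurable_funM.
    exact: measurable_powR.
  by apply: measurableT_comp => //; exact: measurable_expR.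
have g0 (t : R) : (0 <= (gammaf x t)%:E)%E by rewrite lee_fin gammaf_ge0.
have Jnd : nondecreasing_seq (J x).
  move=> m n mn; rewrite -lee_fin !JE.
  apply: ge0_subset_integral => //; last by apply/subsetPset; exact: exhaust_le.
  by apply/measurable_EFinP; exact: mg.
have Jcvg : J x @ \oo --> limn (J x).
  by apply: nondecreasing_is_cvgn => //; exists C => _ [n _ <-].
suff -> : Gamma x = limn (J x).
  split => // n; apply: nondecreasing_cvgn_le => //.
rewrite /Gamma /Rintegral.
have H1 : (\int[mu]_(t in `[lo n, hi n]) (gammaf x t)%:E)%E @[n --> \oo] -->
   (\int[mu]_(t in `]0%R, +oo[) (gammaf x t)%:E)%E.
  rewrite -bigcup_exhaust; apply: ge0_nondecreasing_set_cvg_integral => //.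
    exact: exhaust_le.
  by move=> i; apply/measurable_EFinP; exact: mg.
have H2 : (\int[mu]_(t in `[lo n, hi n]) (gammaf x t)%:E)%E @[n --> \oo] -->
   (limn (J x))%:E.
  under eq_fun do rewrite -JE.
  by apply: cvg_EFin => //; exact: nearW.
by rewrite (cvg_unique _ H1 H2).
Qed.

Lemma cvg_pow_lo x : 0 < x -> (fun n => lo n `^ x * expR (- lo n)) @ \oo --> (0 : R).
Proof.
move=> x0; apply/cvgrPdist_lt => e e0.
have /cvgrPdist_lt/(_ _ e0) := powR_cvg0 x0.
rewrite /at_right/within/= => /nbhs_ballP[d /= d0 dP].
have [N] := ltr_add_invr d0; rewrite add0r => Nd.
exists N => // n /= Nn; rewrite sub0r normrN ger0_norm; last first.
  by rewrite mulr_ge0 ?powR_ge0 ?expR_ge0.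
have lod : lo n < d.
  by apply: le_lt_trans Nd; rewrite lef_pV2 ?posrE ?ltr0n// ler_nat !ltnS leqW.
have := dP (lo n); rewrite -ball_normE/= sub0r normrN gtr0_norm// => /(_ lod (lo_gt0 n)).
rewrite sub0r normrN ger0_norm ?powR_ge0//; apply: le_lt_trans.
by rewrite ler_piMr ?powR_ge0// -expR0 ler_expR oppr_le0 ltW.
Qed.

Lemma cvg_pow_hi x : 0 < x -> (fun n => hi n `^ x * expR (- hi n)) @ \oo --> (0 : R).
Proof.
move=> x0; have [K K0 HK] := powR_le_expR (ltr_wpDl ler01 x0).
apply/cvgrPdist_lt => e e0.
have [N] := ltr_add_invr (divr_gt0 e0 K0); rewrite add0r => Ne.
exists N => // n /= Nn; rewrite sub0r normrN ger0_norm; last first.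
  by rewrite mulr_ge0 ?powR_ge0 ?expR_ge0.
have h0 : 0 < hi n by rewrite ltr0n.
rewrite expRN ltr_pdivrMr ?expR_gt0//.
have := HK _ h0; rewrite powRD; last by rewrite (gt_eqF h0) implybT.
rewrite (powRr1 (ltW h0)) => H; rewrite -(ltr_pM2l h0); apply: le_lt_trans H _.
rewrite mulrA ltr_pM2r ?expR_gt0//.
move: Ne; rewrite ltr_pdivlMr// mulrC ltr_pdivrMr ?ltr0n// mulrC => Ne.
by apply: lt_le_trans Ne _; rewrite ler_pM2r// ler_nat !ltnS leqW.
Qed.

Lemma GammaS x : 0 < x -> Gamma (x + 1) = x * Gamma x.
Proof.
move=> x0; have x10 : 0 < x + 1 by rewrite ltr_wpDr.
have [c0 _] := gamma_cvg x0; have [c1 _] := gamma_cvg x10.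
have H1 := lim_sub (lim_mul (@lim_cst _ x) c0) c1.
have H2 := lim_sub (cvg_pow_hi x0) (cvg_pow_lo x0).
have : x * Gamma x - Gamma (x + 1) = 0 - 0.
  apply: lim_unique H1 _.
  have -> // : (fun n => x * J x n - J (x + 1) n) =
      (fun n => hi n `^ x * expR (- hi n) - lo n `^ x * expR (- lo n)).
  by apply/funext => n; exact: gamma_boundary.
by move/eqP; rewrite subr0 subr_eq0 => /eqP.
Qed.

Lemma Gamma_gt0 x : 0 < x -> 0 < Gamma x.
Proof.
move=> x0; have [_ /(_ 0%N)] := gamma_cvg x0; apply: lt_le_trans.
(* A lower bound for the integrand on the first segment, from 1/2 to 2. *)
pose m := 2^-1 `^ x / 2 * expR (- 2) : R.
have m0 : 0 < m by rewrite mulr_gt0 ?expR_gt0// divr_gt0// powR_gt0// invr_gt0.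
apply: (@lt_le_trans _ _ (\int[mu]_(t in `[lo 0, hi 0]) m)%R).
  have -> : (\int[mu]_(t in `[lo 0, hi 0]) m)%R = m * hi 0 - m * lo 0.
    apply: (@Rintegral_derive (fun=> m) (fun t => m * t)) => //.
      move=> t _.
      apply: (is_derive_eq (is_derive_mul (is_derive_cst m t 1) (is_derive_id t 1))).
      by rewrite mulr1 mul0r addr0.
    by move=> t _; exact: cst_continuous.
  by rewrite -mulrBr mulr_gt0// subr_gt0.
apply: le_Rintegral => //.
- by apply: integrable_pos => // t _; exact: cst_continuous.
- by apply: integrable_pos => // t; exact: continuous_gammaf.
move=> t /=; rewrite in_itv/= => /andP[t1 t2].
have t0 : 0 < t by exact: lt_le_trans t1.
rewrite /m /gammaf ler_pM ?expR_ge0 ?divr_ge0 ?powR_ge0//; last first.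
  by rewrite ler_expR lerN2.
rewrite powRB; last by rewrite (gt_eqF t0) implybT.
rewrite (powRr1 (ltW t0)) ler_pM ?powR_ge0//.
  by apply: (ge0_ler_powR (ltW x0)); rewrite ?nnegrE ?invr_ge0// (ltW t0).
by rewrite lef_pV2 ?posrE.
Qed.

Lemma Gamma_pochhammer x n : 0 < x -> Gamma (x + n%:R) = pochhammer x n * Gamma x.
Proof.
move=> x0; elim: n => [|n ih]; first by rewrite addr0 /pochhammer big_ord0 mul1r.
have xn : 0 < x + n%:R by rewrite ltr_wpDr.
by rewrite -natr1 addrA (GammaS xn) ih /pochhammer big_ord_recr mulrA [_ * \prod_(i < n) _]mulrC.
Qed.

End GammaFunction.

(** * Polynomials with positive roots *)
Section PositiveRoots.
Context {R : realType}.
Implicit Types (p q : {poly R}) (a b c x : R) (cs : seq R).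

(** The list holds the inverses of the roots; this also normalizes the constant
    coefficient to 1. *)
Definition pos_rooted p := exists2 cs : seq R, all (fun c => 0 < c) cs &
  p = \prod_(c <- cs) (1 - c *: 'X).

Lemma horner_prod_lin (K : comNzRingType) (cs : seq K) (z : K) :
  (\prod_(d <- cs) (1 - d *: 'X)).[z] = \prod_(d <- cs) (1 - d * z).
Proof. by rewrite horner_prod; apply: eq_bigr => d _; rewrite !hornerE. Qed.

Lemma log_derivative_prod (K : fieldType) (cs : seq K) (z : K) :
  all (fun d => 1 - d * z != 0) cs ->
  z * (\prod_(d <- cs) (1 - d *: 'X))^`().[z] =
  (\prod_(d <- cs) (1 - d * z)) * \sum_(d <- cs) (1 - (1 - d * z)^-1).
Proof.
elim: cs => [|d cs ih] /=; first by rewrite !big_nil derivC horner0 !mulr0.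
move=> /andP[d0 /ih H]; rewrite !big_cons derivM !hornerE mulrDr.
rewrite mulrCA [X in _ + X]mulrCA {}H horner_prod_lin.
rewrite derivB derivC derivZ derivX !hornerE /=.
field.
by [].
Qed.

(** The operator [1 + a^-1 x d/dx], diagonal on monomials ([coef_euler]). *)
Definition euler a p := p + a^-1 *: ('X * p^`()).

Lemma coef_euler a p n : (euler a p)`_n = p`_n * (1 + n%:R / a).
Proof.
rewrite /euler coefD coefZ coefXM; case: n => [|n] /=.
  by rewrite mulr0 mul0r !addr0 mulr1.
by rewrite coef_deriv -mulr_natr; ring.
Qed.

Lemma Im_inv_lin c (z : R[i]) : complex.Im (1 - c%:C%C * z)^-1 =
  complex.Im z * (c / ((1 - c * complex.Re z) ^+ 2 + (c * complex.Im z) ^+ 2)).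
Proof.
case: z => x y; simpc => /=.
by rewrite sqrrN; ring.
Qed.

Lemma lin_neq0 c (z : R[i]) : 1 - c%:C%C * z != 0 ->
  0 < (1 - c * complex.Re z) ^+ 2 + (c * complex.Im z) ^+ 2.
Proof.
move=> z0; rewrite lt0r addr_ge0 ?sqr_ge0// andbT; apply: contra z0.
rewrite paddr_eq0 ?sqr_ge0// !sqrf_eq0 => /andP[/eqP z1 /eqP z2].
case: z z1 z2 => x y /= z1 z2; rewrite eq_complex; simpc => /=.
by rewrite z1 z2 oppr0 !eqxx.
Qed.

(** At a root [z] where the product does not vanish, [a] plus the sum of the
    [1 - (1 - c z)^-1] is zero. The imaginary parts of these terms all have the sign
    of [- Im z], so that [z] is real; and if [z <= 0] the terms are nonnegative,
    which contradicts [0 < a]. *)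
Lemma euler_root_pos a cs (z : R[i]) : 0 < a -> all (fun c => 0 < c) cs ->
  (map_poly (real_complex R) (euler a (\prod_(c <- cs) (1 - c *: 'X)))).[z] = 0 ->
  0 < z.
Proof.
move=> a0 cs0; pose ds : seq R[i] := [seq c%:C%C | c <- cs].
set p := \prod_(c <- cs) _ => Hz.
have pE : map_poly (real_complex R) p = \prod_(d <- ds) (1 - d *: 'X).
  rewrite rmorph_prod/= big_map; apply: eq_bigr => c _.
  by rewrite rmorphB rmorph1 /= map_polyZ map_polyX.
have Qz : (map_poly (real_complex R) p).[z] +
    (a^-1)%:C%C * (z * (map_poly (real_complex R) p)^`().[z]) = 0.
  rewrite -[RHS]Hz /euler rmorphD/= map_polyZ rmorphM/= map_polyX.
  by rewrite -deriv_map !hornerE.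
have [/allP lin|] := boolP (all (fun d => 1 - d * z != 0) ds); last first.
  rewrite -has_predC => /hasP[_ /mapP[c cin ->]] /=; rewrite negbK subr_eq0 => /eqP cz.
  have c0 : 0 < c by exact: (allP cs0).
  have -> : z = (c^-1)%:C%C.
    have cn0 : c%:C%C != 0 by rewrite fmorph_eq0 gt_eqF.
    by apply: (mulfI cn0); rewrite -cz -rmorphM divff ?rmorph1// gt_eqF.
  by rewrite ltcR invr_gt0.
move: Qz; rewrite pE log_derivative_prod ?horner_prod_lin; last exact/allP.
set P := \prod_(d <- ds) _; set S := \sum_(d <- ds) _.
have P0 : P != 0 by rewrite prodf_seq_neq0; apply/allP => d /lin.
rewrite mulrCA -{1}[P]mulr1 -mulrDr => /eqP; rewrite mulf_eq0 (negbTE P0)/= => /eqP HS.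
have aS : a%:C%C + S = 0.
  have ac : a%:C%C != 0 by rewrite fmorph_eq0 gt_eqF.
  by rewrite -[LHS](mulVKf ac) mulrDr mulVf// -fmorphV HS mulr0.
have SE : S = \sum_(c <- cs) (1 - (1 - c%:C%C * z)^-1) by rewrite /S big_map.
have k0 c : c \in cs -> 0 < c /\
    0 < (1 - c * complex.Re z) ^+ 2 + (c * complex.Im z) ^+ 2.
  move=> cin; split; first exact: (allP cs0).
  by apply: lin_neq0; apply: lin; apply: map_f.
have ImS : complex.Im z * \sum_(c <- cs)
    (c / ((1 - c * complex.Re z) ^+ 2 + (c * complex.Im z) ^+ 2)) = 0.
  have := congr1 (@complex.Im R) aS; rewrite SE raddfD/= add0r raddf_sum/=.
  under eq_bigr do rewrite raddfB/= Im_inv_lin sub0r.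
  by rewrite sumrN -mulr_sumr => /eqP; rewrite oppr_eq0 => /eqP.
have z_real : complex.Im z = 0.
  move/eqP: ImS; rewrite mulf_eq0 => /orP[/eqP//|].
  rewrite big_seq psumr_eq0; last first.
    by move=> c /k0[? ?]; rewrite divr_ge0// ltW.
  move=> /allP H; suff cs_nil : cs = [::].
    move: aS; rewrite SE cs_nil big_nil addr0 => /eqP; rewrite fmorph_eq0.
    by rewrite gt_eqF.
  case: cs H k0 {cs0 ds p pE lin P P0 S HS aS SE Hz} => // c cs /(_ c).
  rewrite mem_head/= => /(_ isT) H /(_ c); rewrite mem_head => /(_ isT)[c0 d0].
  by move: H; rewrite gt_eqF// divr_gt0.
rewrite ltcE z_real eqxx /= ltNge; apply/negP => x0.
have := congr1 (@complex.Re R) aS; rewrite SE raddfD/= raddf_sum/=.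
apply/eqP; rewrite gt_eqF// ltr_pwDl// big_seq; apply: sumr_ge0 => c cin.
have [c0 _] := k0 _ cin.
case: z z_real x0 {Hz lin P P0 S HS aS SE k0 ImS} => x y /= -> x0; simpc => /=.
rewrite expr0n addr0.
have u1 : 1 <= 1 - c * x by rewrite lerDl oppr_ge0 mulr_ge0_le0// ltW.
have u0 : 1 - c * x != 0 by rewrite gt_eqF// (lt_le_trans ltr01).
rewrite expr2 invfM mulrA divff// mul1r subr_ge0.
by rewrite invf_le1// (lt_le_trans ltr01).
Qed.

(** The polynomial splits over the complex numbers, and [euler_root_pos] applies to
    each of its roots. *)
Lemma pos_rooted_euler a p : 0 < a -> pos_rooted p -> pos_rooted (euler a p).
Proof.
move=> a0 [cs cs0 pE]; set Q := map_poly (real_complex R) (euler a p).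
have [rs QE] := closed_field_poly_normal Q.
have Q0 : Q.[0] = 1.
  rewrite /Q horner_coef0 coef_map/= coef_euler mul0r addr0 mulr1.
  rewrite pE -horner_coef0 horner_prod_lin big1 ?rmorph1//.
  by move=> c _; rewrite mulr0 subr0.
have Qn0 : Q != 0 by apply: contra_eq_neq Q0 => ->; rewrite horner0 eq_sym oner_eq0.
have rs0 r : r \in rs -> 0 < r.
  move=> rin; apply: (euler_root_pos a0 cs0); rewrite -pE -/Q.
  apply/eqP; rewrite -[_ == 0]/(root Q r) QE rootZ ?lead_coef_eq0//.
  by rewrite root_prod_XsubC.
pose es := [seq (complex.Re r)^-1 | r <- rs].
have reE r : r \in rs -> r = (complex.Re r)%:C%C /\ 0 < complex.Re r.
  by move=> /rs0; case: r => x y; rewrite ltcE/= => /andP[/eqP -> ?].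
exists es; first by apply/allP => _ /mapP[r rin ->]; rewrite invr_gt0; have [] := reE _ rin.
apply: (map_poly_inj (real_complex R)); rewrite -/Q.
have fac (r : R[i]) : r \in rs ->
    'X - r%:P = (- r)%:P * (1 - ((complex.Re r)^-1)%:C%C *: 'X).
  move=> /reE[rE r0].
  have -> : ((complex.Re r)^-1)%:C%C = r^-1 by rewrite [in RHS]rE fmorphV.
  have rn0 : r != 0 by rewrite rE fmorph_eq0 gt_eqF.
  rewrite mulrBr mulr1 -scalerAr mul_polyC scalerA mulrN mulVf//.
  by rewrite scaleN1r opprK polyCN addrC.
rewrite QE rmorph_prod/= big_map.
have prodE : \prod_(r <- rs) ('X - r%:P) = (\prod_(r <- rs) - r)%:P *
    \prod_(r <- rs) (1 - ((complex.Re r)^-1)%:C%C *: 'X).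
  rewrite rmorph_prod/= -big_split/=; apply: eq_big_seq => r /fac ->.
  by [].
rewrite prodE -mul_polyC mulrA -polyCM.
have -> : lead_coef Q * \prod_(r <- rs) - r = 1.
  rewrite -[RHS]Q0 [in RHS]QE hornerZ horner_prod; congr (_ * _).
  by apply: eq_bigr => r _; rewrite hornerXsubC sub0r.
rewrite mul1r; apply: eq_bigr => r _.
by rewrite rmorphB rmorph1 /= map_polyZ map_polyX.
Qed.

Lemma pos_rooted_eulers (as_ : seq R) p : all (fun a => 0 < a) as_ ->
  pos_rooted p -> exists2 q, pos_rooted q &
    forall n, q`_n = p`_n * \prod_(a <- as_) (1 + n%:R / a).
Proof.
elim: as_ => [_ pp|a as_ ih /= /andP[a0 as0] /(ih as0)[q qp qE]].
  by exists p => // n; rewrite big_nil mulr1.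
exists (euler a q); first exact: pos_rooted_euler.
by move=> n; rewrite coef_euler qE big_cons; ring.
Qed.

Lemma pos_rooted_scale c p : 0 < c -> pos_rooted p ->
  exists2 q, pos_rooted q & forall n, q`_n = p`_n * c ^+ n.
Proof.
move=> c0 [cs cs0 pE]; exists (p \Po (c *: 'X)); last first.
  move=> n; rewrite comp_polyE coef_sum.
  under eq_bigr do rewrite exprZn coefZ coefZ coefXn.
  have [np|pn] := ltnP n (size p); last first.
    rewrite nth_default// mul0r big1// => i _.
    by rewrite [n == i]gtn_eqF ?mulr0// (leq_trans (ltn_ord i)).
  rewrite (bigD1 (Ordinal np))//= eqxx mulr1 big1 ?addr0// => i ni.
  by case: eqP => [E|]; rewrite ?mulr0//; case/eqP: ni; apply/val_inj.
exists [seq c * d | d <- cs].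
  by rewrite all_map; apply/allP => d din /=; rewrite mulr_gt0// (allP cs0).
rewrite pE rmorph_prod/= big_map; apply: eq_bigr => d _.
by rewrite rmorphB rmorph1/= linearZ/= comp_polyX scalerA mulrC.
Qed.

Lemma pos_rooted_pow c N : 0 < c -> exists2 q, pos_rooted q &
  forall n, q`_n = (- c) ^+ n * 'C(N, n)%:R.
Proof.
move=> c0; exists ((1 - c *: 'X) ^+ N).
  exists (nseq N c); first by rewrite all_nseq c0 orbT.
  by rewrite big_nseq -Monoid.iteropE.
move=> n; rewrite addrC exprDn coef_sum.
have coefE i : ((- (c *: 'X)) ^+ (N - i) * 1 ^+ i *+ 'C(N, i) : {poly R})`_n =
    (- c) ^+ (N - i) * 'C(N, i)%:R * (n == N - i)%N%:R.
  by rewrite expr1n mulr1 -scaleNr exprZn coefMn coefZ coefXn -[LHS]mulr_natr mulrAC.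
under eq_bigr do rewrite coefE.
have [nN|Nn] := leqP n N; last first.
  rewrite bin_small// mulr0 big1// => i _; case: eqP => [E|]; rewrite ?mulr0//.
  by move: Nn; rewrite E ltnNge leq_subr.
have iN : (N - n < N.+1)%N by rewrite ltnS leq_subr.
rewrite (bigD1 (Ordinal iN))//= subKn// eqxx mulr1 bin_sub//.
rewrite big1 ?addr0// => i ni; case: eqP => [E|]; rewrite ?mulr0//.
case/eqP: ni; apply/val_inj => /=.
by rewrite E subKn// -ltnS.
Qed.

(** * Newton sums and their inequalities *)

Definition psum cs k : R := \sum_(c <- cs) c ^+ k.

(** Newton's identities [p' = - s p], where [s] stands for its generating series.
    For the coefficients [p] of a product of factors [1 - c X], the number [s n] is
    the sum of the [c ^+ n.+1]. *)
Definition newton (s p : nat -> R) := forall n, dcoef p n = - cauchy s p n.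

(** By induction on the list: the new factor contributes a geometric sum that
    telescopes. *)
Lemma newton_prod cs :
  newton (fun k => psum cs k.+1) (fun n => (\prod_(c <- cs) (1 - c *: 'X))`_n).
Proof.
elim: cs => [|c cs ih] n.
  rewrite /dcoef big_nil coef1 /= mulr0 /cauchy big1 ?oppr0// => i _.
  by rewrite /psum big_nil mul0r.
set p := fun n => (\prod_(c <- cs) (1 - c *: 'X))`_n in ih.
pose sp m : R := if m is m'.+1 then p m' else 0.
have qE m : (\prod_(d <- c :: cs) (1 - d *: 'X))`_m = p m - c * sp m.
  by rewrite big_cons mulrBl mul1r coefB -scalerAl coefZ coefXM /sp; case: m.
rewrite /dcoef qE /cauchy.
rewrite [X in _ = - X](eq_bigr (fun i : 'I_n.+1 =>
   c ^+ i.+1 * (p (n - i)%N - c * sp (n - i)%N) +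
   psum cs i.+1 * (p (n - i)%N - c * sp (n - i)%N))); last first.
  by move=> i _; rewrite qE /psum big_cons mulrDl.
rewrite big_split/=.
have geom m : \sum_(i < m.+1) c ^+ i.+1 * (p (m - i)%N - c * sp (m - i)%N) = c * p m.
  elim: m => [|m ihm]; first by rewrite big_ord1/= mulr0 subr0 expr1.
  rewrite big_ord_recl/=; under eq_bigr do rewrite /bump/= add1n exprS -mulrA subSS.
  by rewrite -mulr_sumr ihm subn0 expr1/=; ring.
rewrite geom.
rewrite [X in - (_ + X)](eq_bigr (fun i : 'I_n.+1 =>
   psum cs i.+1 * p (n - i)%N - c * (psum cs i.+1 * sp (n - i)%N))); last first.
  by move=> i _; rewrite mulrBr (mulrCA _ c).
rewrite sumrB -mulr_sumr.
have sumE : \sum_(i < n.+1) psum cs i.+1 * p (n - i)%N = - dcoef p n.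
  by rewrite ih opprK.
rewrite sumE.
have spE : \sum_(i < n.+1) psum cs i.+1 * sp (n - i)%N = - (n%:R * p n).
  case: n {sumE} => [|n]; first by rewrite big_ord1/= mulr0 mul0r oppr0.
  rewrite big_ord_recr/= subnn mulr0 addr0 -[RHS]/(- dcoef p n) ih opprK.
  by apply: eq_bigr => i _; rewrite subSn// -ltnS.
rewrite spE /dcoef/=; ring.
Qed.

Lemma newton_first (s p : nat -> R) n : p 0%N = 1 -> newton s p ->
  s n = - dcoef p n - \sum_(i < n) s i * p (n - i)%N.
Proof.
move=> p0 /(_ n); rewrite /cauchy big_ord_recr/= subnn p0 mulr1 => ->.
by rewrite opprK addrAC subrr add0r.
Qed.

(** Newton's identities compute [s n] from finitely many coefficients by ring
    operations, which are continuous. *)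
Lemma newton_lim (s p : nat -> R) (sN pN : nat -> nat -> R) : p 0%N = 1 -> newton s p ->
  (forall N, pN N 0%N = 1) -> (forall N, newton (sN N) (pN N)) ->
  (forall n, pN^~ n @ \oo --> p n) -> forall n, sN^~ n @ \oo --> s n.
Proof.
move=> p0 sp pN0 spN pcvg n; elim/ltn_ind: n => n ih.
have sum_cvg m : (m <= n)%N ->
    (fun N => \sum_(i < m) sN N i * pN N (n - i)%N) @ \oo -->
    \sum_(i < m) s i * p (n - i)%N.
  elim: m => [_|m ihm mn].
    by under eq_fun do rewrite big_ord0; rewrite big_ord0; exact: lim_cst.
  under eq_fun do rewrite big_ord_recr/=; rewrite big_ord_recr/=.
  exact: (lim_add (ihm (ltnW mn)) (lim_mul (ih _ mn) (pcvg _))).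
rewrite (newton_first n p0 sp).
under eq_fun do rewrite (newton_first n (pN0 _) (spN _)).
apply: lim_sub (sum_cvg n (leqnn n)).
have := lim_mul (@lim_cst _ (- 1)) (lim_mul (@lim_cst _ n.+1%:R) (pcvg n.+1)).
rewrite /dcoef mulN1r; under eq_fun do rewrite mulN1r.
by [].
Qed.

(** Inequalities between the power sums of positive numbers that survive limits.
    They stand in for the zeros of the limit function. *)
Record moment_like (s : nat -> R) : Prop := MomentLike {
  moment_ge0 : forall n, 0 <= s n;
  moment_logconvex : forall n, s n.+1 ^+ 2 <= s n * s n.+2;
  moment_submul : forall m n, s (m + n).+1 <= s m * s n }.

(** Adding a number [c] to the list increases [s_n s_(n+2) - s_(n+1)^2] by
    nonnegative multiples of the [(d - c) ^+ 2]; and a product of two power sums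
    contains its diagonal terms. *)
Lemma psum_moment_like cs : all (fun c => 0 < c) cs ->
  moment_like (fun k => psum cs k.+1).
Proof.
move=> cs0; have c_ge0 c k : c \in cs -> 0 <= c ^+ k.
  by move=> cin; rewrite exprn_ge0// ltW// (allP cs0).
have psum_ge0 ds k : {subset ds <= cs} -> 0 <= psum ds k.
  by move=> sub; rewrite /psum big_seq sumr_ge0// => c /sub/c_ge0.
split=> [n|n|m n]; first exact: psum_ge0.
- have : {subset cs <= cs} by [].
  elim: {1 3 4 5}cs => [|c ds ih] sub; first by rewrite /psum !big_nil expr0n mul0r.
  have {}ih := ih (fun x xin => sub x (mem_behead (s := c :: ds) xin)).
  rewrite /psum !big_cons -!/(psum ds _).
  have c0 : 0 <= c by have := c_ge0 c 1%N (sub _ (mem_head _ _)); rewrite expr1.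
  have sq : 0 <= psum ds n.+3 - 2 * c * psum ds n.+2 + c ^+ 2 * psum ds n.+1.
    rewrite /psum !mulr_sumr -sumrB -big_split/= big_seq sumr_ge0// => d din.
    have -> : d ^+ n.+3 - 2 * c * d ^+ n.+2 + c ^+ 2 * d ^+ n.+1 =
      d ^+ n.+1 * (d - c) ^+ 2 by rewrite !exprS; ring.
    by rewrite mulr_ge0 ?sqr_ge0// c_ge0// sub// inE din orbT.
  rewrite -subr_ge0; move: ih; rewrite -subr_ge0 => ih.
  have -> : (c ^+ n.+1 + psum ds n.+1) * (c ^+ n.+3 + psum ds n.+3) -
      (c ^+ n.+2 + psum ds n.+2) ^+ 2 =
      (psum ds n.+1 * psum ds n.+3 - psum ds n.+2 ^+ 2) + c ^+ n.+1 *
      (psum ds n.+3 - 2 * c * psum ds n.+2 + c ^+ 2 * psum ds n.+1).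
    by rewrite !exprS; ring.
  by rewrite addr_ge0// mulr_ge0// exprn_ge0.
have -> : (m + n).+2 = (m.+1 + n.+1)%N by rewrite addSn addnS.
rewrite [X in X <= _]/psum [X in _ <= X * _]/psum mulr_suml big_seq [leRHS]big_seq.
apply: ler_sum => c cin; rewrite exprD ler_wpM2l ?c_ge0//.
rewrite /psum (big_rem c)//= lerDl.
by apply: psum_ge0 => x; exact: mem_rem.
Qed.

Lemma lim_ge0 (u : nat -> R) (l : R) : (forall n, 0 <= u n) -> u @ \oo --> l -> 0 <= l.
Proof.
move=> u0 ul; have cu : cvgn u by apply: cvgP ul.
by rewrite -(cvg_lim (@Rhausdorff R) ul); apply: limr_ge => //; exact: nearW.
Qed.

Lemma moment_like_lim s (sN : nat -> nat -> R) :
  (forall N, moment_like (sN N)) -> (forall n, sN^~ n @ \oo --> s n) ->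
  moment_like s.
Proof.
move=> mN scvg; split=> [n|n|m n].
- have := scvg n; apply: lim_ge0 => N; exact: moment_ge0.
- have := lim_sub (lim_mul (scvg n) (scvg n.+2)) (lim_mul (scvg n.+1) (scvg n.+1)).
  rewrite -subr_ge0; apply: lim_ge0 => N.
  by rewrite subr_ge0 -expr2; exact: moment_logconvex.
- have := lim_sub (lim_mul (scvg m) (scvg n)) (scvg (m + n).+1).
  rewrite -subr_ge0; apply: lim_ge0 => N.
  by rewrite subr_ge0; exact: moment_submul.
Qed.

End PositiveRoots.

(** * Limits of polynomials with positive roots *)
Section Approximation.
Context {R : realType}.
Implicit Types (a b c x k : R) (s p : nat -> R).

Lemma newton_exists p : p 0%N = 1 -> exists s, newton s p.
Proof.
move=> p0.
(* Course-of-values recursion: [L n] lists the first [n] values. *)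
pose fix L n : seq R := if n is m.+1 then
  rcons (L m) (- dcoef p m - \sum_(i < m) (L m)`_i * p (m - i)%N) else [::].
have szL n : size (L n) = n by elim: n => //= n ih; rewrite size_rcons ih.
have LS i m : (i < m)%N -> (L m)`_i = (L i.+1)`_i.
  elim: m => // m ih; rewrite ltnS leq_eqVlt => /predU1P[->//|im].
  by rewrite [L m.+1]/= nth_rcons szL im ih.
have LE n : (L n.+1)`_n = - dcoef p n - \sum_(i < n) (L n)`_i * p (n - i)%N.
  by rewrite /= nth_rcons szL ltnn eqxx.
have cauchy_rec (f : nat -> R) n :
    cauchy f p n = \sum_(i < n) f i * p (n - i)%N + f n * p 0%N.
  by rewrite /cauchy big_ord_recr/= subnn.
exists (fun n => (L n.+1)`_n) => n; rewrite cauchy_rec LE p0 mulr1.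
rewrite (eq_bigr (fun i : 'I_n => (L n)`_i * p (n - i)%N)).
  by rewrite addrC subrK opprK.
by move=> i _; rewrite (LS i n).
Qed.

Lemma pochhammerS x n : pochhammer x n.+1 = pochhammer x n * (x + n%:R).
Proof. by rewrite /pochhammer big_ord_recr. Qed.

Lemma pochhammer0 x : pochhammer x 0 = 1.
Proof. by rewrite /pochhammer big_ord0. Qed.

Lemma pochhammer_gt0 x n : 0 < x -> 0 < pochhammer x n.
Proof. by move=> x0; apply: prodr_gt0 => i _; rewrite ltr_wpDr. Qed.

Lemma pochhammerD x m n :
  pochhammer x (m + n) = pochhammer x m * pochhammer (x + m%:R) n.
Proof.
elim: n => [|n ih]; first by rewrite addn0 pochhammer0 mulr1.
by rewrite addnS !pochhammerS ih natrD -!mulrA addrA.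
Qed.

(** The product of the [N + n] factors [x, x + 1, ...] can be split after the first
    [N] of them or after the first [n]. *)
Lemma prod_shift x N n : 0 < x -> \prod_(j < N) (1 + n%:R / (x + j%:R)) =
  pochhammer (x + N%:R) n / pochhammer x n.
Proof.
move=> x0; have p0 m : pochhammer x m != 0 by rewrite gt_eqF ?pochhammer_gt0.
have -> : \prod_(j < N) (1 + n%:R / (x + j%:R)) =
    pochhammer (x + n%:R) N / pochhammer x N.
  rewrite /pochhammer -prodf_div; apply: eq_bigr => j _.
  have xj : x + j%:R != 0 by rewrite gt_eqF// ltr_wpDr.
  by rewrite -{1}(divff xj) -mulrDl addrAC.
apply/eqP; rewrite eqr_div//; apply/eqP.
by rewrite mulrC -pochhammerD addnC pochhammerD mulrC.
Qed.

Lemma lim_inv_succ : (fun N : nat => N.+1%:R^-1 : R) @ \oo --> 0.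
Proof. exact: cvg_harmonic. Qed.

Lemma lim_pochhammer x n :
  (fun N : nat => pochhammer (x + N.+1%:R) n / N.+1%:R ^+ n) @ \oo --> (1 : R).
Proof.
elim: n => [|n ih].
  under eq_fun do rewrite pochhammer0 expr0 divr1.
  exact: lim_cst.
have -> : (fun N : nat => pochhammer (x + N.+1%:R) n.+1 / N.+1%:R ^+ n.+1) =
    (fun N => pochhammer (x + N.+1%:R) n / N.+1%:R ^+ n *
              (1 + (x + n%:R) * N.+1%:R^-1)).
  apply/funext => N; rewrite pochhammerS exprSr; field.
  by rewrite addrC natr1 pnatr_eq0/= expf_neq0// pnatr_eq0.
have := lim_mul ih (lim_add (@lim_cst _ 1) (lim_mul (@lim_cst _ (x + n%:R)) lim_inv_succ)).
by rewrite mulr0 addr0 mulr1.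
Qed.

Lemma lim_binomial n :
  (fun N : nat => 'C(N.+1, n)%:R / N.+1%:R ^+ n) @ \oo --> (n`!%:R^-1 : R).
Proof.
elim: n => [|n ih].
  under eq_fun do rewrite bin0 expr0 divr1.
  by rewrite invr1; exact: lim_cst.
have -> : (fun N : nat => 'C(N.+1, n.+1)%:R / N.+1%:R ^+ n.+1 : R) =
    (fun N => 'C(N.+1, n)%:R / N.+1%:R ^+ n *
              ((1 - n%:R * N.+1%:R^-1) * n.+1%:R^-1)).
  apply/funext => N.
  have E : 'C(N.+1, n.+1)%:R * n.+1%:R = 'C(N.+1, n)%:R * (N.+1%:R - n%:R) :> R.
    have [nN|Nn] := leqP n N.+1.
      by rewrite -natrB// -!natrM mulnC mul_bin_left mulnC.
    by rewrite !bin_small ?mul0r// ltnW.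
  have n0 : n.+1%:R != 0 :> R by rewrite pnatr_eq0.
  have -> : 'C(N.+1, n.+1)%:R = 'C(N.+1, n)%:R * (N.+1%:R - n%:R) / n.+1%:R :> R.
    by rewrite -E mulfK.
  rewrite exprSr; field.
  by rewrite -!natr1 in n0 *; rewrite [1 + _]addrC n0 [1 + _]addrC natr1 pnatr_eq0/= expf_neq0// pnatr_eq0.
have := lim_mul ih (lim_mul (lim_sub (@lim_cst _ 1)
  (lim_mul (@lim_cst _ n%:R) lim_inv_succ)) (@lim_cst _ n.+1%:R^-1)).
by rewrite mulr0 subr0 mul1r factS natrM invfM mulrC.
Qed.

(** A hypergeometric series with lower parameters [xs], followed by the operators
    [euler b] for [b] in [bs]. *)
Definition hyper_coef k (xs bs : seq R) n : R := (- k) ^+ n / n`!%:R *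
  \prod_(x <- xs) (pochhammer x n)^-1 * \prod_(b <- bs) (1 + n%:R / b).

(** Euler's product: apply [euler (x + j)] with [x] in [xs] and [j <= N], then
    [euler b] with [b] in [bs], to [(1 - X / N.+1) ^+ N.+1], and rescale the
    variable by [k / N.+1 ^+ size xs]. The resulting polynomials have positive
    roots, and their coefficients [appr N] tend to [hyper_coef]. *)
Lemma hyper_moment_like k (xs bs : seq R) s : 0 < k ->
  all (fun x => 0 < x) xs -> all (fun b => 0 < b) bs ->
  newton s (hyper_coef k xs bs) -> moment_like s.
Proof.
move=> k0 xs0 bs0 sp.
pose appr N n : R := (- k) ^+ n * ('C(N.+1, n)%:R / N.+1%:R ^+ n) *
  \prod_(x <- xs) (pochhammer (x + N.+1%:R) n / N.+1%:R ^+ n / pochhammer x n) *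
  \prod_(b <- bs) (1 + n%:R / b).
have apprP N : exists2 cs, all (fun c => 0 < c) cs &
    forall n, (\prod_(c <- cs) (1 - c *: 'X))`_n = appr N n.
  have N0 : 0 < N.+1%:R :> R by rewrite ltr0n.
  have Ni0 : 0 < (N.+1%:R : R)^-1 by rewrite invr_gt0.
  have [q1 q1p q1E] := pos_rooted_pow N.+1 Ni0.
  pose as_ := flatten [seq [seq x + (nat_of_ord j)%:R | j <- enum 'I_N.+1] | x <- xs] ++ bs.
  have as0 : all (fun a => 0 < a) as_.
    rewrite all_cat bs0 andbT; apply/allP => a /flatten_mapP[x xin /mapP[j _ ->]].
    by rewrite ltr_wpDr// (allP xs0).
  have [q2 q2p q2E] := pos_rooted_eulers as0 q1p.
  have c0 : 0 < k / N.+1%:R ^+ size xs by rewrite divr_gt0// exprn_gt0.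
  have [q3 [cs cs0 ->] q3E] := pos_rooted_scale c0 q2p.
  exists cs => // n; rewrite q3E q2E q1E /as_ big_cat/= /appr.
  have -> : \prod_(a <- flatten [seq [seq x + (nat_of_ord j)%:R | j <- enum 'I_N.+1] | x <- xs])
      (1 + n%:R / a) = \prod_(x <- xs) (pochhammer (x + N.+1%:R) n / pochhammer x n).
    rewrite big_flatten/= big_map big_seq [RHS]big_seq; apply: eq_bigr => x xin.
    by rewrite big_map big_enum/= prod_shift// (allP xs0).
  have -> : \prod_(x <- xs) (pochhammer (x + N.+1%:R) n / N.+1%:R ^+ n / pochhammer x n) =
      \prod_(x <- xs) (pochhammer (x + N.+1%:R) n / pochhammer x n) *
      (N.+1%:R ^- n) ^+ size xs.
    elim: (xs) => [|x ys ih]; first by rewrite !big_nil mulr1.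
    by rewrite !big_cons ih/= exprS; ring.
  have -> : (N.+1%:R ^- n) ^+ size xs = ((N.+1%:R ^+ size xs)^-1) ^+ n :> R.
    by rewrite -!exprVn -!exprM mulnC.
  rewrite exprMn -!exprVn [(- k) ^+ n]exprNn [(- N.+1%:R^-1) ^+ n]exprNn.
  ring.
have /choice[cs csP] : forall N, exists c : seq R, all (fun c => 0 < c) c /\
    forall n, (\prod_(d <- c) (1 - d *: 'X))`_n = appr N n.
  by move=> N; have [c c0 cE] := apprP N; exists c.
apply: (@moment_like_lim _ s (fun N (j : nat) => psum (cs N) j.+1)).
  by move=> N; apply: psum_moment_like; have [] := csP N.
apply: (@newton_lim _ s (hyper_coef k xs bs) _ appr) => //.
- rewrite /hyper_coef expr0 fact0 divr1 mul1r !big1 ?mulr1//.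
    by move=> b _; rewrite mul0r addr0.
  by move=> x _; rewrite pochhammer0 invr1.
- move=> N; have [_ /(_ 0%N) <-] := csP N.
  rewrite -horner_coef0 horner_prod_lin big1// => c _.
  by rewrite mulr0 subr0.
- move=> N; have [_ E] := csP N; have := @newton_prod _ (cs N).
  by congr newton; apply/funext => n; rewrite E.
move=> n; rewrite /appr /hyper_coef.
have P (ys : seq R) : (fun N : nat => \prod_(x <- ys)
    (pochhammer (x + N.+1%:R) n / N.+1%:R ^+ n / pochhammer x n)) @ \oo -->
    \prod_(x <- ys) (pochhammer x n)^-1.
  elim: ys => [|x ys ih].
    by under eq_fun do rewrite big_nil; rewrite big_nil; exact: lim_cst.
  under eq_fun do rewrite big_cons; rewrite big_cons; apply: (lim_mul _ ih).
  by have := lim_mul (@lim_pochhammer x n) (@lim_cst _ (pochhammer x n)^-1); rewrite mul1r.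
exact: (lim_mul (lim_mul (lim_mul (@lim_cst _ ((- k) ^+ n)) (@lim_binomial n)) (P xs))
  (@lim_cst _ (\prod_(b <- bs) (1 + n%:R / b)))).
Qed.

End Approximation.

(** * Growth rate of the power sums *)
Section MomentGrowth.
Context {R : realType}.
Local Notation C := (Cplx R).
Implicit Types (x r e m : R) (z : C) (s p : nat -> R).

(** The first bound makes the series of [s] converge inside the radius [m^-1], the
    second one makes it diverge there. *)
Definition growth_rate s m := [/\ 0 < m, forall n, s n.+1 <= m * s n &
  forall n, m ^+ n.+1 <= s n].

Lemma ratio_le s n k : (forall n, 0 < s n) -> moment_like s ->
  s n.+1 / s n <= s (n + k).+1 / s (n + k)%N.
Proof.
move=> s0 [_ lc _]; elim: k => [|k ih]; first by rewrite addn0.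
rewrite addnS; apply: le_trans ih _.
rewrite ler_pdivrMr// mulrAC ler_pdivlMr//.
by rewrite -expr2 mulrC lc.
Qed.

(** Log-convexity makes the ratios [r n = s n.+1 / s n] nondecreasing, and
    submultiplicativity bounds them by [s 0]; [m] is their limit. Since
    [r n ^+ k.+1 * s n <= s (n + k).+1 <= s k * s n], the powers of [m] are bounded
    by [s] as well. *)
Lemma moment_growth s : (forall n, 0 < s n) -> moment_like s ->
  exists m, growth_rate s m.
Proof.
move=> s0 ms; have [_ lc sm] := ms.
pose r n := s n.+1 / s n.
have r0 n : 0 < r n by rewrite divr_gt0.
have r_nd : nondecreasing_seq r.
  by move=> i j /subnKC <-; exact: ratio_le.
have r_ub n : r n <= s 0%N.
  by rewrite ler_pdivrMr// mulrC; have := sm n 0%N; rewrite addn0.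
have rcvg : r @ \oo --> limn r.
  by apply: nondecreasing_is_cvgn => //; exists (s 0%N) => _ [n _ <-].
have r_le n : r n <= limn r by apply: nondecreasing_cvgn_le.
exists (limn r); split=> [|n|k].
- exact: lt_le_trans (r0 0%N) (r_le 0%N).
- by rewrite -ler_pdivrMr//; exact: r_le.
have rk n j : r n ^+ j * s n <= s (n + j)%N.
  elim: j => [|j ih]; first by rewrite addn0 mul1r.
  rewrite addnS exprS -mulrA; apply: le_trans (ler_wpM2l (ltW (r0 n)) ih) _.
  by rewrite -ler_pdivlMr//; exact: ratio_le.
have rks n : 0 <= s k - r n ^+ k.+1.
  rewrite subr_ge0 -(ler_pM2r (s0 n)) [leRHS]mulrC.
  by apply: le_trans (rk n k.+1) _; rewrite addnS; exact: sm.
have rX j : (fun n => r n ^+ j) @ \oo --> limn r ^+ j.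
  elim: j => [|j ih]; first by under eq_fun do rewrite expr0; exact: lim_cst.
  by under eq_fun do rewrite exprS; rewrite exprS; exact: lim_mul rcvg ih.
by rewrite -subr_ge0; exact: (lim_ge0 rks (lim_sub (@lim_cst _ (s k)) (rX k.+1))).
Qed.

Lemma growth_asum s m r : (forall n, 0 < s n) -> growth_rate s m -> 0 <= r ->
  r * m < 1 -> asum s r.
Proof.
move=> s0 [m0 sm _] r0 rm1; exists (s 0%N / (1 - r * m)) => N.
have q0 : 0 < 1 - r * m by rewrite subr_gt0.
rewrite ler_pdivlMr//.
have sn n : s n <= m ^+ n * s 0%N.
  elim: n => [|n ih]; first by rewrite mul1r.
  by apply: le_trans (sm n) _; rewrite exprS -mulrA ler_wpM2l// ltW.
apply: (@le_trans _ _ ((\sum_(n < N) s 0%N * (r * m) ^+ n) * (1 - r * m))).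
  rewrite ler_wpM2r ?(ltW q0)//; apply: ler_sum => n _.
  rewrite ger0_norm ?(ltW (s0 _))//.
  have -> : s 0%N * (r * m) ^+ n = m ^+ n * s 0%N * r ^+ n by rewrite exprMn; ring.
  by rewrite ler_wpM2r ?exprn_ge0.
rewrite -mulr_sumr -mulrA [_ * (1 - _)]mulrC -[1 - _]opprB mulNr -subrX1 opprB.
by rewrite ler_piMr ?(ltW (s0 _))// gerBl exprn_ge0// mulr_ge0// ltW.
Qed.

Lemma bernoulli (y : R) n : 0 <= y <= 1 -> 1 - n%:R * y <= (1 - y) ^+ n.
Proof.
move=> /andP[y0 y1]; elim: n => [|n ih]; first by rewrite mul0r subr0 expr0.
rewrite exprSr; apply: le_trans (ler_wpM2r _ ih); last by rewrite subr_ge0.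
rewrite -natr1; have : 0 <= n%:R * (y * y) by rewrite !mulr_ge0.
by move=> H; nra.
Qed.

(** By Bernoulli's inequality each of the first [N] terms is still at least [1/2]
    at this [x], so the sum is large just below [m^-1]. *)
Lemma growth_large s m N : growth_rate s m -> (0 < N)%N ->
  let x := m^-1 * (1 - (2 * N%:R)^-1) in
  [/\ 0 < x, x * m < 1 & N%:R / 2 <= \sum_(k < N) s k * x ^+ k.+1].
Proof.
move=> [m0 _ ms] N0 x.
have N1 : 1 <= N%:R :> R by rewrite ler1n.
have N2 : 0 < 2 * N%:R :> R by rewrite mulr_gt0// (lt_le_trans ltr01).
set y := (2 * N%:R)^-1 : R.
have y0 : 0 < y by rewrite invr_gt0.
have y1 : y <= 1 / 2 by rewrite /y invfM mul1r ler_piMr// invf_le1// (lt_le_trans ltr01).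
have xm : x * m = 1 - y by rewrite /x mulrAC mulVf ?mul1r// gt_eqF.
have x0 : 0 < x by rewrite /x mulr_gt0 ?invr_gt0// -/y; lra.
split=> //; first by rewrite xm; lra.
have -> : N%:R / 2 = \sum_(k < N) 2^-1 :> R.
  by rewrite sumr_const card_ord -[RHS]mulr_natl.
apply: ler_sum => k _.
apply: (@le_trans _ _ (m ^+ k.+1 * x ^+ k.+1)); last first.
  by rewrite ler_wpM2r// exprn_ge0// ltW.
rewrite mulrC -exprMn xm; have := @bernoulli y k.+1; rewrite (ltW y0)/= => H.
apply: le_trans (H _); last by lra.
have : k.+1%:R * y <= N%:R * y by rewrite ler_pM2r// ler_nat.
have -> : N%:R * y = 2^-1 by rewrite /y; field; rewrite gt_eqF// (lt_le_trans ltr01).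
lra.
Qed.

(** * Strictness *)

(** Newton's identities at two consecutive indices, combined so that beyond [s 0]
    only the gaps [s j.+1 - m * s j] occur. *)
Lemma newton_ratio_gap s p m n : newton s p ->
  n.+1%:R * p n.+1 - m * (n%:R * p n) =
  - (s 0%N * p n) - \sum_(j < n) (s j.+1 - m * s j) * p (n - j.+1)%N.
Proof.
move=> sp; have E := sp n; rewrite /dcoef in E; rewrite E /cauchy big_ord_recl subn0.
case: n E => [|n] _.
  by rewrite !big_ord0 mul0r mulr0 !addr0 subr0.
have := sp n; rewrite /dcoef => ->.
under [in RHS]eq_bigr do rewrite mulrBl.
rewrite sumrB /cauchy mulrN opprK mulr_sumr opprD -!addrA; congr (_ + _).
rewrite opprB addrC; congr (_ - _).
by apply: eq_bigr => i _; rewrite mulrA subSS.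
Qed.

(** By log-convexity one equality [s n.+1 = m * s n] makes all later gaps vanish, so
    that the sum in [newton_ratio_gap] has a fixed number of terms. As [p] decays
    fast, its term of lowest index dominates all others, which forces the last
    nonzero gap to vanish as well. Descending in this way, one is left without
    gaps, and [n.+1 * p n.+1 = (m * n - s 0) * p n] contradicts the alternating
    signs of [p] for large [n]. *)
Lemma growth_strict s p m K : (forall n, 0 < s n) -> moment_like s ->
  growth_rate s m -> newton s p ->
  (forall n, 0 < (- 1) ^+ n * p n) ->
  (forall n, n.+1%:R ^+ 2 * `|p n.+1| <= K * `|p n|) ->
  forall n, s n.+1 < m * s n.
Proof.
move=> s0 ms [m0 sm _] sp palt pdec n0.
rewrite lt_neqAle sm andbT; apply/eqP => eq0.
pose b j := s j.+1 - m * s j.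
have b_zero j : (n0 <= j)%N -> b j = 0.
  move=> /subnKC <-; apply/eqP; rewrite subr_eq0 eq_le sm/=.
  rewrite -ler_pdivlMr//; apply: le_trans (ratio_le _ (j - n0) s0 ms).
  by rewrite eq0 mulfK// gt_eqF.
have dE n : `|p n| = (- 1) ^+ n * p n.
  by rewrite -(gtr0_norm (palt n)) normrM normrX normrN1 expr1n mul1r.
have d0 n : 0 < `|p n| by rewrite dE.
have K0 : 0 < K.
  have := lt_le_trans _ (pdec 0%N); rewrite expr1n mul1r => /(_ _ (d0 _)).
  by rewrite pmulr_lgt0.
have {eq0} : forall j, (n0 <= j)%N -> b j = 0 by [].
elim: n0 {b_zero} => [|J ih] b_zero.
  (* No gap is left, so [n.+1 * `|p n.+1| = (s 0 - m * n) * `|p n|], which fails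
     as soon as [n] exceeds [s 0 / m]. *)
  pose n := (`|Num.ceil (s 0%N / m)|).+1%N.
  have := newton_ratio_gap m n sp; rewrite big1; last first.
    by move=> j _; rewrite -/(b j) b_zero// mul0r.
  rewrite subr0 => H.
  have : (- 1) ^+ n.+1 * (n.+1%:R * p n.+1) = (s 0%N - m * n%:R) * `|p n|.
    move/eqP: H; rewrite subr_eq => /eqP ->; rewrite dE exprS; ring.
  move=> E; have : 0 < (s 0%N - m * n%:R) * `|p n|.
    by rewrite -E mulrCA mulr_gt0// ltr0n.
  rewrite pmulr_lgt0// subr_gt0 => {}E.
  have : s 0%N / m < n%:R.
    exact: lt_succ_ceil.
  by rewrite ltr_pdivrMr// mulrC => /(lt_trans E); rewrite ltxx.
apply: ih => j; rewrite leq_eqVlt => /predU1P[<-{j}|]; last exact: b_zero.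
(* [M] adds up the coefficients of all terms other than [b J * p N] in the identity
   at index [J.+1 + N]; by the decay of [p] each of these terms is at most its
   coefficient times [K / N.+1 * `|p N|]. *)
pose M := s 0%N + \sum_(j < J) `|b j| + 1 + m.
have M0 : 0 < M.
  by rewrite /M -addrA ltr_wpDl ?addr_gt0// addr_ge0 ?(ltW (s0 _))// sumr_ge0.
have bound N : K <= N.+1%:R -> `|b J| <= K / N.+1%:R * M.
  move=> KN; have N0 : 0 < N.+1%:R :> R by rewrite ltr0n.
  have KN1 : K / N.+1%:R <= 1 by rewrite ler_pdivrMr// mul1r.
  have KN0 : 0 <= K / N.+1%:R by rewrite divr_ge0// ltW.
  have stepk k : (N <= k)%N -> k.+1%:R * `|p k.+1| <= K / N.+1%:R * `|p k|.
    move=> Nk; have k0 : 0 < k.+1%:R :> R by rewrite ltr0n.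
    rewrite mulrAC ler_pdivlMr//; apply: le_trans _ (pdec k).
    by rewrite mulrAC expr2 ler_wpM2r// ler_wpM2l ?(ltW k0)// ler_nat.
  have step1 k : (N <= k)%N -> `|p k.+1| <= K / N.+1%:R * `|p k|.
    move=> Nk; apply: le_trans _ (stepk _ Nk).
    by rewrite ler_peMl// ler1n.
  have mono i : `|p (N + i)%N| <= `|p N|.
    elim: i => [|i ihi]; first by rewrite addn0.
    rewrite addnS; apply: le_trans (step1 _ (leq_addr _ _)) _.
    by apply: le_trans _ ihi; rewrite ler_piMl.
  have small i : `|p (N + i).+1| <= K / N.+1%:R * `|p N|.
    apply: le_trans (step1 _ (leq_addr _ _)) _.
    by rewrite ler_wpM2l.
  have smallk i : (N + i).+1%:R * `|p (N + i).+1| <= K / N.+1%:R * `|p N|.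
    apply: le_trans (stepk _ (leq_addr _ _)) _.
    by rewrite ler_wpM2l.
  have nE : (J.+1 + N)%N = (N + J).+1 by rewrite addSn addnC.
  have := newton_ratio_gap m (J.+1 + N) sp; rewrite big_split_ord/= big_ord_recr/=.
  rewrite [X in _ = _ - (_ + X)]big1 ?addr0; last first.
    by move=> j _; rewrite -/(b _) b_zero ?mul0r// leq_addr.
  rewrite -/(b J) addKn => H.
  have top : b J * p N = - ((J.+1 + N).+1%:R * p (J.+1 + N).+1)
      + m * ((J.+1 + N)%:R * p (J.+1 + N)%N) - s 0%N * p (J.+1 + N)%N
      - \sum_(j < J) b j * p (J.+1 + N - j.+1)%N.
    move/eqP: H; rewrite -subr_eq0 => /eqP H; apply/eqP; rewrite -subr_eq0 -[X in _ == X]H.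
    by apply/eqP; ring.
  rewrite -(ler_pM2r (d0 N)) -normrM top.
  set q := K / N.+1%:R in KN1 KN0 smallk small *.
  have -> : q * M * `|p N| = (q * `|p N|) + m * (q * `|p N|) + s 0%N * (q * `|p N|)
      + (\sum_(j < J) `|b j|) * (q * `|p N|) by rewrite /M; ring.
  apply: le_trans (ler_normB _ _) _; apply: lerD.
    apply: le_trans (ler_normB _ _) _; apply: lerD.
      apply: le_trans (ler_normD _ _) _; apply: lerD.
        by rewrite normrN normrM normr_nat nE -addnS; exact: smallk.
      by rewrite !normrM normr_nat (gtr0_norm m0) ler_wpM2l ?(ltW m0)// nE; exact: smallk.
    by rewrite normrM (gtr0_norm (s0 _)) ler_wpM2l ?(ltW (s0 _))// nE; exact: small.
  apply: le_trans (ler_norm_sum _ _ _) _; rewrite mulr_suml; apply: ler_sum => j _.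
  rewrite normrM ler_wpM2l//.
  have -> : (J.+1 + N - j.+1 = (N + (J - j.+1)).+1)%N.
    by rewrite -addnS subnSK// addSn subSS addnC addnBA// ltnW.
  exact: small.
apply/eqP; rewrite -normr_le0; apply/ler_addgt0Pr => e e0; rewrite add0r.
pose N := `|Num.ceil (Num.max K (K * M / e))|%N.
have KN : Num.max K (K * M / e) <= N.+1%:R by rewrite ltW// lt_succ_ceil.
move: KN; rewrite ge_max => /andP[K1 K2].
apply: le_trans (bound _ K1) _.
by rewrite mulrAC ler_pdivrMr ?ltr0n// [leRHS]mulrC -ler_pdivrMr.
Qed.

End MomentGrowth.

(** * The first zero of the limit function *)
Section RealValues.
Context {R : realType}.
Local Notation C := (Cplx R).
Implicit Types (x r : R) (z : C) (a : nat -> R).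

Lemma series_toC (a : nat -> R) x N :
  series (fun n => toC (a n) * toC x ^+ n) N = toC (\sum_(n < N) a n * x ^+ n).
Proof.
rewrite /series/= big_mkord rmorph_sum; apply: eq_bigr => i _.
by rewrite rmorphM rmorphXn.
Qed.

Lemma cps_toC a x : asum a `|x| -> cps a (toC x) = toC (complex.Re (cps a (toC x))).
Proof.
move=> ax; apply: toC_Re; rewrite -cabs_toC in ax.
apply: (lim_unique (lim_Im (cps_cvg ax))).
under eq_fun do rewrite series_toC/=.
exact: lim_cst.
Qed.

Lemma cps_partial_le a x N : (forall n, 0 <= a n) -> 0 <= x -> asum a x ->
  \sum_(n < N) a n * x ^+ n <= complex.Re (cps a (toC x)).
Proof.
move=> a0 x0 ax; have cx : cabs (toC x) = x by rewrite cabs_toC ger0_norm.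
rewrite -cx in ax; have cl := lim_Re (cps_cvg ax).
rewrite -(cvg_lim (@Rhausdorff R) cl); apply: limr_ge; first exact: cvgP cl.
near=> n; rewrite series_toC/=.
have Nn : (N <= n)%N by near: n; exact: nbhs_infty_ge.
rewrite -(subnKC Nn) big_split_ord/= lerDl sumr_ge0// => i _.
by rewrite mulr_ge0// exprn_ge0.
Unshelve. all: by end_near. Qed.

Lemma cps_dominated a z : (forall n, 0 <= a n) -> asum a (cabs z) ->
  cabs (cps a z) <= complex.Re (cps a (toC (cabs z))).
Proof.
move=> a0 az; apply: cps_le => N.
under eq_bigr do rewrite ger0_norm//.
by apply: cps_partial_le => //; exact: cabs_ge0.
Qed.

End RealValues.

Section ExponentialForm.
Context {R : realType}.
Local Notation C := (Cplx R).
Implicit Types (x r e : R) (z w : C).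
Variables (s p : nat -> R) (m : R).
Hypotheses (s_gt0 : forall n, 0 < s n) (gr : growth_rate s m).
Hypotheses (sp : newton s p) (p0 : p 0%N = 1).
Hypothesis p_entire : forall r, 0 <= r -> asum p r.

Let m_gt0 : 0 < m. Proof. by case: gr. Qed.

Lemma sums_asum z : cabs z * m < 1 -> asum s (cabs z).
Proof. by move=> zm; apply: growth_asum gr _ zm => //; exact: cabs_ge0. Qed.

(** The logarithmic derivative is [- s], integrated here term by term. *)
Definition logc n : R := if n is k.+1 then - (s k / k.+1%:R) else 0.

Lemma dcoef_logc : dcoef logc = (fun n => - s n).
Proof. by apply/funext => n; rewrite /dcoef/= mulrN mulrCA divff ?mulr1// pnatr_eq0. Qed.

Lemma logc_asum r : 0 <= r -> asum s r -> asum logc r.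
Proof.
move=> r0 [M sM]; exists (r * M) => -[|N].
  by rewrite big_ord0 mulr_ge0//; have := sM 0%N; rewrite big_ord0.
rewrite big_ord_recl normr0 mul0r add0r.
apply: le_trans (ler_wpM2l r0 (sM N)); rewrite mulr_sumr.
apply: ler_sum => i _; rewrite lift0 /= normrN exprS mulrCA ler_wpM2l//.
rewrite ler_wpM2r ?exprn_ge0// normrM ler_piMr// ger0_norm ?invr_ge0//.
by rewrite invf_le1 ?ltr0n// ler1n.
Qed.

Lemma newton_deriv z : cabs z * m < 1 ->
  cps (dcoef p) z = - (cps s z * cps p z).
Proof.
move=> zm; have sz := sums_asum zm; have pz := p_entire (cabs_ge0 z).
rewrite cps_cauchy// -cps_opp; last exact: asum_cauchy (cabs_ge0 z) sz pz.
by congr cps; apply/funext => n; rewrite sp.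
Qed.

(** The intermediate radius [r] leaves room for the termwise derivative. *)
Lemma is_derive_log z : cabs z * m < 1 -> is_derive z 1 (cps logc) (- cps s z).
Proof.
move=> zm; pose r := (cabs z + m^-1) / 2.
have zr : cabs z < m^-1 by rewrite -[m^-1]mul1r ltr_pdivlMr.
have r0 : 0 <= r by rewrite divr_ge0// addr_ge0 ?cabs_ge0// invr_ge0 ltW.
have rm : r * m < 1 by rewrite -ltr_pdivlMr// mul1r /r; lra.
have := @cps_is_derive _ logc z r; rewrite dcoef_logc cps_opp; last exact: sums_asum.
apply; first by rewrite /r; lra.
by apply: logc_asum => //; exact: growth_asum gr _ rm.
Qed.

(** Newton's identities say that the quotient of the two sides has derivative 0 on
    the segment from 0 to [z]. *)
Lemma cps_exp z : cabs z * m < 1 -> cps p z = cexp (cps logc z).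
Proof.
move=> zm; pose f w := cps p w * cexp (- cps logc w).
suff : f z = f 0.
  have l0 : logc 0 = 0 by [].
  rewrite /f !cps0 p0 l0 rmorph0 oppr0 cexp0 rmorph1 mulr1 cexpN => H.
  by rewrite -[RHS]mul1r -H divfK// cexp_neq0.
apply: cst_on_segment => t /andP[t0 t1].
rewrite add0r subr0; set w := toC t * z.
have wm : cabs w * m < 1.
  apply: le_lt_trans zm; rewrite ler_pM2r// cabsM cabs_toC ger0_norm//.
  by rewrite ler_piMl// cabs_ge0.
have dl : is_derive w 1 (fun w => - cps logc w) (cps s w).
  have := is_derive_mul (is_derive_cst (- 1 : C) w 1) (is_derive_log wm).
  rewrite mulrNN mul1r mul0r addr0.
  by have -> : (fun w => - cps logc w) = (fun w => - 1 * cps logc w)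
    by apply/funext => v; rewrite mulN1r.
apply: (is_derive_eq (is_derive_mul (is_derive_entire w p_entire)
  (is_derive_comp (is_derive_cexp _) dl))).
by rewrite newton_deriv//; ring.
Qed.

Lemma cps_neq0 z : cabs z * m < 1 -> cps p z != 0.
Proof. by move=> zm; rewrite cps_exp// cexp_neq0. Qed.

Lemma cps_gt0 x : 0 <= x -> x * m < 1 -> exists2 y, 0 < y & cps p (toC x) = toC y.
Proof.
move=> x0 xm; have cx : cabs (toC x) = x by rewrite cabs_toC ger0_norm.
exists (expR (complex.Re (cps logc (toC x)))); first exact: expR_gt0.
rewrite cps_exp ?cx// cps_toC ?cexp_toC//.
rewrite ger0_norm//; apply: logc_asum => //.
exact: growth_asum gr _ xm.
Qed.

Lemma sums_large x N : 0 <= x -> x * m < 1 ->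
  \sum_(k < N) s k * x ^+ k.+1 <= x * complex.Re (cps s (toC x)).
Proof.
move=> x0 xm.
have -> : \sum_(k < N) s k * x ^+ k.+1 = x * \sum_(k < N) s k * x ^+ k.
  by rewrite mulr_sumr; apply: eq_bigr => k _; rewrite exprS mulrCA.
rewrite ler_wpM2l//; apply: cps_partial_le => //.
  by move=> n; exact: ltW.
exact: growth_asum gr _ xm.
Qed.

(** Near [m^-1] the logarithmic derivative is unbounded by [growth_large], while the
    derivative itself is bounded; hence the function is small there. *)
Lemma cps_root : cps p (toC m^-1) = 0.
Proof.
have mi0 : 0 < m^-1 by rewrite invr_gt0.
have [B pB] := dcoef_entire p_entire (ltW mi0).
have B0 : 0 <= B by have := pB 0%N; rewrite big_ord0.
apply/eqP; rewrite -cabs_eq0 eq_le cabs_ge0 andbT.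
apply/ler_addgt0Pr => e e0; rewrite add0r.
have e20 : 0 < e / 2 by rewrite divr_gt0.
have /continuous_cabs/(_ _ e20)[d d0 dP] := is_derive_continuous (is_derive_entire (toC m^-1) p_entire).
(* The first bound brings [x] within [d] of [m^-1], the second one makes the value
   at [x] at most [e / 2]. *)
pose A := Num.max (m^-1 / d) (m^-1 * B * 2 / (e / 2)).
pose N := (`|Num.ceil A|).+1%N.
have N0 : 0 < N%:R :> R by rewrite ltr0n.
have AN : A < N%:R by exact: lt_succ_ceil.
move: AN; rewrite gt_max => /andP[AN1 AN2].
have /= := growth_large gr (ltn0Sn `|Num.ceil A|); rewrite -/N.
set x := m^-1 * _ => -[x0 xm xN].
have cx : cabs (toC x) = x by rewrite cabs_toC gtr0_norm.
have xl : x <= m^-1 by rewrite -[leRHS]mul1r ler_pdivlMr// ltW.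
have close : cabs (toC x - toC m^-1) < d.
  rewrite -rmorphB cabs_toC /x mulrBr mulr1 addrAC subrr add0r normrN ger0_norm; last first.
    by rewrite mulr_ge0 ?(ltW mi0)// invr_ge0 mulr_ge0// ltW.
  rewrite invfM mulrA ltr_pdivrMr//; apply: le_lt_trans (_ : m^-1 / 2 <= m^-1) _.
    by rewrite ler_pdivrMr// ler_peMr ?ler1n// ltW.
  by rewrite mulrC -ltr_pdivrMr.
have small : cabs (cps p (toC x)) <= e / 2.
  have dB : cabs (cps (dcoef p) (toC x)) <= B.
    apply: cps_le => k; apply: le_trans (pB k); apply: ler_sum => i _.
    by rewrite ler_wpM2l// cx lerXn2r// nnegrE ltW.
  rewrite newton_deriv ?cx// cabsN cabsM in dB.
  have sl : N%:R / 2 <= x * cabs (cps s (toC x)).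
    apply: le_trans xN _; apply: le_trans (sums_large _ (ltW x0) xm) _.
    by rewrite ler_wpM2l ?(ltW x0)//; apply: le_trans (ler_norm _) (Re_le_cabs _).
  have : N%:R / 2 * cabs (cps p (toC x)) <= m^-1 * B.
    apply: le_trans (ler_wpM2r (cabs_ge0 _) sl) _.
    rewrite -mulrA; apply: ler_pM => //; first exact: ltW.
    by rewrite mulr_ge0 ?cabs_ge0.
  move=> H; rewrite -(ler_pM2l (_ : 0 < N%:R / 2)) ?divr_gt0//.
  apply: le_trans H _; move: AN2; rewrite ltr_pdivrMr// => /ltW AN2.
  by rewrite -mulrA [_ / 2]mulrC mulrA; lra.
have := dP _ close => /ltW cl.
have -> : cps p (toC m^-1) = cps p (toC x) - (cps p (toC x) - cps p (toC m^-1)).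
  by rewrite opprB addrC subrK.
by apply: le_trans (ler_cabsD _ _) _; rewrite cabsN (splitr e) lerD.
Qed.

End ExponentialForm.

(** * Entire series *)
Section EntireSeries.
Context {R : realType}.
Local Notation C := (Cplx R).
Implicit Types (x r c K : R) (z : C) (a : nat -> R).

(** Comparison with the exponential series at [K * r]. *)
Lemma entire_ratio a K r : 0 <= r -> 0 <= K ->
  (forall n, n.+1%:R * `|a n.+1| <= K * `|a n|) -> asum a r.
Proof.
move=> r0 K0 aK; exists (`|a 0%N| * expR (K * r)) => N.
have an n : `|a n| * n`!%:R <= `|a 0%N| * K ^+ n.
  elim: n => [|n ih]; first by rewrite fact0.
  rewrite factS natrM mulrA [_ * n.+1%:R]mulrC.
  apply: le_trans (ler_wpM2r (ler0n _ _) (aK n)) _.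
  by rewrite -mulrA exprS [leRHS]mulrCA ler_wpM2l.
apply: (@le_trans _ _ (\sum_(n < N) `|a 0%N| * exp_coeff (K * r) n)).
  apply: ler_sum => n _; rewrite exp_coeffE.
  have -> : `|a 0%N| * (n`!%:R^-1 * (K * r) ^+ n) = `|a 0%N| * K ^+ n / n`!%:R * r ^+ n.
    by rewrite exprMn; ring.
  by rewrite ler_wpM2r ?exprn_ge0// ler_pdivlMr ?ltr0n ?fact_gt0.
rewrite -mulr_sumr ler_wpM2l//.
have := @nondecreasing_cvgn_le _ (series (exp_coeff (K * r))).
rewrite /series/= => /(_ _ _ N); rewrite big_mkord; apply.
  apply: nondecreasing_series => n _ _; exact: exp_coeff_ge0 (mulr_ge0 K0 r0).
exact: is_cvg_series_exp_coeff.
Qed.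

Lemma cps_scale a c z : asum a (`|c| * cabs z) ->
  cps (fun n => a n * c ^+ n) z = cps a (toC c * z).
Proof.
move=> H; congr (limn (series _)); apply/funext => n.
by rewrite rmorphM rmorphXn exprMn mulrA.
Qed.

Lemma cps_even a z : asum a (cabs z) -> (forall n, a n.*2.+1 = 0) ->
  cps a z = cps (fun n => a n.*2) (z ^+ 2).
Proof.
move=> az a_odd; apply/esym/cps_eq.
have -> : series (fun n => toC (a n.*2) * (z ^+ 2) ^+ n) =
    (fun N => series (fun n => toC (a n) * z ^+ n) N.*2).
  apply/funext => N; rewrite /series/= !big_mkord.
  elim: N => [|N ih]; first by rewrite !big_ord0.
  rewrite doubleS !big_ord_recr/= -ih a_odd rmorph0 mul0r addr0.
  by rewrite -exprM mul2n.
have := cps_cvg az => /cvg_cabs H; apply/cvg_cabs => e e0.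
have [N _ HN] := H _ e0; exists N => // n /= Nn; apply: HN => /=.
by rewrite -addnn (leq_trans Nn)// leq_addr.
Qed.

End EntireSeries.

(** * Coefficients of the Wronskian of the Bessel functions *)
Section WronskianCoefficients.
Context {R : realType}.
Variable nu : R.
Hypothesis hnu : - (1 / 2) < nu.

(** Up to the factor [(z / 2) ^ nu / Gamma (nu + 1)], the coefficients of the
    modified Bessel function in the variable [u = (z / 2) ^ 2]. Those of the Bessel
    function are [jcoef]. *)
Definition bcoef n : R := (n`!%:R * pochhammer (nu + 1) n)^-1.

Lemma nu1_gt0 : 0 < nu + 1.
Proof. by move: hnu; lra. Qed.

Lemma bcoef_gt0 n : 0 < bcoef n.
Proof. by rewrite invr_gt0 mulr_gt0 ?ltr0n ?fact_gt0// pochhammer_gt0// nu1_gt0. Qed.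

(** The modified Bessel equation, coefficient by coefficient. *)
Lemma bcoefS n : n.+1%:R * (n.+1%:R + nu) * bcoef n.+1 = bcoef n.
Proof.
rewrite /bcoef factS natrM pochhammerS.
have p0 : pochhammer (nu + 1) n != 0 by rewrite gt_eqF// pochhammer_gt0// nu1_gt0.
have f0 : n`!%:R != 0 :> R by rewrite pnatr_eq0 -lt0n fact_gt0.
have s0 : nu + 1 + n%:R != 0 by rewrite gt_eqF// ltr_wpDr// nu1_gt0.
have n0 : n.+1%:R != 0 :> R by rewrite pnatr_eq0.
have e1 : n.+1%:R + nu = nu + 1 + n%:R by rewrite -natr1; ring.
rewrite e1; field.
by rewrite p0 s0 f0 addrC natr1 n0.
Qed.

(** Coefficients of a product of the series of [jcoef], index [k], and of [bcoef],
    index [l], after differential operators that multiply the terms by functions of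
    [k] and [l]. The sign comes from [jcoef]. *)
Definition alt (F : nat -> nat -> R) m : R := \sum_(k < m.+1) (-1) ^+ k * F k (m - k)%N.

Lemma alt_shiftr F G m : (forall k, F k 0%N = 0) -> (forall k l, F k l.+1 = G k l) ->
  alt F m.+1 = alt G m.
Proof.
move=> F0 FG; rewrite /alt big_ord_recr/= subnn F0 mulr0 addr0.
by apply: eq_bigr => k _; rewrite subSn ?FG// -ltnS.
Qed.

Lemma alt_shiftl F G m : (forall l, F 0%N l = 0) -> (forall k l, F k.+1 l = G k l) ->
  alt F m.+1 = - alt G m.
Proof.
move=> F0 FG; rewrite /alt big_ord_recl F0 mulr0 add0r -sumrN.
by apply: eq_bigr => k _; rewrite lift0 subSS FG exprS mulN1r mulNr.
Qed.

Lemma alt_lin F G c m : alt (fun k l => F k l + c * G k l) m = alt F m + c * alt G m.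
Proof. by rewrite /alt mulr_sumr -big_split; apply: eq_bigr => k _ /=; ring. Qed.

(** The product rule: the operator [u d/du] multiplies the coefficient of index [m]
    by [m = k + l]. *)
Lemma alt_diag (f : R -> R) F m : f m%:R * alt F m = alt (fun k l => f (k%:R + l%:R) * F k l) m.
Proof.
rewrite /alt mulr_sumr; apply: eq_bigr => k _.
have E : (nat_of_ord k)%:R + (m - k)%:R = m%:R :> R by rewrite -natrD subnKC// -ltnS.
by rewrite E mulrCA.
Qed.

(** With [D = u d/du], and [j], [i] for the series of [jcoef] and [bcoef], these are
    the coefficients of [j i], of [j (D i) - (D j) i] and of [(D j) (D i)]. *)
Definition prodP := alt (fun k l => bcoef k * bcoef l).
Definition prodW := alt (fun k l => (l%:R - k%:R) * (bcoef k * bcoef l)).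
Definition prodQ := alt (fun k l => k%:R * l%:R * (bcoef k * bcoef l)).

(* The Bessel equation [bcoefS] applies to the factor of index [l] or of index
   [k]; the other factor carries an arbitrary weight [f]. *)
Let bessel_r (f : nat -> R) k (l : nat) := f k * (l%:R * (l%:R + nu) * (bcoef k * bcoef l)).
Let bessel_l (f : nat -> R) (k : nat) l := f l * (k%:R * (k%:R + nu) * (bcoef k * bcoef l)).

Lemma alt_bessel_r f m : alt (bessel_r f) m.+1 = alt (fun k l => f k * (bcoef k * bcoef l)) m.
Proof.
apply: alt_shiftr => [k|k l]; first by rewrite /bessel_r !mul0r mulr0.
by rewrite /bessel_r -(bcoefS l); ring.
Qed.

Lemma alt_bessel_l f m : alt (bessel_l f) m.+1 = - alt (fun k l => f l * (bcoef k * bcoef l)) m.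
Proof.
apply: alt_shiftl => [l|k l]; first by rewrite /bessel_l !mul0r mulr0.
by rewrite /bessel_l -(bcoefS k); ring.
Qed.

Lemma alt_ext F G m : (forall k l, F k l = G k l) -> alt F m = alt G m.
Proof. by move=> FG; apply: eq_bigr => k _; rewrite FG. Qed.

(** Here and in the next two lemmas, differentiating a product produces [D^2 i] and
    [D^2 j], which the Bessel equations [D^2 i = u i - nu D i] and
    [D^2 j = - u j - nu D j] remove. *)
Lemma prodW_rec m : (m.+1%:R + nu) * prodW m.+1 = 2 * prodP m.
Proof.
rewrite (alt_diag (fun x => x + nu)).
rewrite (@alt_ext _ (fun k l => bessel_r (fun=> 1) k l + (- 1) * bessel_l (fun=> 1) k l)).
  rewrite alt_lin alt_bessel_r alt_bessel_l mulN1r opprK.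
  rewrite (@alt_ext _ (fun k l => bcoef k * bcoef l)); last by move=> k l; rewrite mul1r.
  by rewrite -/(prodP m) mulr_natl.
by move=> k l; rewrite /bessel_r /bessel_l; ring.
Qed.

Lemma prodP_rec m : m.+1%:R * (m.+1%:R + nu) * prodP m.+1 = 2 * prodQ m.+1.
Proof.
rewrite (alt_diag (fun x => x * (x + nu))).
rewrite (@alt_ext _ (fun k l => bessel_r (fun=> 1) k l + 1 * (bessel_l (fun=> 1) k l +
   2 * (k%:R * l%:R * (bcoef k * bcoef l))))).
  by rewrite !alt_lin alt_bessel_r alt_bessel_l mul1r addrA addrN add0r.
by move=> k l; rewrite /bessel_r /bessel_l; ring.
Qed.

Lemma prodQ_rec m : (m.+1%:R + 2 * nu) * prodQ m.+1 = - prodW m.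
Proof.
rewrite (alt_diag (fun x => x + 2 * nu)).
rewrite (@alt_ext _ (fun k l => bessel_r (fun k => k%:R) k l + 1 * bessel_l (fun l => l%:R) k l)).
  rewrite alt_lin alt_bessel_r alt_bessel_l mul1r.
  have -> : prodW m = alt (fun k l => l%:R * (bcoef k * bcoef l)) m +
      (- 1) * alt (fun k l => k%:R * (bcoef k * bcoef l)) m.
    by rewrite -alt_lin; apply: alt_ext => k l; ring.
  by ring.
by move=> k l; rewrite /bessel_r /bessel_l; ring.
Qed.

Lemma prodP0 : prodP 0 = 1.
Proof.
have b0 : bcoef 0 = 1 by rewrite /bcoef fact0 pochhammer0 mul1r invr1.
by rewrite /prodP /alt big_ord1/= b0 !mulr1.
Qed.

Lemma prodW0 : prodW 0 = 0.
Proof. by rewrite /prodW /alt big_ord1/= subrr mul0r mulr0. Qed.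

Lemma prod_step m : prodP m.+1 =
    - 2 * prodW m / (m.+1%:R * (m.+1%:R + nu) * (m.+1%:R + 2 * nu)) /\
  prodW m.+1 = 2 * prodP m / (m.+1%:R + nu).
Proof.
have m1 : 1 <= m.+1%:R :> R by rewrite ler1n.
have n1 : m.+1%:R + nu != 0 by rewrite gt_eqF//; move: hnu; lra.
have n2 : m.+1%:R + 2 * nu != 0 by rewrite gt_eqF//; move: hnu; lra.
have n3 : m.+1%:R != 0 :> R by rewrite pnatr_eq0.
split; last by rewrite -prodW_rec mulrAC mulfV// mul1r.
have Q : prodQ m.+1 = - prodW m / (m.+1%:R + 2 * nu).
  by rewrite -prodQ_rec mulrAC mulfV// mul1r.
have -> : prodP m.+1 = 2 * prodQ m.+1 / (m.+1%:R * (m.+1%:R + nu)).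
  by rewrite -prodP_rec mulrAC mulfV ?mul1r// mulf_neq0.
by rewrite Q !invfM; ring.
Qed.

(** Starting from [prodW 0 = 0], the steps of [prod_step] leave out every other
    coefficient. This is why the Wronskian is a series in [u ^ 2], that is, in
    [z ^ 4]. *)
Lemma prod_odd k : prodP k.*2.+1 = 0 /\ prodW k.*2 = 0.
Proof.
elim: k => [|k [ih1 ih2]].
  by have [-> _] := prod_step 0; rewrite prodW0 mulr0 mul0r.
rewrite doubleS; have [_ W] := prod_step k.*2.+1; rewrite ih1 mulr0 mul0r in W.
by split=> //; have [-> _] := prod_step k.*2.+2; rewrite W mulr0 mul0r.
Qed.

Lemma prod_even k : prodP k.*2 =
  (- 1) ^+ k / (k`!%:R * pochhammer (nu + 1) k * pochhammer (nu + 1) k.*2).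
Proof.
elim: k => [|k ih]; first by rewrite double0 prodP0 expr0 fact0 !pochhammer0 !mulr1 divr1.
rewrite doubleS; have [-> _] := prod_step k.*2.+1; have [_ ->] := prod_step k.*2.
rewrite ih factS natrM !pochhammerS exprS.
have f0 : k`!%:R != 0 :> R by rewrite pnatr_eq0 -lt0n fact_gt0.
have p1 j : pochhammer (nu + 1) j != 0 by rewrite gt_eqF// pochhammer_gt0// nu1_gt0.
have := p1 k; have := p1 k.*2; move: (pochhammer _ _) (pochhammer _ _) => A B A0 B0.
have k0 : 0 <= k%:R :> R by [].
have e2 : k.*2%:R = 2 * k%:R :> R by rewrite -mul2n natrM.
rewrite -!natr1 e2; field.
move: hnu => h; rewrite f0 A0 B0 /=.
by do !(apply/andP; split); rewrite gt_eqF//; lra.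
Qed.

Definition jcoef n : R := (- 1) ^+ n * bcoef n.

(** The Wronskian of the two series for the derivative in [u]. *)
Definition wcoef n : R := cauchy jcoef (dcoef bcoef) n - cauchy (dcoef jcoef) bcoef n.

Lemma wcoefE n : wcoef n = prodW n.+1.
Proof.
rewrite /prodW (@alt_ext _ (fun k l => l%:R * (bcoef k * bcoef l) +
   (- 1) * (k%:R * (bcoef k * bcoef l)))); last by move=> k l; ring.
rewrite alt_lin (@alt_shiftr _ (fun k l => bcoef k * dcoef bcoef l)); last 2 first.
- by move=> k; rewrite mul0r.
- by move=> k l; rewrite /dcoef; ring.
rewrite (@alt_shiftl _ (fun k l => dcoef bcoef k * bcoef l)); last 2 first.
- by move=> k; rewrite mul0r.
- by move=> k l; rewrite /dcoef; ring.
rewrite /wcoef /cauchy /alt mulN1r opprK -sumrN; congr (_ + _); apply: eq_bigr => k _.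
  by rewrite /jcoef -mulrA.
by rewrite /dcoef /jcoef exprS; ring.
Qed.

Lemma bcoef_asum r : 0 <= r -> asum bcoef r.
Proof.
move=> r0; apply: (@entire_ratio _ bcoef 2) => // n.
rewrite !gtr0_norm ?bcoef_gt0// -[bcoef n]bcoefS mulrA.
rewrite ler_wpM2r ?(ltW (bcoef_gt0 _))// mulrCA ler_peMr//.
by rewrite -natr1; have : 0 <= n%:R :> R by []; move: hnu; lra.
Qed.

Lemma jcoef_asum r : 0 <= r -> asum jcoef r.
Proof.
move=> r0; apply: asum_norm_le (bcoef_asum r0) => // n.
by rewrite normrM normrX normrN1 expr1n mul1r.
Qed.

(** As [(nu + 2)_(2n) = 4^n ((nu + 2) / 2)_n ((nu + 3) / 2)_n]
    ([pochhammer_double]), the coefficient is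
    [(-1)^n / (16^n n! (nu + 1)_n (nu + 2)_(2n))]. *)
Definition gxs := [:: nu + 1; (nu + 2) / 2; (nu + 3) / 2].
Definition gcoef : nat -> R := hyper_coef 64^-1 gxs [::].

Lemma gxs_gt0 : all (fun x => 0 < x) gxs.
Proof. by rewrite /=; move: hnu => h; apply/and4P; split=> //; lra. Qed.

Lemma pochhammer_double (x : R) n : pochhammer x n.*2 =
  4 ^+ n * (pochhammer (x / 2) n * pochhammer ((x + 1) / 2) n).
Proof.
elim: n => [|n ih]; first by rewrite !pochhammer0 expr0 !mulr1.
rewrite doubleS !pochhammerS ih exprS -[n.*2.+1%:R]natr1.
by rewrite -mul2n natrM; field.
Qed.

Lemma wcoef_even n : wcoef n.*2 = 2 / (nu + 1) * (gcoef n * 16 ^+ n).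
Proof.
rewrite wcoefE; have [_ ->] := prod_step n.*2; rewrite prod_even.
rewrite /gcoef /hyper_coef /gxs !big_cons !big_nil.
have e3 : (nu + 3) / 2 = (nu + 2 + 1) / 2 by ring.
have P2 := pochhammer_double (nu + 2) n; rewrite -e3 in P2.
have E : pochhammer (nu + 1) n.*2 * (nu + 1 + n.*2%:R) = (nu + 1) * pochhammer (nu + 2) n.*2.
  rewrite -pochhammerS -add1n pochhammerD pochhammerS pochhammer0 mul1r addr0.
  by rewrite -addrA.
have p1 j : pochhammer (nu + 1) j != 0 by rewrite gt_eqF// pochhammer_gt0// nu1_gt0.
have x2 : 0 < (nu + 2) / 2 by move: hnu; lra.
have x3 : 0 < (nu + 3) / 2 by move: hnu; lra.
have p2 : pochhammer ((nu + 2) / 2) n != 0 by rewrite gt_eqF// pochhammer_gt0.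
have p3 : pochhammer ((nu + 3) / 2) n != 0 by rewrite gt_eqF// pochhammer_gt0.
have k0 : 0 <= n.*2%:R :> R by [].
have n1 : nu + 1 != 0 by rewrite gt_eqF ?nu1_gt0.
have nn : nu + 1 + n.*2%:R != 0 by rewrite gt_eqF//; move: hnu; lra.
have f0 : n`!%:R != 0 :> R by rewrite pnatr_eq0 -lt0n fact_gt0.
have -> : pochhammer (nu + 1) n.*2 = (nu + 1) * (4 ^+ n *
   (pochhammer ((nu + 2) / 2) n * pochhammer ((nu + 3) / 2) n)) / (nu + 1 + n.*2%:R).
  by rewrite -P2 -E mulfK.
have e64 : (- 64^-1) ^+ n * 16 ^+ n = (- 1) ^+ n / 4 ^+ n :> R.
  by rewrite -exprMn -exprVn -exprMn; congr (_ ^+ _); field.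
have f4 : 4 ^+ n != 0 :> R by rewrite expf_neq0.
have -> : n.*2.+1%:R + nu = nu + 1 + n.*2%:R by rewrite -natr1; ring.
transitivity (2 / (nu + 1) * ((- 64^-1) ^+ n * 16 ^+ n / n`!%:R *
  ((pochhammer (nu + 1) n)^-1 *
   ((pochhammer ((nu + 2) / 2) n)^-1 * (pochhammer ((nu + 3) / 2) n)^-1)))); last by ring.
rewrite e64; move: (pochhammer _ _) (pochhammer _ _) (pochhammer _ _) (4 ^+ n) p2 p3 (p1 n) f4.
by move=> A B D E4 A0 B0 D0 E0; field; rewrite ?A0 ?B0 ?D0 ?E0 ?n1 ?nn ?f0.
Qed.

Lemma wcoef_odd n : wcoef n.*2.+1 = 0.
Proof. by rewrite wcoefE -doubleS; have [] := prod_odd n.+1. Qed.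

Lemma gcoefS n : gcoef n.+1 = - gcoef n / (64 * n.+1%:R * (nu + 1 + n%:R) *
  ((nu + 2) / 2 + n%:R) * ((nu + 3) / 2 + n%:R)).
Proof.
rewrite /gcoef /hyper_coef /gxs !big_cons !big_nil !pochhammerS !invfM factS natrM.
by rewrite exprS invfM; ring.
Qed.

Lemma gcoef_alt n : 0 < (- 1) ^+ n * gcoef n.
Proof.
rewrite /gcoef /hyper_coef big_nil mulr1 !mulrA -exprMn mulN1r opprK.
rewrite mulr_gt0 ?divr_gt0 ?exprn_gt0 ?invr_gt0 ?ltr0n ?fact_gt0//.
rewrite big_seq prodr_gt0// => x xin; rewrite invr_gt0 pochhammer_gt0//.
exact: (allP gxs_gt0).
Qed.

Lemma gcoef_decay n : n.+1%:R ^+ 2 * `|gcoef n.+1| <= `|gcoef n|.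
Proof.
have k0 : 0 <= n%:R :> R by [].
move: hnu => h; rewrite gcoefS normrM normrN normfV.
have n1 : n.+1%:R = n%:R + 1 :> R by rewrite natr1.
have A0 : n.+1%:R <= (nu + 3) / 2 + n%:R by rewrite n1; lra.
have A1 : 3 / 4 <= (nu + 2) / 2 + n%:R by lra.
have A2 : 1 / 2 <= nu + 1 + n%:R by lra.
have n0 : 0 < n.+1%:R :> R by rewrite ltr0n.
rewrite [X in _ / X]ger0_norm; last first.
  by rewrite !mulr_ge0//; lra.
rewrite mulrA ler_pdivrMr; last by rewrite !mulr_gt0//; lra.
rewrite mulrC ler_wpM2l//.
have B1 : n.+1%:R * n.+1%:R <= n.+1%:R * ((nu + 3) / 2 + n%:R).
  by rewrite ler_wpM2l ?(ltW n0).
have B2 : 3 / 8 <= (nu + 1 + n%:R) * ((nu + 2) / 2 + n%:R).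
  have H : 1 / 2 * (3 / 4) <= (nu + 1 + n%:R) * ((nu + 2) / 2 + n%:R).
    by apply: ler_pM => //; lra.
  by apply: le_trans H; lra.
have -> : 64 * n.+1%:R * (nu + 1 + n%:R) * ((nu + 2) / 2 + n%:R) *
    ((nu + 3) / 2 + n%:R) = 64 * ((nu + 1 + n%:R) * ((nu + 2) / 2 + n%:R)) *
    (n.+1%:R * ((nu + 3) / 2 + n%:R)) by ring.
rewrite expr2; apply: le_trans B1 _.
rewrite ler_peMl; first by [].
  by rewrite mulr_ge0 ?(ltW n0)//; lra.
by lra.
Qed.

Lemma gcoef_entire r : 0 <= r -> asum gcoef r.
Proof.
move=> r0; apply: (@entire_ratio _ gcoef 1) => // n.
rewrite mul1r; apply: le_trans (gcoef_decay n); rewrite expr2 -mulrA.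
by rewrite ler_peMl ?mulr_ge0// ler1n.
Qed.

End WronskianCoefficients.

(** * The Wronskian on the slit plane *)
Section BesselWronskian.
Context {R : realType}.
Local Notation C := (Cplx R).
Implicit Types (x c r : R) (z w : C) (a : nat -> R).

Lemma two_toC : 2 = toC (2 : R) :> C.
Proof. by rewrite rmorph_nat. Qed.

Lemma half_toC z : z / 2 = toC 2^-1 * z.
Proof. by rewrite fmorphV rmorph_nat mulrC. Qed.

Lemma slit_scale c z : 0 < c -> slit_plane z -> slit_plane (toC c * z).
Proof.
move=> c0 [zi|zr]; [left|right]; rewrite ?Im_toCM ?Re_toCM.
  by rewrite mulf_neq0// gt_eqF.
by rewrite mulr_gt0.
Qed.

Lemma clog_scale c z : 0 < c -> z != 0 -> clog (toC c * z) = toC (ln c) + clog z.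
Proof.
move=> c0 z0; have z1 : 0 < cabs z by rewrite cabs_gt0.
have cE : cabs (toC c * z) = c * cabs z by rewrite cabsM cabs_toC gtr0_norm.
have aE : carg (toC c * z) = carg z.
  rewrite /carg -!/(cabs _) cE Re_toCM Im_toCM pmulr_rge0// -mulf_div divff ?mul1r//.
  by rewrite gt_eqF.
rewrite /clog aE -!/(cabs _) cE; apply: cplx_eq; rewrite ?ReD ?ImD /= ?add0r//.
by rewrite lnM ?posrE.
Qed.

Lemma cpow_scale c z r : 0 < c -> z != 0 ->
  cpow (toC c * z) r = toC (c `^ r) * cpow z r.
Proof.
move=> c0 z0; rewrite /cpow clog_scale// mulrDr cexpD -rmorphM cexp_toC.
by rewrite /powR gt_eqF.
Qed.

Lemma cpow_neq0 z r : cpow z r != 0.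
Proof. exact: cexp_neq0. Qed.

Lemma cpowD z r1 r2 : cpow z (r1 + r2) = cpow z r1 * cpow z r2.
Proof. by rewrite /cpow rmorphD mulrDl cexpD. Qed.

Lemma cpow1 z : z != 0 -> cpow z 1 = z.
Proof. by move=> z0; rewrite /cpow rmorph1 mul1r clogK. Qed.

Lemma cpow_nat z n : z != 0 -> cpow z n%:R = z ^+ n.
Proof. by move=> z0; rewrite /cpow rmorph_nat cexpMn clogK. Qed.

(** The prefactor is common to both Bessel functions, so that the terms in which it
    is differentiated cancel in their Wronskian. *)
Definition bessel_form nu a z : C :=
  toC (Gamma (nu + 1))^-1 * cpow (z / 2) nu * cps a ((z / 2) ^+ 2).

Lemma bessel_series nu a (f : nat -> R) z : z != 0 ->
  (forall r, 0 <= r -> asum a r) -> (forall n, f n = (Gamma (nu + 1))^-1 * a n) ->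
  limn (series (fun n : nat => toC (f n) * cpow (z / 2) (2 * n%:R + nu))) =
  bessel_form nu a z.
Proof.
move=> z0 a_ent fE; apply: cvg_lim; first exact: norm_hausdorff.
have z20 : z / 2 != 0 by rewrite mulf_neq0// invr_eq0 two_toC fmorph_eq0 pnatr_eq0.
have -> : series (fun n => toC (f n) * cpow (z / 2) (2 * n%:R + nu)) =
   (fun N => toC (Gamma (nu + 1))^-1 * cpow (z / 2) nu *
      series (fun n => toC (a n) * ((z / 2) ^+ 2) ^+ n) N).
  apply/funext => N; rewrite /series/= mulr_sumr; apply: eq_bigr => n _.
  by rewrite fE rmorphM cpowD -natrM cpow_nat// -exprM; ring.
apply: lim_mul (@lim_cst _ _) _.
exact: cps_cvg (a_ent _ (cabs_ge0 _)).
Qed.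

Lemma is_derive_half z : is_derive z 1 (fun w : C => w / 2) (1 / 2).
Proof.
have := is_derive_mul (is_derive_id z 1) (is_derive_cst (2^-1 : C) z 1).
by rewrite mulr0 add0r.
Qed.

Lemma is_derive_bessel_form nu a z : slit_plane z ->
  (forall r, 0 <= r -> asum a r) ->
  is_derive z 1 (bessel_form nu a) (toC (Gamma (nu + 1))^-1 * cpow (z / 2) nu *
    (cps (dcoef a) ((z / 2) ^+ 2) * (z / 2) + toC nu / z * cps a ((z / 2) ^+ 2))).
Proof.
move=> sz a_ent; have z0 := slit_neq0 sz.
have n2 : (2 : C) != 0 by rewrite two_toC fmorph_eq0 pnatr_eq0.
have s2 : slit_plane (z / 2) by rewrite half_toC; apply: slit_scale.
have d1 := is_derive_comp (f := fun w => cpow w nu) (g := fun w : C => w / 2)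
  (is_derive_cpow nu s2) (is_derive_half z).
have d2 : is_derive z 1 (fun w : C => (w / 2) ^+ 2) (z / 2).
  by apply: (is_derive_eq (is_derive_mul (is_derive_half z) (is_derive_half z))); field.
have d3 := is_derive_entire ((z / 2) ^+ 2) a_ent.
have d4 := is_derive_comp (g := fun w : C => (w / 2) ^+ 2) d3 d2.
have d5 := is_derive_mul (is_derive_cst (toC (Gamma (nu + 1))^-1) z 1) d1.
apply: (is_derive_eq (is_derive_mul d5 d4)).
rewrite /=; move: (toC (Gamma (nu + 1))^-1) => k; field.
by [].
Qed.

Variable nu : R.
Hypothesis hnu : - (1 / 2) < nu.

Let nu1 := nu1_gt0 hnu.

Lemma Gamma_shift n : Gamma (nu + n%:R + 1) = pochhammer (nu + 1) n * Gamma (nu + 1).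
Proof. by rewrite addrAC Gamma_pochhammer. Qed.

Lemma besselJE z : z != 0 -> besselJ nu z = bessel_form nu (jcoef nu) z.
Proof.
move=> z0; apply: bessel_series => // [r r0|n]; first exact: jcoef_asum.
by rewrite Gamma_shift /jcoef /bcoef mulrA invfM; ring.
Qed.

Lemma besselIE z : z != 0 -> besselI nu z = bessel_form nu (bcoef nu) z.
Proof.
move=> z0; apply: bessel_series => // [r r0|n]; first exact: bcoef_asum.
by rewrite Gamma_shift /bcoef mulrA invfM; ring.
Qed.

(** The Bessel functions have the form [bessel_form] off the origin only; this
    suffices for derivatives, as the slit plane is open. *)
Lemma is_derive_slit (f g : C -> C) z (l : C) : slit_plane z ->
  (forall w, w != 0 -> f w = g w) -> is_derive z 1 g l -> is_derive z 1 f l.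
Proof.
move=> sz fg; apply: near_eq_is_derive; have := slit_open sz.
by apply: filterS => w /slit_neq0 w0; rewrite fg.
Qed.

(** The Wronskian of the power series is [2 / (nu + 1)] times the series of [gcoef]
    in [16 u ^ 2 = z ^ 4] ([wcoef_even]). The Gamma factors cancel since
    [Gamma (nu + 2) = (nu + 1) Gamma (nu + 1)], and [(z / 2) ^ (2 nu)] accounts for
    the power of 2. *)
Lemma Phi_slit z : slit_plane z ->
  toC (2 `^ (2 * nu) * Gamma (nu + 1) * Gamma (nu + 2)) * Phi nu z =
  cpow z (2 * nu + 1) * cps (gcoef nu) (z ^+ 4).
Proof.
move=> sz; have z0 := slit_neq0 sz.
have n2 : (2 : C) != 0 by rewrite two_toC fmorph_eq0 pnatr_eq0.
have ja r := @jcoef_asum _ _ hnu r; have ba r := @bcoef_asum _ _ hnu r.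
have dJ := is_derive_slit sz besselJE (is_derive_bessel_form nu sz ja).
have dI := is_derive_slit sz besselIE (is_derive_bessel_form nu sz ba).
rewrite /Phi (derive1_val dJ) (derive1_val dI) besselJE// besselIE// /bessel_form.
set u := (z / 2) ^+ 2; set k := toC _^-1; set F := cpow (z / 2) nu.
have u0 := cabs_ge0 u.
have dja := dcoef_entire ja u0; have dba := dcoef_entire ba u0.
have wa : asum (wcoef nu) (cabs u).
  have [M1 H1] := asum_cauchy u0 (ja _ u0) dba.
  have [M2 H2] := asum_cauchy u0 dja (ba _ u0).
  exists (M1 + M2) => N; apply: le_trans (lerD (H1 N) (H2 N)).
  rewrite -big_split/=; apply: ler_sum => n _.
  by rewrite -mulrDl ler_wpM2r ?exprn_ge0// ler_normB.
have wE : cps (jcoef nu) u * cps (dcoef (bcoef nu)) u -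
    cps (dcoef (jcoef nu)) u * cps (bcoef nu) u = cps (wcoef nu) u.
  rewrite !cps_cauchy//; try exact: ja; try exact: ba.
  have := @cps_lin _ (cauchy (jcoef nu) (dcoef (bcoef nu)))
     (cauchy (dcoef (jcoef nu)) (bcoef nu)) (- 1) u.
  rewrite rmorphN rmorph1 mulN1r => <-; last 2 first.
  - exact: asum_cauchy (ja _ u0) dba.
  - exact: asum_cauchy dja (ba _ u0).
  by congr cps; apply/funext => n; rewrite mulN1r.
have gE : cps (wcoef nu) u = toC (2 / (nu + 1)) * cps (gcoef nu) (z ^+ 4).
  rewrite (cps_even wa (wcoef_odd hnu)).
  have -> : z ^+ 4 = toC 16 * u ^+ 2.
    by rewrite /u rmorph_nat; field.
  have z4 : asum (gcoef nu) (`|16| * cabs (u ^+ 2)).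
    by apply: gcoef_entire => //; rewrite mulr_ge0 ?cabs_ge0.
  rewrite -(cps_scale z4) -cps_mull; last first.
    have [M HM] := z4; exists M => N; apply: le_trans _ (HM N).
    apply: ler_sum => n _; set c := cabs _; set g := gcoef nu n.
    by rewrite normrM (normrX n (16 : R)) [in leRHS]exprMn mulrA.
  by congr cps; apply/funext => n; exact: wcoef_even.
have G2 : Gamma (nu + 2) = (nu + 1) * Gamma (nu + 1).
  have -> : nu + 2 = nu + 1 + 1 by ring.
  exact: GammaS nu1.
have G0 : Gamma (nu + 1) != 0 by rewrite gt_eqF// Gamma_gt0.
have pow2 : 2 `^ (2 * nu) * (2^-1 `^ nu * 2^-1 `^ nu) = 1 :> R.
  rewrite mulr_natl mulr2n powRD; last by apply/implyP => _; rewrite gt_eqF.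
  by rewrite mulrACA -powRM ?invr_ge0// divff ?pnatr_eq0// powR1 mulr1.
have P : cpow z (2 * nu + 1) = toC (2 `^ (2 * nu)) * (F * F) * z.
  rewrite cpowD cpow1//; congr (_ * z).
  have -> : F = toC (2^-1 `^ nu) * cpow z nu by rewrite /F half_toC cpow_scale.
  transitivity (toC (2 `^ (2 * nu) * (2^-1 `^ nu * 2^-1 `^ nu)) * (cpow z nu * cpow z nu)).
    by rewrite pow2 rmorph1 mul1r -cpowD mulr_natl mulr2n.
  by rewrite !rmorphM; ring.
have -> : k * F * cps (jcoef nu) u *
   (k * F * (cps (dcoef (bcoef nu)) u * (z / 2) + toC nu / z * cps (bcoef nu) u)) -
   k * F * (cps (dcoef (jcoef nu)) u * (z / 2) + toC nu / z * cps (jcoef nu) u) *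
   (k * F * cps (bcoef nu) u) = k * k * (F * F) * (z / 2) *
   (cps (jcoef nu) u * cps (dcoef (bcoef nu)) u -
    cps (dcoef (jcoef nu)) u * cps (bcoef nu) u) by ring.
rewrite wE gE P half_toC G2 /k.
have E : 2 `^ (2 * nu) * Gamma (nu + 1) * ((nu + 1) * Gamma (nu + 1)) *
    ((Gamma (nu + 1))^-1 * (Gamma (nu + 1))^-1 * (2^-1 * (2 / (nu + 1)))) = 2 `^ (2 * nu) :> R.
  by field; rewrite G0 gt_eqF.
rewrite -[in RHS]E !rmorphM; ring.
Qed.

End BesselWronskian.

(** * The derivative of the Wronskian and its first power sums *)
Section DerivativeCoefficients.
Context {R : realType}.
Variable nu : R.
Hypothesis hnu : - (1 / 2) < nu.

(** With [w = z ^ 4] and [G] the series of [gcoef], taking logarithmic derivatives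
    gives [z f' / f = 1 + beta^-1 w G' / G]. *)
Definition beta : R := (2 * nu + 1) / 4.

Lemma beta_gt0 : 0 < beta.
Proof. by move: hnu; rewrite /beta; lra. Qed.

(** These are the coefficients of [G + beta^-1 w G'] ([hcoefE]), in the form that
    [hyper_moment_like] expects. *)
Definition hcoef : nat -> R := hyper_coef 64^-1 (gxs nu) [:: beta].

Lemma hcoefE n : hcoef n = gcoef nu n * (1 + n%:R / beta).
Proof. by rewrite /hcoef /gcoef /hyper_coef big_cons !big_nil !mulr1. Qed.

Lemma hcoef_alt n : 0 < (- 1) ^+ n * hcoef n.
Proof.
by rewrite hcoefE mulrA mulr_gt0 ?gcoef_alt// ltr_pwDl// divr_ge0// ltW// beta_gt0.
Qed.

Lemma gcoef0 : gcoef nu 0 = 1.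
Proof.
rewrite /gcoef /hyper_coef expr0 fact0 divr1 mul1r big_nil mulr1 big1// => x _.
by rewrite pochhammer0 invr1.
Qed.

Lemma hcoef0 : hcoef 0 = 1.
Proof. by rewrite hcoefE gcoef0 mul0r addr0 mulr1. Qed.

Lemma hcoef_decay n : n.+1%:R ^+ 2 * `|hcoef n.+1| <= (1 + beta^-1) * `|hcoef n|.
Proof.
have b0 := beta_gt0; have k0 : 0 <= n%:R :> R by [].
have i0 : 0 < beta^-1 by rewrite invr_gt0.
have pos k : 0 <= 1 + k%:R / beta by rewrite addr_ge0// mulr_ge0// ltW.
rewrite !hcoefE (normrM (gcoef nu n.+1)) (normrM (gcoef nu n)) mulrA.
rewrite (ger0_norm (pos _)) (ger0_norm (pos _)).
rewrite [leRHS]mulrCA; apply: ler_pM => //.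
  exact: (gcoef_decay hnu).
have -> : (1 + beta^-1) * (1 + n%:R / beta) =
    1 + n.+1%:R / beta + beta^-1 * (n%:R / beta) by rewrite -natr1; ring.
by rewrite lerDl !mulr_ge0// ltW.
Qed.

Lemma hcoef_entire r : 0 <= r -> asum hcoef r.
Proof.
move=> r0; apply: (@entire_ratio _ hcoef (1 + beta^-1)) => // [|n].
  by rewrite addr_ge0// invr_ge0 ltW// beta_gt0.
apply: le_trans (hcoef_decay n); rewrite expr2 -mulrA.
by rewrite ler_peMl ?mulr_ge0// ler1n.
Qed.

Lemma moment_gt0 (s : nat -> R) : moment_like s -> 0 < s 0%N -> 0 < s 1%N ->
  forall n, 0 < s n.
Proof.
move=> [_ lc _] s0 s1; suff H n : 0 < s n /\ 0 < s n.+1 by move=> n; have [] := H n.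
elim: n => // n [sn sn1]; split=> //.
by rewrite -(pmulr_rgt0 _ sn); apply: lt_le_trans (lc n); rewrite exprn_gt0.
Qed.

Lemma newton0 (s p : nat -> R) : p 0%N = 1 -> newton s p -> s 0%N = - p 1%N.
Proof. by move=> p0 sp; rewrite (newton_first 0 p0 sp) big_ord0 subr0 /dcoef mul1r. Qed.

Lemma newton1 (s p : nat -> R) : p 0%N = 1 -> newton s p ->
  s 1%N = - (2 * p 2%N) - s 0%N * p 1%N.
Proof. by move=> p0 sp; rewrite (newton_first 1 p0 sp) big_ord1 /dcoef. Qed.

Lemma newton2 (s p : nat -> R) : p 0%N = 1 -> newton s p ->
  s 2%N = - (3 * p 3%N) - (s 0%N * p 2%N + s 1%N * p 1%N).
Proof.
by move=> p0 sp; rewrite (newton_first 2 p0 sp) !big_ord_recr big_ord0 /= add0r /dcoef.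
Qed.

Lemma newton3 (s p : nat -> R) : p 0%N = 1 -> newton s p ->
  s 3%N = - (4 * p 4%N) - (s 0%N * p 3%N + s 1%N * p 2%N + s 2%N * p 1%N).
Proof.
by move=> p0 sp; rewrite (newton_first 3 p0 sp) !big_ord_recr big_ord0 /= add0r /dcoef.
Qed.

Lemma gcoef_step n : gcoef nu n.+1 =
  - gcoef nu n / (16 * n.+1%:R * (nu + 1 + n%:R) * (nu + 2 + 2 * n%:R) * (nu + 3 + 2 * n%:R)).
Proof.
rewrite gcoefS; congr (_ / _); by field.
Qed.

Let cubic : R := 20 * nu ^+ 3 + 184 * nu ^+ 2 + 529 * nu + 473.

Lemma hvalues :
  [/\ hcoef 1 = - (2 * nu + 5) / ((2 * nu + 1) * 16 * ((nu + 1) * (nu + 2) * (nu + 3))),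
      hcoef 2 = (2 * nu + 9) / ((2 * nu + 1) * (16 * 32) * ((nu + 1) * (nu + 2) * (nu + 3)) *
         ((nu + 2) * (nu + 4) * (nu + 5))),
      hcoef 3 = - (2 * nu + 13) / ((2 * nu + 1) * (16 * 32 * 48) * ((nu + 1) * (nu + 2) * (nu + 3)) *
         ((nu + 2) * (nu + 4) * (nu + 5)) * ((nu + 3) * (nu + 6) * (nu + 7))) &
      hcoef 4 = (2 * nu + 17) / ((2 * nu + 1) * (16 * 32 * 48 * 64) * ((nu + 1) * (nu + 2) * (nu + 3)) *
         ((nu + 2) * (nu + 4) * (nu + 5)) * ((nu + 3) * (nu + 6) * (nu + 7)) *
         ((nu + 4) * (nu + 8) * (nu + 9)))].
Proof.
have bn k : 1 + k / beta = (2 * nu + 1 + 4 * k) / (2 * nu + 1).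
  by rewrite /beta; field; rewrite gt_eqF//; move: hnu; lra.
have pos k : 1 <= k -> k + nu != 0 by move=> k1; rewrite gt_eqF//; move: hnu; lra.
have n0 : 2 * nu + 1 != 0 by rewrite gt_eqF//; move: hnu; lra.
have [n1 n2 n3 n4 n5] : [/\ nu + 1 != 0, nu + 2 != 0, nu + 3 != 0, nu + 4 != 0 & nu + 5 != 0].
  by split; rewrite addrC pos//; lra.
have [n6 n7 n8 n9] : [/\ nu + 6 != 0, nu + 7 != 0, nu + 8 != 0 & nu + 9 != 0].
  by split; rewrite addrC pos//; lra.
have g1 : gcoef nu 1 = - 1 / (16 * ((nu + 1) * (nu + 2) * (nu + 3))).
  rewrite gcoef_step gcoef0; congr (_ / _); ring.
have g2 : gcoef nu 2 = 1 / ((16 * 32) * ((nu + 1) * (nu + 2) * (nu + 3)) *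
    ((nu + 2) * (nu + 4) * (nu + 5))).
  by rewrite gcoef_step g1; field; rewrite n1 n2 n3 n4 n5.
have g3 : gcoef nu 3 = - 1 / ((16 * 32 * 48) * ((nu + 1) * (nu + 2) * (nu + 3)) *
    ((nu + 2) * (nu + 4) * (nu + 5)) * ((nu + 3) * (nu + 6) * (nu + 7))).
  by rewrite gcoef_step g2; field; rewrite n1 n2 n3 n4 n5 n6 n7.
have g4 : gcoef nu 4 = 1 / ((16 * 32 * 48 * 64) * ((nu + 1) * (nu + 2) * (nu + 3)) *
    ((nu + 2) * (nu + 4) * (nu + 5)) * ((nu + 3) * (nu + 6) * (nu + 7)) *
    ((nu + 4) * (nu + 8) * (nu + 9))).
  by rewrite gcoef_step g3; field; rewrite n1 n2 n3 n4 n5 n6 n7 n8 n9.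
rewrite !hcoefE !bn g1 g2 g3 g4; split; field;
  by rewrite ?n0 ?n1 ?n2 ?n3 ?n4 ?n5 ?n6 ?n7 ?n8 ?n9.
Qed.

Lemma pochhammer3 : pochhammer (nu + 1) 3 = (nu + 1) * (nu + 2) * (nu + 3).
Proof. by rewrite !pochhammerS pochhammer0; ring. Qed.

Lemma pochhammer5 : pochhammer (nu + 1) 5 =
  (nu + 1) * (nu + 2) * (nu + 3) * (nu + 4) * (nu + 5).
Proof. by rewrite !pochhammerS pochhammer0; ring. Qed.

Lemma pochhammer7 : pochhammer (nu + 1) 7 =
  (nu + 1) * (nu + 2) * (nu + 3) * (nu + 4) * (nu + 5) * (nu + 6) * (nu + 7).
Proof. by rewrite !pochhammerS pochhammer0; ring. Qed.

(** The first four Rayleigh sums of the zeros; the polynomials [nu_1] and [nu_2]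
    arise as numerators. *)
Lemma moment_values (s : nat -> R) : newton s hcoef ->
  [/\ s 0%N = (2 * nu + 5) / (16 * (2 * nu + 1) * pochhammer (nu + 1) 3),
      s 1%N = cubic / (2 ^+ 8 * (2 * nu + 1) ^+ 2 * pochhammer (nu + 1) 3 * pochhammer (nu + 1) 5),
      s 2%N = nu_1 nu / (2 ^+ 11 * (2 * nu + 1) ^+ 3 * pochhammer (nu + 1) 3 ^+ 2 *
         pochhammer (nu + 1) 7) &
      s 3%N = nu_2 nu / (2 ^+ 16 * (2 * nu + 1) ^+ 4 * pochhammer (nu + 1) 3 ^+ 2 *
         pochhammer (nu + 1) 5 * pochhammer (nu + 1) 7 * (nu + 8) * (nu + 9))].
Proof.
move=> sp; rewrite pochhammer3 pochhammer5 pochhammer7.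
have [h1 h2 h3 h4] := hvalues.
have pos k : 1 <= k -> k + nu != 0 by move=> k1; rewrite gt_eqF//; move: hnu; lra.
have n0 : 2 * nu + 1 != 0 by rewrite gt_eqF//; move: hnu; lra.
have [n1 n2 n3 n4 n5] : [/\ nu + 1 != 0, nu + 2 != 0, nu + 3 != 0, nu + 4 != 0 & nu + 5 != 0].
  by split; rewrite addrC pos//; lra.
have [n6 n7 n8 n9] : [/\ nu + 6 != 0, nu + 7 != 0, nu + 8 != 0 & nu + 9 != 0].
  by split; rewrite addrC pos//; lra.
have e0 := newton0 hcoef0 sp; rewrite h1 in e0.
have E0 : s 0%N = (2 * nu + 5) / (16 * (2 * nu + 1) * ((nu + 1) * (nu + 2) * (nu + 3))).
  by rewrite e0; field; rewrite n0 n1 n2 n3.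
have e1 := newton1 hcoef0 sp; rewrite E0 h1 h2 in e1.
have E1 : s 1%N = cubic / (2 ^+ 8 * (2 * nu + 1) ^+ 2 * ((nu + 1) * (nu + 2) * (nu + 3)) *
   ((nu + 1) * (nu + 2) * (nu + 3) * (nu + 4) * (nu + 5))).
  by rewrite e1 /cubic; field; rewrite n0 n1 n2 n3 n4 n5.
have e2 := newton2 hcoef0 sp; rewrite E0 E1 h1 h2 h3 in e2.
have E2 : s 2%N = nu_1 nu / (2 ^+ 11 * (2 * nu + 1) ^+ 3 *
    ((nu + 1) * (nu + 2) * (nu + 3)) ^+ 2 *
    ((nu + 1) * (nu + 2) * (nu + 3) * (nu + 4) * (nu + 5) * (nu + 6) * (nu + 7))).
  by rewrite e2 /cubic /nu_1 /thousands /=; field; rewrite n0 n1 n2 n3 n4 n5 n6 n7.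
have e3 := newton3 hcoef0 sp; rewrite E0 E1 E2 h1 h2 h3 h4 in e3.
split=> //; rewrite e3 /cubic /nu_1 /nu_2 /thousands /=; field.
by rewrite n0 n1 n2 n3 n4 n5 n6 n7 n8 n9.
Qed.

End DerivativeCoefficients.

(** * Euler-Rayleigh bounds *)
Section EulerRayleighBounds.
Context {R : realType}.
Implicit Types (m x y : R) (s : nat -> R).

Lemma growth_lower s m k : growth_rate s m -> (forall n, s n.+1 < m * s n) ->
  m ^+ k.+1 < s k.
Proof.
move=> [m0 _ ms] strict; rewrite -(ltr_pM2l m0) -exprS.
exact: le_lt_trans (ms k.+1) (strict k).
Qed.

Lemma growth_upper s m k : (forall n, 0 < s n) -> 0 < m ->
  (forall n, s n.+1 < m * s n) -> m^-1 < s k / s k.+1.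
Proof.
by move=> s0 m0 strict; rewrite ltr_pdivlMr// mulrC ltr_pdivrMr// mulrC strict.
Qed.

Lemma powR_root_lower s m k : 0 < m -> m ^+ k.+1 < s k ->
  (s k)^-1 `^ (1 / (4 * k.+1%:R)) < m^-1 `^ (1 / 4).
Proof.
move=> m0 mk; have s0 : 0 < s k by apply: lt_trans mk; rewrite exprn_gt0.
have -> : m^-1 `^ (1 / 4) = ((m ^+ k.+1)^-1) `^ (1 / (4 * k.+1%:R)).
  rewrite -exprVn -powR_mulrn ?invr_ge0 ?(ltW m0)// -powRrM; congr (_ `^ _).
  by field; rewrite addrC natr1 pnatr_eq0.
have r0 : 0 < 1 / (4 * k.+1%:R) :> R by rewrite divr_gt0// mulr_gt0// ltr0n.
apply: (gt0_ltr_powR r0); rewrite ?nnegrE ?invr_ge0 ?exprn_ge0 ?(ltW m0) ?(ltW s0)//.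
by rewrite ltf_pV2 ?posrE ?exprn_gt0.
Qed.

Lemma powR_root_upper m x : 0 < m -> m^-1 < x -> m^-1 `^ (1 / 4) < x `^ (1 / 4).
Proof.
move=> m0 mx; have i0 : 0 < m^-1 by rewrite invr_gt0.
have r0 : 0 < 1 / 4 :> R by rewrite divr_gt0.
apply: (gt0_ltr_powR r0) => //; rewrite nnegrE ltW//.
exact: lt_trans mx.
Qed.

Variable nu : R.
Hypothesis hnu : - (1 / 2) < nu.

(** The lower bounds are [m ^+ k.+1 < s k] and the upper ones [s k.+1 < m * s k],
    with the values of [moment_values]. The very first bound relaxes the upper bound
    for [k = 0], by [4 (2 nu + 5) (nu + 4) (nu + 5) <= cubic]. *)
Lemma zero_bounds s m : newton s (hcoef nu) -> (forall n, 0 < s n) ->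
  growth_rate s m -> (forall n, s n.+1 < m * s n) ->
  let gamma := m^-1 `^ (1 / 4) in
  [/\ gamma < (4 * pochhammer (nu + 1) 3 * (2 * nu + 1)) `^ (1 / 4) &
        [/\ (16 * (2 * nu + 1) * pochhammer (nu + 1) 3 / (2 * nu + 5))
              `^ (1 / 4) < gamma,
            gamma < (16 * (2 * nu + 1) * (2 * nu + 5) * pochhammer (nu + 1) 5
                     / (20 * nu ^+ 3 + 184 * nu ^+ 2 + 529 * nu + 473))
                    `^ (1 / 4) &
        [/\ (2 ^+ 8 * (2 * nu + 1) ^+ 2 * pochhammer (nu + 1) 3
               * pochhammer (nu + 1) 5
             / (20 * nu ^+ 3 + 184 * nu ^+ 2 + 529 * nu + 473))
              `^ (1 / 8) < gamma,
            gamma < (8 * pochhammer (nu + 1) 3 * (nu + 6) * (nu + 7)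
                     * (2 * nu + 1)
                     * (20 * nu ^+ 3 + 184 * nu ^+ 2 + 529 * nu + 473)
                     / nu_1 nu) `^ (1 / 4),
            (2 ^+ 11 * (2 * nu + 1) ^+ 3 * pochhammer (nu + 1) 3 ^+ 2
               * pochhammer (nu + 1) 7 / nu_1 nu) `^ (1 / 12) < gamma &
            gamma < (32 * pochhammer (nu + 1) 5 * (nu + 8) * (nu + 9)
                     * (2 * nu + 1) * nu_1 nu / nu_2 nu) `^ (1 / 4)]]].
Proof.
move=> sp s0 gr strict gamma; have m0 : 0 < m by case: gr.
have [E0 E1 E2 E3] := moment_values hnu sp.
have lower k := powR_root_lower m0 (growth_lower k gr strict).
have upper k := growth_upper k s0 m0 strict.
set cubic := 20 * nu ^+ 3 + 184 * nu ^+ 2 + 529 * nu + 473 in E1 *.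
have pos k : 1 <= k -> nu + k != 0 by move=> k1; rewrite gt_eqF//; move: hnu; lra.
have n0 : 2 * nu + 1 != 0 by rewrite gt_eqF//; move: hnu; lra.
have n50 : 2 * nu + 5 != 0 by rewrite gt_eqF//; move: hnu; lra.
have [n1 n2 n3 n4 n5] : [/\ nu + 1 != 0, nu + 2 != 0, nu + 3 != 0, nu + 4 != 0 & nu + 5 != 0].
  by split; rewrite pos//; lra.
have [n6 n7 n8 n9] : [/\ nu + 6 != 0, nu + 7 != 0, nu + 8 != 0 & nu + 9 != 0].
  by split; rewrite pos//; lra.
have c0 : cubic != 0 by apply/eqP => c0; have := s0 1%N; rewrite E1 c0 mul0r ltxx.
have v1 : nu_1 nu != 0 by apply/eqP => c1; have := s0 2%N; rewrite E2 c1 mul0r ltxx.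
have v2 : nu_2 nu != 0 by apply/eqP => c2; have := s0 3%N; rewrite E3 c2 mul0r ltxx.
have U0 : s 0%N / s 1%N = 16 * (2 * nu + 1) * (2 * nu + 5) * pochhammer (nu + 1) 5 / cubic.
  rewrite E0 E1 pochhammer3 pochhammer5; clear E0 E1; move: cubic c0 => c c0.
  by field; rewrite c0 n0 n1 n2 n3 n4 n5.
have U1 : s 1%N / s 2%N = 8 * pochhammer (nu + 1) 3 * (nu + 6) * (nu + 7) *
    (2 * nu + 1) * cubic / nu_1 nu.
  rewrite E1 E2 pochhammer3 pochhammer5 pochhammer7; clear E1 E2 U0; move: cubic (nu_1 nu) c0 v1 => c v c0 v1.
  by field; rewrite v1 n0 n1 n2 n3 n4 n5 n6 n7.
have U2 : s 2%N / s 3%N = 32 * pochhammer (nu + 1) 5 * (nu + 8) * (nu + 9) *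
    (2 * nu + 1) * nu_1 nu / nu_2 nu.
  rewrite E2 E3 pochhammer3 pochhammer5 pochhammer7.
  clear E2 E3 U1; move: (nu_1 nu) (nu_2 nu) v1 v2 => v v' v1 v2.
  by field; rewrite v2 n0 n1 n2 n3 n4 n5 n6 n7 n8 n9.
split; last split.
- apply: powR_root_upper => //; apply: lt_le_trans (upper 0%N) _; rewrite U0.
  have c1 : 0 < cubic.
    have : 0 <= (2 * nu + 1) * nu ^+ 2 by rewrite mulr_ge0 ?sqr_ge0//; move: hnu; lra.
    have := sqr_ge0 nu; move: hnu; rewrite /cubic; lra.
  have key : 4 * (2 * nu + 5) * ((nu + 4) * (nu + 5)) <= cubic.
    have q0 : 0 <= 6 * nu ^+ 2 + 43 * nu + 73 by have := sqr_ge0 nu; move: hnu; lra.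
    have p0 : 0 <= 2 * nu + 1 by move: hnu; lra.
    have -> : cubic = 4 * (2 * nu + 5) * ((nu + 4) * (nu + 5)) +
        (2 * nu + 1) * (6 * nu ^+ 2 + 43 * nu + 73) by rewrite /cubic; ring.
    by rewrite lerDl mulr_ge0.
  rewrite ler_pdivrMr// pochhammer3 pochhammer5.
  have -> : 16 * (2 * nu + 1) * (2 * nu + 5) * ((nu + 1) * (nu + 2) * (nu + 3) *
      (nu + 4) * (nu + 5)) = 4 * ((nu + 1) * (nu + 2) * (nu + 3)) * (2 * nu + 1) *
      (4 * (2 * nu + 5) * ((nu + 4) * (nu + 5))) by ring.
  by apply: ler_wpM2l => //; rewrite !mulr_ge0//; move: hnu; lra.
- by have := lower 0%N; rewrite E0 invf_div mulr1.
- by have := powR_root_upper m0 (upper 0%N); rewrite U0.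
split.
- by have := lower 1%N; rewrite E1 invf_div (_ : 4 * 2%:R = 8)// -natrM.
- by have := powR_root_upper m0 (upper 1%N); rewrite U1.
- by have := lower 2%N; rewrite E2 invf_div (_ : 4 * 3%:R = 12)// -natrM.
- by have := powR_root_upper m0 (upper 2%N); rewrite U2.
Qed.

End EulerRayleighBounds.

(** * The two first zeros compared *)
Section Zeros.
Context {R : realType}.
Local Notation C := (Cplx R).
Implicit Types (x y r : R) (z w : C) (a s : nat -> R).

Lemma cps_natmul a z : asum (dcoef a) (cabs z) ->
  cps (fun n => n%:R * a n) z = z * cps (dcoef a) z.
Proof.
move=> az; apply: cps_eq.
have sc : series (fun n => toC (dcoef a n) * z ^+ n) \o predn @ \oo --> cps (dcoef a) z.
  apply: cvg_comp (cps_cvg az).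
  by apply/cvgnyPge => A; exists A.+1 => //= -[].
have -> : series (fun n => toC (n%:R * a n) * z ^+ n) =
    (fun N => z * (series (fun n => toC (dcoef a n) * z ^+ n) \o predn) N).
  apply/funext => -[|N]; rewrite /series/= ?big_nil ?mulr0// !big_mkord.
  rewrite big_ord_recl mul0r rmorph0 mul0r add0r mulr_sumr.
  by apply: eq_bigr => i _; rewrite lift0 /dcoef exprS; ring.
exact: (lim_mul (@lim_cst _ z) sc).
Qed.

Variable nu : R.
Hypothesis hnu : - (1 / 2) < nu.

Notation g := (gcoef nu).
Notation h := (hcoef nu).
Notation b := (beta nu).

Let g_ent r : 0 <= r -> asum g r. Proof. exact: gcoef_entire. Qed.
Let h_ent r : 0 <= r -> asum h r. Proof. exact: hcoef_entire. Qed.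

Lemma gcoef_moments : exists s m, [/\ newton s g, forall n, 0 < s n & growth_rate s m].
Proof.
have [s sp] := newton_exists (gcoef0 nu).
have ms : moment_like s.
  apply: (hyper_moment_like (k := 64^-1) _ (gxs_gt0 hnu) (bs := [::])) => //.
have s0 : 0 < s 0%N.
  by rewrite (newton0 (gcoef0 nu) sp); have := gcoef_alt hnu 1; rewrite expr1 mulN1r.
have s1 : 0 < s 1%N.
  have [n1 n2 n3 n4 n5] : [/\ 0 < nu + 1, 0 < nu + 2, 0 < nu + 3, 0 < nu + 4 & 0 < nu + 5].
    by split; move: hnu; lra.
  pose p1 := 16 * ((nu + 1) * (nu + 2) * (nu + 3)).
  pose p2 := 16 * ((nu + 2) * (nu + 4) * (nu + 5)).
  have p10 : 0 < p1 by rewrite !mulr_gt0.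
  have p20 : 0 < p2 by rewrite !mulr_gt0.
  have g1 : g 1 = - p1^-1.
    rewrite gcoef_step gcoef0 mulNr mul1r; congr (- _^-1).
    by rewrite /p1; ring.
  have g2 : g 2 = p1^-1 / (2 * p2).
    by rewrite gcoef_step g1 opprK; congr (_ / _); rewrite /p2; ring.
  rewrite (newton1 (gcoef0 nu) sp) (newton0 (gcoef0 nu) sp) g1 g2.
  have -> : - (2 * (p1^-1 / (2 * p2))) - - - p1^-1 * - p1^-1 = p1^-1 * (p1^-1 - p2^-1).
    by clearbody p1 p2; field; rewrite !gt_eqF.
  rewrite mulr_gt0 ?invr_gt0// subr_gt0 ltf_pV2 ?posrE ?mulr_gt0//.
  have -> : p2 = p1 + 16 * ((nu + 2) * (5 * nu + 17)) by rewrite /p1 /p2; ring.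
  by rewrite ltrDl !mulr_gt0//; move: hnu; lra.
have sgt0 := moment_gt0 ms s0 s1.
have [m gm] := moment_growth sgt0 ms.
by exists s, m.
Qed.

Lemma hcoef_moments : exists s m, [/\ newton s h, forall n, 0 < s n,
  growth_rate s m & forall n, s n.+1 < m * s n].
Proof.
have [s sp] := newton_exists (hcoef0 nu).
have ms : moment_like s.
  apply: (hyper_moment_like (k := 64^-1) _ (gxs_gt0 hnu) (bs := [:: b])) => //.
  by rewrite /= beta_gt0.
have [E0 E1 _ _] := moment_values hnu sp.
have s0 : 0 < s 0%N.
  by rewrite E0 divr_gt0 ?mulr_gt0 ?pochhammer_gt0//; move: hnu; lra.
have s1 : 0 < s 1%N.
  have c1 : 0 < 20 * nu ^+ 3 + 184 * nu ^+ 2 + 529 * nu + 473.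
    have : 0 <= (2 * nu + 1) * nu ^+ 2 by rewrite mulr_ge0 ?sqr_ge0//; move: hnu; lra.
    have := sqr_ge0 nu; move: hnu; lra.
  by rewrite E1 divr_gt0 ?mulr_gt0 ?exprn_gt0 ?pochhammer_gt0//; move: hnu; lra.
have sgt0 := moment_gt0 ms s0 s1.
have [m gm] := moment_growth sgt0 ms.
exists s, m; split=> // n.
exact: (growth_strict sgt0 ms gm sp (hcoef_alt hnu) (hcoef_decay hnu)).
Qed.

Lemma cps_hcoef z : cps h z = cps g z + toC b^-1 * (z * cps (dcoef g) z).
Proof.
have z0 := cabs_ge0 z.
have ng : asum (fun n => n%:R * g n) (cabs z).
  have [M HM] := dcoef_entire g_ent z0; exists (cabs z * M) => -[|N].
    by rewrite big_ord0 mulr_ge0//; have := HM 0%N; rewrite big_ord0.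
  rewrite big_ord_recl mul0r normr0 mul0r add0r.
  apply: le_trans (ler_wpM2l z0 (HM N)); rewrite mulr_sumr.
  by apply: ler_sum => i _; rewrite lift0 /dcoef exprS mulrCA.
rewrite -cps_natmul; last exact: dcoef_entire.
rewrite -cps_lin//; last exact: g_ent.
by congr cps; apply/funext => n; rewrite hcoefE; ring.
Qed.

Variables (sg sh : nat -> R) (mg mh : R).
Hypotheses (sgP : newton sg g) (sg0 : forall n, 0 < sg n) (gg : growth_rate sg mg).
Hypotheses (shP : newton sh h) (sh0 : forall n, 0 < sh n) (gh : growth_rate sh mh).

(** The quotient of the two series is [z f' / f] in the variable [z ^ 4], expressed
    by the power sums of [g]. *)
Lemma cps_hcoef_factor z : cabs z * mg < 1 ->
  cps h z = cps g z * (1 - toC b^-1 * (z * cps sg z)).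
Proof.
move=> zm; rewrite cps_hcoef (newton_deriv sg0 gg sgP g_ent zm); ring.
Qed.

(** On the positive axis both series are positive before their first zeros, and so
    is their quotient. *)
Lemma hcoef_gt0_bound x : 0 <= x -> x * mg < 1 -> x * mh < 1 ->
  x * complex.Re (cps sg (toC x)) < b.
Proof.
move=> x0 xg xh; have cx : cabs (toC x) = x by rewrite cabs_toC ger0_norm.
have b0 := beta_gt0 hnu.
have [y y0 gE] := cps_gt0 sg0 gg sgP (gcoef0 nu) g_ent x0 xg.
have [y' y'0 hE] := cps_gt0 sh0 gh shP (hcoef0 nu) h_ent x0 xh.
have := @cps_hcoef_factor (toC x); rewrite cx => /(_ xg); rewrite gE hE.
rewrite cps_toC; last by rewrite ger0_norm//; exact: growth_asum gg _ xg.
rewrite -!rmorphM -[1](rmorph1 (@toC R)) -rmorphB -rmorphM => /toC_inj.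
set t := complex.Re _ => E; have : 0 < y * (1 - b^-1 * (x * t)) by rewrite -E.
by rewrite pmulr_rgt0// subr_gt0 mulrC ltr_pdivrMr// mul1r.
Qed.

(** Otherwise the bound [hcoef_gt0_bound] would hold up to [mg^-1], near which the
    sum is unbounded by [growth_large]. *)
Lemma growth_lt : mg < mh.
Proof.
have [mg0 _ _] := gg; have b0 := beta_gt0 hnu.
rewrite ltNge; apply/negP => hg.
pose N := (`|Num.ceil (2 * b)|).+1%N.
have bN : 2 * b < N%:R by exact: lt_succ_ceil.
have /= := growth_large gg (ltn0Sn `|Num.ceil (2 * b)|); rewrite -/N.
set x := mg^-1 * _ => -[x0 xm xN].
have xh : x * mh < 1 by apply: le_lt_trans xm; rewrite ler_wpM2l// ltW.
have := hcoef_gt0_bound (ltW x0) xm xh.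
by have := sums_large sg0 gg N (ltW x0) xm; lra.
Qed.

End Zeros.

(** * The normalized root and its radius of starlikeness *)
Section NormalizedRoot.
Context {R : realType}.
Local Notation C := (Cplx R).
Implicit Types (x y r t : R) (z w : C) (f : C -> C).

Lemma root4K x : 0 <= x -> (x `^ (1 / 4)) ^+ 4 = x.
Proof.
move=> x0; rewrite -powR_mulrn ?powR_ge0// -powRrM.
by rewrite (_ : 1 / 4 * 4%:R = 1) ?powRr1//; field.
Qed.

Lemma lt_root4 x y : 0 <= y -> 0 <= x -> (y < x `^ (1 / 4)) = (y ^+ 4 < x).
Proof. by move=> y0 x0; rewrite -{2}(root4K x0) ltr_pXn2r// nnegrE ?powR_ge0. Qed.

Lemma is_derive_pow4 z : is_derive z 1 (fun w : C => w ^+ 4) (4 * z ^+ 3).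
Proof.
have d2 := is_derive_mul (is_derive_id z 1) (is_derive_id z 1).
have -> : (fun w : C => w ^+ 4) = (fun w => (w * w) * (w * w)).
  by apply/funext => w; ring.
by apply: (is_derive_eq (is_derive_mul d2 d2)); rewrite /=; ring.
Qed.

Lemma disc_open r z : cabs z < r -> \forall w \near z, cabs w < r.
Proof.
move=> zr; apply/nbhs_cabs; exists (r - cabs z); first by rewrite subr_gt0.
move=> w wz; have := ler_cabsD (w - z) z; rewrite subrK.
by move=> H; apply: le_lt_trans H _; rewrite -ltrBrDr.
Qed.

Lemma discE r z : disc r z <-> cabs z < r.
Proof. by rewrite /disc/= cabsE lt_toC. Qed.

Lemma derivable_is_derive f z : derivable f z 1 -> is_derive z 1 f (derive1 f z).
Proof. by move=> fz; rewrite derive1E; exact: derivableP. Qed.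

Variable nu : R.
Hypothesis hnu : - (1 / 2) < nu.

Notation g := (gcoef nu).
Notation h := (hcoef nu).
Notation b := (beta nu).

Variables (sg sh : nat -> R) (mg mh : R).
Hypotheses (sgP : newton sg g) (sg0 : forall n, 0 < sg n) (gg : growth_rate sg mg).
Hypotheses (shP : newton sh h) (sh0 : forall n, 0 < sh n) (gh : growth_rate sh mh).

Let b0 : 0 < b := beta_gt0 hnu.
Let mg0 : 0 < mg. Proof. by case: gg. Qed.
Let mh0 : 0 < mh. Proof. by case: gh. Qed.
Let g_ent r (r0 : 0 <= r) : asum g r := gcoef_entire hnu r0.
Let h_ent r (r0 : 0 <= r) : asum h r := hcoef_entire hnu r0.
Let n1 : 2 * nu + 1 != 0. Proof. by rewrite gt_eqF//; move: hnu; lra. Qed.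

(** The first positive zeros of the Wronskian ([rad_g]) and of its derivative
    ([rad_h]): fourth roots, because the two series are in [z ^ 4]. *)
Definition rad_g := mg^-1 `^ (1 / 4).
Definition rad_h := mh^-1 `^ (1 / 4).

Lemma rad_g_gt0 : 0 < rad_g. Proof. by rewrite powR_gt0// invr_gt0. Qed.
Lemma rad_h_gt0 : 0 < rad_h. Proof. by rewrite powR_gt0// invr_gt0. Qed.

Lemma in_rad_g z : cabs z < rad_g -> cabs (z ^+ 4) * mg < 1.
Proof.
rewrite lt_root4 ?cabs_ge0 ?invr_ge0 ?(ltW mg0)// -cabsX => zr.
by rewrite -ltr_pdivlMr// mul1r.
Qed.

Lemma in_rad_h z : cabs z < rad_h -> cabs (z ^+ 4) * mh < 1.
Proof.
rewrite lt_root4 ?cabs_ge0 ?invr_ge0 ?(ltW mh0)// -cabsX => zr.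
by rewrite -ltr_pdivlMr// mul1r.
Qed.

Lemma rad_lt : rad_h < rad_g.
Proof.
rewrite lt_root4 ?powR_ge0 ?invr_ge0 ?(ltW mg0)// root4K ?invr_ge0 ?(ltW mh0)//.
rewrite ltf_pV2 ?posrE//.
exact: (growth_lt hnu sgP sg0 gg shP sh0 gh).
Qed.

Lemma root_g : cps g (toC rad_g ^+ 4) = 0.
Proof.
rewrite -rmorphXn root4K ?invr_ge0 ?(ltW mg0)//.
exact: (cps_root sg0 gg sgP g_ent).
Qed.

Lemma root_h : cps h (toC rad_h ^+ 4) = 0.
Proof.
rewrite -rmorphXn root4K ?invr_ge0 ?(ltW mh0)//.
exact: (cps_root sh0 gh shP h_ent).
Qed.

(** The quantity [z f' / f] ([star_fnu]), with its limit 1 at the origin. *)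
Definition star z : C := 1 - toC b^-1 * (z ^+ 4 * cps sg (z ^+ 4)).

(** The power sums [sg] are positive, so that at given modulus the real part is
    smallest on the positive axis, where [hcoef_gt0_bound] applies. *)
Lemma star_gt0 z : cabs z < rad_h -> 0 < complex.Re (star z).
Proof.
move=> zh; have zg := in_rad_g (lt_trans zh rad_lt).
have zh' := in_rad_h zh; set w := z ^+ 4 in zg zh'.
have w0 := cabs_ge0 w.
have H := hcoef_gt0_bound hnu sgP sg0 gg shP sh0 gh w0 zg zh'.
rewrite /star ReD ReN Re_toCM /= subr_gt0 mulrC ltr_pdivrMr// mul1r.
apply: le_lt_trans H; apply: le_trans (le_trans (ler_norm _) (Re_le_cabs _)) _.
rewrite cabsM ler_wpM2l//; apply: cps_dominated; first by move=> n; exact: ltW.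
exact: (sums_asum sg0 gg zg).
Qed.

Lemma star_rad_h : star (toC rad_h) = 0.
Proof.
have cg : cabs (toC rad_h) < rad_g by rewrite cabs_toC gtr0_norm ?rad_h_gt0// rad_lt.
have := cps_hcoef_factor hnu sgP sg0 gg (in_rad_g cg); rewrite root_h => /esym/eqP.
by rewrite mulf_eq0 (negbTE (cps_neq0 sg0 gg sgP (gcoef0 nu) g_ent (in_rad_g cg))) => /eqP.
Qed.

Definition expo : R := 1 / (2 * nu + 1).

(** The power [z ^ (2 nu + 1)] is extracted before taking the root, so that no
    branch cut appears. *)
Definition froot z : C := z * cexp (toC expo * cps (logc sg) (z ^+ 4)).

Lemma is_derive_logz z : cabs z < rad_g ->
  is_derive z 1 (fun w => cps (logc sg) (w ^+ 4)) (- cps sg (z ^+ 4) * (4 * z ^+ 3)).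
Proof.
move=> /in_rad_g zg.
exact: (is_derive_comp (g := fun w : C => w ^+ 4) (is_derive_log sg0 gg zg) (is_derive_pow4 z)).
Qed.

Lemma is_derive_froot z : cabs z < rad_g ->
  is_derive z 1 froot (cexp (toC expo * cps (logc sg) (z ^+ 4)) * star z).
Proof.
move=> zg; have d1 := is_derive_mul (is_derive_cst (toC expo) z 1) (is_derive_logz zg).
have d2 := is_derive_comp (is_derive_cexp _) d1.
apply: (is_derive_eq (is_derive_mul (is_derive_id z 1) d2)).
rewrite /star /=; set E := cexp _.
have -> : toC b^-1 = 4 * toC expo.
  rewrite -(rmorph_nat (@toC R)) -rmorphM; congr toC.
  by rewrite /beta /expo; field; rewrite n1.
ring.
Qed.

Lemma star_froot z : z != 0 -> cabs z < rad_g ->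
  z * (cexp (toC expo * cps (logc sg) (z ^+ 4)) * star z) / froot z = star z.
Proof.
move=> z0 zg; have E0 := cexp_neq0 (toC expo * cps (logc sg) (z ^+ 4)).
rewrite /froot; move: (cexp _) E0 (star z) => E E0 s.
by field; rewrite z0 E0.
Qed.

Definition Kconst : R := 2 `^ (2 * nu) * Gamma (nu + 1) * Gamma (nu + 2).

Lemma Kconst_gt0 : 0 < Kconst.
Proof. by rewrite !mulr_gt0 ?powR_gt0 ?Gamma_gt0//; move: hnu; lra. Qed.

Let K0 : toC Kconst != 0.
Proof. by rewrite fmorph_eq0 gt_eqF ?Kconst_gt0. Qed.

Lemma Phi_neq0 z : slit_plane z -> cabs z < rad_g -> Phi nu z != 0.
Proof.
move=> sz zg; have := Phi_slit hnu sz; apply: contra_eq_neq => ->; rewrite mulr0 eq_sym.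
by rewrite mulf_neq0 ?cpow_neq0//; exact: (cps_neq0 sg0 gg sgP (gcoef0 nu) g_ent (in_rad_g zg)).
Qed.

Lemma slit_toC x : 0 < x -> slit_plane (toC x).
Proof. by move=> x0; right. Qed.

Lemma Phi_root : Phi nu (toC rad_g) = 0.
Proof.
have := Phi_slit hnu (slit_toC rad_g_gt0); rewrite root_g mulr0 => /eqP.
by rewrite mulf_eq0 (negbTE K0)/= => /eqP.
Qed.

(** The branch of the logarithm on the slit disc from which [froot] arises as a
    power ([froot_logPhi]). *)
Definition logPhi z : C := toC (2 * nu + 1) * clog z + cps (logc sg) (z ^+ 4).

Lemma is_derive_logPhi z : slit_plane z -> cabs z < rad_g ->
  is_derive z 1 logPhi (toC (2 * nu + 1) * z^-1 - cps sg (z ^+ 4) * (4 * z ^+ 3)).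
Proof.
move=> sz zg.
have d1 := is_derive_mul (is_derive_cst (toC (2 * nu + 1)) z 1) (is_derive_clog sz).
apply: (is_derive_eq (is_derive_add d1 (is_derive_logz zg))).
by rewrite /= mul0r addr0 mulNr.
Qed.

Lemma cexp_logPhi z : slit_plane z -> cabs z < rad_g ->
  cexp (logPhi z) = toC Kconst * Phi nu z.
Proof.
move=> sz zg; rewrite /Kconst (Phi_slit hnu sz) /logPhi cexpD.
by rewrite (cps_exp sg0 gg sgP (gcoef0 nu) g_ent (in_rad_g zg)).
Qed.

Lemma froot_logPhi z : z != 0 -> froot z = cexp (toC expo * logPhi z).
Proof.
move=> z0; have E : expo * (2 * nu + 1) = 1 by rewrite /expo mul1r mulVf.
by rewrite /logPhi mulrDr cexpD mulrA -rmorphM E rmorph1 mul1r clogK.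
Qed.

(** A disc without zeros of the Wronskian has radius at most [rad_g], because
    [rad_g] is a zero. *)
Lemma is_fnu_froot : is_fnu nu froot.
Proof.
have c0 : cabs (0 : C) < rad_g by rewrite cabs0 rad_g_gt0.
split.
- by rewrite /froot mul0r.
- apply: (is_derive_eq (is_derive_froot c0)).
  have l0 : logc sg 0 = 0 by [].
  by rewrite /star expr0n/= mul0r mulr0 subr0 mulr1 cps0 l0 rmorph0 mulr0 cexp0.
move=> r r0 Phi0.
have rg : r <= rad_g.
  rewrite leNgt; apply/negP => gr.
  have /discE dg : cabs (toC rad_g) < r by rewrite cabs_toC gtr0_norm// rad_g_gt0.
  by have := Phi0 _ dg (slit_toC rad_g_gt0); rewrite Phi_root eqxx.
have inr z : disc r z -> cabs z < rad_g by move=> /discE zr; exact: lt_le_trans rg.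
split; first by move=> z /inr zg; have [] := is_derive_froot zg.
exists logPhi; split.
- by move=> z [/inr zg sz]; have [] := is_derive_logPhi sz zg.
- by move=> z [/inr zg sz]; exact: cexp_logPhi.
- by move=> z [/inr zg sz]; rewrite froot_logPhi ?slit_neq0.
Qed.

Lemma slit_star x z t : 0 < x -> slit_plane z -> 0 <= t <= 1 ->
  slit_plane (toC x + toC t * (z - toC x)).
Proof.
move=> x0 sz /andP[t0 t1].
have ImE : complex.Im (toC x + toC t * (z - toC x)) = t * complex.Im z.
  by rewrite ImD Im_toCM ImD ImN /= oppr0 addr0 add0r.
have ReE : complex.Re (toC x + toC t * (z - toC x)) = (1 - t) * x + t * complex.Re z.
  by rewrite ReD Re_toCM ReD ReN /=; ring.
have [->|tn0] := eqVneq t 0; first by rewrite rmorph0 mul0r addr0; exact: slit_toC.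
have {}t0 : 0 < t by rewrite lt0r tn0.
case: sz => [zi|zr]; [left|right]; first by rewrite ImE mulf_neq0.
by rewrite ReE ltr_wpDl ?mulr_gt0// mulr_ge0 ?subr_ge0// ltW.
Qed.

Lemma disc_star x z t r : 0 < x < r -> cabs z < r -> 0 <= t <= 1 ->
  cabs (toC x + toC t * (z - toC x)) < r.
Proof.
move=> /andP[x0 xr] zr /andP[t0 t1].
have -> : toC x + toC t * (z - toC x) = toC ((1 - t) * x) + toC t * z.
  by rewrite rmorphM rmorphB rmorph1; ring.
apply: le_lt_trans (ler_cabsD _ _) _; rewrite cabsM !cabs_toC.
rewrite (ger0_norm t0) ger0_norm ?mulr_ge0 ?subr_ge0 ?(ltW x0)//.
have [->|tn0] := eqVneq t 0; first by rewrite subr0 mul1r mul0r addr0.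
have {}t0 : 0 < t by rewrite lt0r tn0.
have H1 : t * cabs z < t * r by rewrite ltr_pM2l.
have H2 : (1 - t) * x <= (1 - t) * r by rewrite ler_wpM2l ?subr_ge0// ltW.
have -> : r = (1 - t) * r + t * r by ring.
exact: ler_ltD.
Qed.

(** Two logarithms of the same function have the same derivative, so they differ by
    a constant on the slit disc, which is star-shaped about each of its positive
    points. The two roots are therefore proportional there, and on the cut by
    continuity. *)
Lemma fnu_unique f : is_fnu nu f ->
  exists2 k : C, k != 0 & forall z, cabs z < rad_g -> f z = k * froot z.
Proof.
move=> [_ _ fP].
have [|f_hol [L [L_hol LP fL]]] := fP rad_g rad_g_gt0.
  by move=> z /discE zg sz; exact: Phi_neq0.
have inU z : slit_plane z -> cabs z < rad_g -> (disc rad_g `&` slit_plane) z.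
  by move=> sz zg; split=> //; apply/discE.
pose x := rad_g / 2.
have x0 : 0 < x < rad_g.
  by have := rad_g_gt0; rewrite /x => ?; apply/andP; split; lra.
have /andP[x00 _] := x0.
pose D z := L z - logPhi z.
have D_cst z : slit_plane z -> cabs z < rad_g -> D z = D (toC x).
  move=> sz zg; apply: cst_on_segment => t t01.
  have sw := slit_star x00 sz t01; have wg := disc_star x0 zg t01.
  set w := _ + _ in sw wg *.
  have dL := derivable_is_derive (L_hol _ (inU _ sw wg)).
  have dP := is_derive_logPhi sw wg.
  have dEL := is_derive_comp (is_derive_cexp (L w)) dL.
  have dEP := is_derive_comp (is_derive_cexp (logPhi w)) dP.
  have eqE : \forall v \near w, cexp (logPhi v) = cexp (L v).
    have : \forall v \near w, slit_plane v /\ cabs v < rad_g.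
      exact: filterI (slit_open sw) (disc_open wg).
    apply: filterS => v [sv vg].
    by rewrite cexp_logPhi// LP//; exact: inU.
  have := derive1_val (near_eq_is_derive eqE dEP); rewrite (derive1_val dEL).
  rewrite -(nbhs_singleton eqE) => /(mulfI (cexp_neq0 _)) LE.
  have dN := is_derive_mul (is_derive_cst (- 1 : C) w 1) dP.
  have -> : D = (fun v => L v + (- 1) * logPhi v).
    by apply/funext => v; rewrite mulN1r.
  by apply: (is_derive_eq (is_derive_add dL dN)); rewrite LE /=; ring.
have on_slit z : slit_plane z -> cabs z < rad_g ->
    f z = cexp (toC expo * D (toC x)) * froot z.
  move=> sz zg; rewrite fL; last exact: inU.
  rewrite froot_logPhi ?slit_neq0// -cexpD -mulrDr -(D_cst z)// /D subrK.
  by [].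
set k := cexp _ in on_slit; exists k; first exact: cexp_neq0.
move=> z zg; have [sz|nsz] := pselect (slit_plane z); first exact: on_slit.
have zi : complex.Im z = 0 by apply/eqP/negP => zi; apply: nsz; left; apply/negP.
apply/eqP; rewrite -subr_eq0 -cabs_eq0 eq_le cabs_ge0 andbT.
apply/ler_addgt0Pr => e e0; rewrite add0r.
have k1 : 0 < 1 + cabs k by rewrite ltr_pwDl// cabs_ge0.
have ek : 0 < e / (1 + cabs k) by rewrite divr_gt0.
have cf : {for z, continuous f}.
  by apply: (is_derive_continuous (derivable_is_derive (f_hol _ _))); apply/discE.
have cr := is_derive_continuous (is_derive_froot zg).
have /continuous_cabs/(_ _ ek)[d1 d10 H1] := cf.
have /continuous_cabs/(_ _ ek)[d2 d20 H2] := cr.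
pose t := Num.min (Num.min d1 d2) (rad_g - cabs z) / 2.
have m0 : 0 < Num.min (Num.min d1 d2) (rad_g - cabs z).
  by rewrite !lt_min d10 d20 subr_gt0.
have t0 : 0 < t by rewrite divr_gt0.
have tm : t < Num.min (Num.min d1 d2) (rad_g - cabs z).
  by rewrite /t ltr_pdivrMr// ltr_pMr// ltr1n.
move: tm; rewrite !lt_min => /andP[/andP[td1 td2] tz].
(* A point of the slit plane next to the real number [z]. *)
pose w : C := z + 'i%C * toC t.
have wz : cabs (w - z) = t by rewrite /w addrAC subrr add0r cabsM cabs_i mul1r cabs_toC gtr0_norm.
have sw : slit_plane w.
  by left; rewrite /w ImD zi add0r ImM/= mul0r mul1r add0r gt_eqF.
have wg : cabs w < rad_g.
  have := ler_cabsD (w - z) z; rewrite subrK wz => H; apply: le_lt_trans H _.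
  by rewrite -ltrBrDr.
have := H1 w; rewrite wz => /(_ td1) {}H1; have := H2 w; rewrite wz => /(_ td2) {}H2.
have -> : f z - k * froot z = k * (froot w - froot z) - (f w - f z).
  have aux (A B F : C) : F - B = (A - B) - (A - F) by ring.
  by rewrite mulrBr (on_slit w sw wg); exact: aux.
apply: le_trans (ler_cabsD _ _) _; rewrite cabsN cabsM.
have -> : e = cabs k * (e / (1 + cabs k)) + e / (1 + cabs k).
  by field; rewrite gt_eqF.
by apply: lerD; [apply: ler_wpM2l; [exact: cabs_ge0|exact: ltW]|exact: ltW].
Qed.

Lemma star_fnu f z : is_fnu nu f -> z != 0 -> cabs z < rad_g ->
  z * derive1 f z / f z = star z.
Proof.
move=> /fnu_unique[k k0 fE] z0 zg; rewrite (fE z zg).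
have -> : derive1 f z = k * (cexp (toC expo * cps (logc sg) (z ^+ 4)) * star z).
  apply: derive1_val.
  have := is_derive_mul (is_derive_cst k z 1) (is_derive_froot zg).
  rewrite mul0r addr0; apply: near_eq_is_derive; have := disc_open zg.
  by apply: filterS => w /fE ->.
rewrite -[RHS](star_froot z0 zg) [z * (k * _)]mulrCA invfM.
by rewrite mulrACA divff// mul1r mulrA.
Qed.

(** The quantity [star] has positive real part inside [rad_h] and vanishes at
    [rad_h], so that no larger disc qualifies. *)
Lemma radius_fnu f : is_fnu nu f -> radius_of_starlikeness f = rad_h%:E.
Proof.
move=> fP; apply/eqP; rewrite eq_le; apply/andP; split.
  apply: ge_ereal_sup => _ [r [r0 rP] <-]; rewrite lee_fin leNgt; apply/negP => hr.
  have zn0 : toC rad_h != 0 by rewrite fmorph_eq0 gt_eqF ?rad_h_gt0.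
  have cz : cabs (toC rad_h) = rad_h by rewrite cabs_toC gtr0_norm ?rad_h_gt0.
  have := rP _ zn0; rewrite star_fnu ?cz ?rad_lt// star_rad_h ltxx => H.
  by have : false by apply: H; apply/discE; rewrite cz.
apply: ereal_sup_ubound; exists rad_h => //; split; first exact: rad_h_gt0.
move=> z z0 /discE zh; rewrite star_fnu//; last exact: lt_trans rad_lt.
exact: star_gt0.
Qed.

Lemma radius_of_fnu : radius_of_starlikeness (fnu nu) = rad_h%:E.
Proof.
rewrite /fnu; case: pselect => [fP|]; last by case; exists froot; exact: is_fnu_froot.
by apply: radius_fnu; exact: projT2 (cid fP).
Qed.

(** The derivative of [z ^ (2 nu + 1) G(z ^ 4)] is [(2 nu + 1) z ^ (2 nu)] times
    [G + beta^-1 w G'] at [w = z ^ 4], which is the series of [hcoef]. *)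
Lemma derive1_Phi z : slit_plane z -> derive1 (Phi nu) z =
  (toC Kconst)^-1 * toC (2 * nu + 1) * (cpow z (2 * nu + 1) / z) * cps h (z ^+ 4).
Proof.
move=> sz; have z0 := slit_neq0 sz; apply: derive1_val.
have dg : is_derive (z ^+ 4) 1 (cps g) (cps (dcoef g) (z ^+ 4)).
  exact: (is_derive_entire _ g_ent).
have d1 := is_derive_comp (g := fun w : C => w ^+ 4) dg (is_derive_pow4 z).
have d2 := is_derive_mul (is_derive_cpow (2 * nu + 1) sz) d1.
have d3 := is_derive_mul (is_derive_cst (toC Kconst)^-1 z 1) d2.
have eqP : \forall w \near z, (toC Kconst)^-1 *
    (cpow w (2 * nu + 1) * cps g (w ^+ 4)) = Phi nu w.
  have := slit_open sz; apply: filterS => w sw.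
  by rewrite -(Phi_slit hnu sw) mulKf.
apply: (is_derive_eq (near_eq_is_derive eqP d3)).
rewrite cps_hcoef// /=.
have -> : toC b^-1 = 4 / toC (2 * nu + 1).
  by rewrite -(rmorph_nat (@toC R)) -fmorphV -rmorphM /beta invf_div.
have t0 : toC (2 * nu + 1) != 0 by rewrite fmorph_eq0.
move: (toC (2 * nu + 1)) t0 (toC Kconst) K0 => t t0 k k0.
by field; rewrite t0 k0 z0.
Qed.

Lemma first_zero_Phi' : first_positive_zero (derive1 (Phi nu)) rad_h.
Proof.
split; first exact: rad_h_gt0.
  by rewrite derive1_Phi; [rewrite root_h mulr0|exact: slit_toC rad_h_gt0].
move=> y /andP[y0 yh]; rewrite derive1_Phi; last exact: slit_toC.
have yc : cabs (toC y) < rad_h by rewrite cabs_toC gtr0_norm.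
rewrite mulf_neq0//; last exact: (cps_neq0 sh0 gh shP (hcoef0 nu) h_ent (in_rad_h yc)).
have y1 : (toC y)^-1 != 0 by rewrite invr_eq0 fmorph_eq0 gt_eqF.
have k1 : (toC Kconst)^-1 != 0 by rewrite invr_eq0.
have t1 : toC (2 * nu + 1) != 0 by rewrite fmorph_eq0.
exact: mulf_neq0 (mulf_neq0 k1 t1) (mulf_neq0 (cpow_neq0 _ _) y1).
Qed.

End NormalizedRoot.

Theorem theorem6 (R : realType) (nu : R) (hnu : - (1 / 2) < nu) :
  exists gamma : R,
    [/\ radius_of_starlikeness (fnu nu) = gamma%:E,
        first_positive_zero (derive1 (Phi nu)) gamma,
        gamma < (4 * pochhammer (nu + 1) 3 * (2 * nu + 1)) `^ (1 / 4) &
        [/\ (16 * (2 * nu + 1) * pochhammer (nu + 1) 3 / (2 * nu + 5))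
              `^ (1 / 4) < gamma,
            gamma < (16 * (2 * nu + 1) * (2 * nu + 5) * pochhammer (nu + 1) 5
                     / (20 * nu ^+ 3 + 184 * nu ^+ 2 + 529 * nu + 473))
                    `^ (1 / 4) &
        [/\ (2 ^+ 8 * (2 * nu + 1) ^+ 2 * pochhammer (nu + 1) 3
               * pochhammer (nu + 1) 5
             / (20 * nu ^+ 3 + 184 * nu ^+ 2 + 529 * nu + 473))
              `^ (1 / 8) < gamma,
            gamma < (8 * pochhammer (nu + 1) 3 * (nu + 6) * (nu + 7)
                     * (2 * nu + 1)
                     * (20 * nu ^+ 3 + 184 * nu ^+ 2 + 529 * nu + 473)
                     / nu_1 nu) `^ (1 / 4),
            (2 ^+ 11 * (2 * nu + 1) ^+ 3 * pochhammer (nu + 1) 3 ^+ 2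
               * pochhammer (nu + 1) 7 / nu_1 nu) `^ (1 / 12) < gamma &
            gamma < (32 * pochhammer (nu + 1) 5 * (nu + 8) * (nu + 9)
                     * (2 * nu + 1) * nu_1 nu / nu_2 nu) `^ (1 / 4)]]].
Proof.
have [sg [mg [sgP sg0 gg]]] := gcoef_moments hnu.
have [sh [mh [shP sh0 gh strict]]] := hcoef_moments hnu.
have [H1 H2] := zero_bounds hnu shP sh0 gh strict.
exists (mh^-1 `^ (1 / 4)); split=> //.
  exact: (radius_of_fnu hnu sgP sg0 gg shP sh0 gh).
exact: (first_zero_Phi' hnu shP sh0 gh).
Qed.
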